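(* Let $\mathbb{D}\subset\mathbb{C}$ be the open unit disc, let $g$ be a nonconstant, nonvanishing, bounded holomorphic function on $\mathbb{D}$, and let $$\Omega_g=\left\{(z_1,z_2)\in\mathbb{C}^2 \;:\; z_1\in\mathbb{D},\ |z_2|<|g(z_1)|\right\}.$$ Suppose that the Bergman projection $\mathbf{B}_{\Omega_g}$ of $\Omega_g$ is bounded from $W^k(\Omega_g)$ to itself for all integers $k\geq 0$. Then the closure of $\Omega_g$ admits a Stein neighborhood basis.
   Context: $W^k(\Omega_g)$ denotes the $L^2$ Sobolev space of order $k$ of functions on $\Omega_g$ (so $W^0(\Omega_g)=L^2(\Omega_g)$, with respect to Lebesgue measure). The Bergman projection $\mathbf{B}_{\Omega_g}$ is the orthogonal projection from $L^2(\Omega_g)$ onto the closed subspace $L^2_a(\Omega_g)$ of square integrable holomorphic functions on $\Omega_g$. The closure of a domain $\Omega\subset\mathbb{C}^n$ is said to have (admit) a Stein neighborhood basis if for every neighborhood $\mathcal{U}$ of $\overline{\Omega}$ there exists a pseudoconvex domain $\mathcal{W}$ such that $\overline{\Omega}\subset\subset\mathcal{W}\subset\subset\mathcal{U}$, where $\subset\subset$ means relatively compact inclusion. *)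

(* Defs.v *)
From HB Require Import structures.
From mathcomp Require Import all_boot all_order all_algebra.
From mathcomp Require Import complex.
From mathcomp Require Import all_classical all_reals all_analysis.

Set Implicit Arguments.
Unset Strict Implicit.
Unset Printing Implicit Defensive.
Import Order.TTheory GRing.Theory Num.Theory.
Import numFieldNormedType.Exports.
Local Open Scope complex_scope.
Local Open Scope classical_set_scope.
Local Open Scope ring_scope.

(* No usable canonical sigma-finite instance is inferred for m1 \x m2. *)
Lemma sigma_finite_product d1 d2 (T1 : measurableType d1)
    (T2 : measurableType d2) (R : realType)
    (m1 : {sigma_finite_measure set T1 -> \bar R})
    (m2 : {sigma_finite_measure set T2 -> \bar R}) :
  sigma_finite setT (m1 \x m2)%E.
Proof.
have /sigma_finiteP[F [TF ndF Foo]] := sigma_finiteT m1.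
have /sigma_finiteP[G [TG ndG Goo]] := sigma_finiteT m2.
exists (fun n => F n `*` G n).
  rewrite -setXTT TF TG predeqE => -[x y]; split.
    move=> [/= [n _ Fnx] [k _ Gky]]; exists (maxn n k) => //; split.
    - by move: x Fnx; exact/subsetPset/ndF/leq_maxl.
    - by move: y Gky; exact/subsetPset/ndG/leq_maxr.
  by move=> [n _ []/= ? ?]; split; exists n.
move=> k; have [? ?] := Foo k; have [? ?] := Goo k.
split; first exact: measurableX.
by rewrite product_measure1E// lte_mul_pinfty// ge0_fin_numE.
Qed.

Section Definitions.
Context {R : realType}.

(* R[i] in its regular form, so that C and C * C are normed spaces over C. *)
Notation C := (R[i]^o)%type.
Notation C2 := (C * C)%type.

(* Real coordinates ((x1, y1), (x2, y2)) of the point (x1 + i y1, x2 + i y2);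
   they carry Lebesgue measure and the real partial derivatives. *)
Notation R4 := ((R * R) * (R * R))%type.

Definition toC2 (p : R4) : C2 := (p.1.1 +i* p.1.2, p.2.1 +i* p.2.2).

Definition lebesgue2 := (@lebesgue_measure R \x @lebesgue_measure R)%E.
HB.instance Definition _ := Measure.on lebesgue2.
HB.instance Definition _ := Measure_isSigmaFinite.Build _ _ _ lebesgue2
  (@sigma_finite_product _ _ _ _ _ _ _).

Definition lebesgue4 := (lebesgue2 \x lebesgue2)%E.
HB.instance Definition _ := Measure.on lebesgue4.
HB.instance Definition _ := Measure_isSigmaFinite.Build _ _ _ lebesgue4
  (@sigma_finite_product _ _ _ _ _ _ _).

Definition integralC (D : set R4) (F : R4 -> C) : C :=
  (\int[lebesgue4]_(p in D) complex.Re (F p)) +i*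
  (\int[lebesgue4]_(p in D) complex.Im (F p)).

(* Elements of the function spaces on W are represented by functions defined
   on all of C^2, of which only the restriction to W matters. *)
Definition sqnorm (W : set C2) (f : C2 -> C) : \bar R :=
  (\int[lebesgue4]_(p in toC2 @^-1` W)
     (complex.Re (f (toC2 p)) ^+ 2 + complex.Im (f (toC2 p)) ^+ 2)%:E)%E.

Definition L2 (W : set C2) (f : C2 -> C) : Prop :=
  [/\ measurable_fun (toC2 @^-1` W) (fun p : R4 => complex.Re (f (toC2 p))),
      measurable_fun (toC2 @^-1` W) (fun p : R4 => complex.Im (f (toC2 p)))
    & (sqnorm W f < +oo)%E].

Definition inner (W : set C2) (f h : C2 -> C) : C :=
  integralC (toC2 @^-1` W) (fun p => f (toC2 p) * conjc (h (toC2 p))).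

(* V is normed over R[i], so the differential is complex linear. *)
Definition holomorphic (V : normedModType R[i]) (D : set V) (f : V -> C) :=
  forall z, D z -> differentiable f z.

Definition L2a (W : set C2) (f : C2 -> C) : Prop := L2 W f /\ holomorphic W f.

(* Determined only up to its values outside W; the default value 0 is never
   taken for f in L2 W, as L2a W is a closed subspace. *)
Definition bergman_projection (W : set C2) (f : C2 -> C) : C2 -> C :=
  xget (fun=> 0)
    [set h | L2a W h /\ forall u, L2a W u -> inner W (f \- h) u = 0].

Definition basis4 (i : 'I_4) : R4 :=
  (((i == 0 :> nat)%:R, (i == 1 :> nat)%:R),
   ((i == 2 :> nat)%:R, (i == 3 :> nat)%:R)).

Definition partial (i : 'I_4) (phi : R4 -> R) : R4 -> R :=
  fun p => 'D_(basis4 i) phi p.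

Definition partials (alpha : 'I_4 -> nat) (phi : R4 -> R) : R4 -> R :=
  foldr (fun i h => iter (alpha i) (partial i) h) phi (enum 'I_4).

Definition smooth (phi : R4 -> R) : Prop :=
  forall (s : seq 'I_4) (p : R4), differentiable (foldr partial phi s) p.

Definition test_function (D : set R4) (phi : R4 -> R) : Prop :=
  [/\ smooth phi, compact (closure [set p | phi p != 0])
    & closure [set p | phi p != 0] `<=` D].

Definition is_weak_derivative (W : set C2) (alpha : 'I_4 -> nat)
    (f h : C2 -> C) : Prop :=
  forall phi, test_function (toC2 @^-1` W) phi ->
    integralC (toC2 @^-1` W) (fun p => f (toC2 p) * (partials alpha phi p)%:C) =
    (-1) ^+ (\sum_i alpha i)%N *
      integralC (toC2 @^-1` W) (fun p => h (toC2 p) * (phi p)%:C).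

Definition sobolev (W : set C2) (k : nat) (f : C2 -> C) : Prop :=
  L2 W f /\
  forall alpha : 'I_4 -> nat, (\sum_i alpha i <= k)%N ->
    exists h, L2 W h /\ is_weak_derivative W alpha f h.

Definition weak_derivative (W : set C2) (alpha : 'I_4 -> nat) (f : C2 -> C) :
    C2 -> C :=
  xget (fun=> 0) [set h | L2 W h /\ is_weak_derivative W alpha f h].

(* The multi-indices of order at most k all have entries in 'I_k.+1. *)
Definition sobolev_norm (W : set C2) (k : nat) (f : C2 -> C) : R :=
  Num.sqrt (\sum_(alpha : {ffun 'I_4 -> 'I_k.+1} | (\sum_i alpha i <= k)%N)
              fine (sqnorm W (weak_derivative W (fun i => alpha i) f))).

Definition sobolev_bounded (W : set C2) (k : nat)
    (T : (C2 -> C) -> (C2 -> C)) : Prop :=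
  exists M : R, forall f, sobolev W k f ->
    sobolev W k (T f) /\ sobolev_norm W k (T f) <= M * sobolev_norm W k f.

Definition expi (t : R) : C := cos t +i* sin t.

Definition continuous_psh (W : set C2) (phi : C2 -> R) : Prop :=
  {within W, continuous phi} /\
  forall z w : C2, (forall t : C, `|t| <= 1 -> W (z + t *: w)) ->
    phi z <= (2 * pi)^-1 *
      \int[@lebesgue_measure R]_(t in `[0, 2 * pi]) phi (z + expi t *: w).

Definition relatively_compact (A B : set C2) : Prop :=
  precompact A /\ closure A `<=` B.

(* phi is a continuous plurisubharmonic exhaustion function of W; for open
   sets this is the same as being a domain of holomorphy (Oka). *)
Definition pseudoconvex_domain (W : set C2) : Prop :=
  [/\ W !=set0, open W, connected W
    & exists phi : C2 -> R, continuous_psh W phi /\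
        forall c : R, relatively_compact [set z | W z /\ phi z < c] W].

Definition stein_neighborhood_basis (K : set C2) : Prop :=
  forall U : set C2, set_nbhs K U ->
    exists W : set C2, [/\ pseudoconvex_domain W, relatively_compact K W
                         & relatively_compact W U].

Definition disc : set C := [set z | `|z| < 1].

Definition hartogs (g : C -> C) : set C2 :=
  [set z | disc z.1 /\ `|z.2| < `|g z.1|].

End Definitions.

(* Main.v *)
(* Write k = 1/g^2, so that Omega_g = {|z1| < 1, |z2^2 k(z1)| < 1}.

   Regularity of the Bergman projection forces k to be Lipschitz under
   dilations.  If c is a smooth compactly supported radial function on the disc
   with mean 1, then f = c(z1) z2 k(z1) lies in every W^n, and its Bergman
   projection is T = z2 k(z1): after the fiberwise change of variables
   z2 = g(z1) w, orthogonality of f - T to holomorphic functions is the mean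
   value property on circles.  Hence T lies in W^6, and in particular
   d_{z2} T = k and d_{z1}^5 d_{z2} T = k^(5) are in L^2(Omega_g).  The first
   bound says that the integral of |g|^2 |k|^2 = 1/|g|^2 over the disc is
   finite.  Testing the second one against conj(z1)^m |g|^-2, whose L^2 norm is
   controlled by the first, bounds the Taylor coefficients of k by C/n^3, so
   |k(s z) - k(z)| <= L (1 - s) for 0 <= s <= 1.

   As |k| is bounded below by m0 > 0, the holomorphic functions F1 = s z1 and
   F2 = s^(N+1) z2^2 k(s z1), where N >= L/m0, satisfy |F1|, |F2| <= s on
   Omega_g.  So {|F1| < 1, |F2| < 1} is a neighbourhood of the closure of
   Omega_g; it shrinks to that closure as s tends to 1, and
   1/(1 - |F1|) + 1/(1 - |F2|) is a plurisubharmonic exhaustion of it. *)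
Require Import Defs.
From HB Require Import structures.
From mathcomp Require Import all_boot all_order all_algebra.
From mathcomp Require Import complex ring lra.
From mathcomp Require Import all_classical all_reals all_analysis.
From mathcomp Require Import measurable_realfun.

Set Implicit Arguments.
Unset Strict Implicit.
Unset Printing Implicit Defensive.
Import Order.TTheory GRing.Theory Num.Theory.
Import numFieldNormedType.Exports.
Import ComplexField.Normc.
Local Open Scope complex_scope.
Local Open Scope classical_set_scope.
Local Open Scope ring_scope.

(** * Complex differentiation and integration *)

(** The source is built from k = 1/g^2 because the substitution z2 = g w has Jacobian |g|^2 and
    |g|^2 g k = conj(g). Paired with a holomorphic u, the integrand for fixed w is thus the
    conjugate of a holomorphic function of z1 times the radial factor c - 1.

    The number of derivatives is an exponent count. The test mass that isolates the m-th coefficient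
    is only bounded below by a constant times (m+1)^-2, so the L^2 bounds let the coefficients of
    k^(5) grow like (m+1)^2. Undoing five derivatives gains (m+1)^5, and the resulting cubic decay
    is what makes the sum of n |a_n| converge.

    The obstacle is that the projection is identified only almost everywhere and its derivatives
    only weakly, while nothing is known near |z1| = 1. Every estimate is therefore a pairing with a
    compactly supported function, with bounds that do not depend on the cutoff parameter e. The a
    priori finiteness that the cutoff provides is also what allows the integral of 1/|g|^2 to be
    absorbed into the left-hand side. *)

Section Normc.
Context {R : realType}.
Implicit Types (z w : R[i]) (x y : R).

Lemma normcE z : `|z| = (normc z)%:C. Proof. by []. Qed.

Lemma normc_ge0 z : 0 <= normc z.
Proof. by case: z => a b /=; rewrite sqrtr_ge0. Qed.

Lemma normcD z w : normc (z + w) <= normc z + normc w.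
Proof. by have := ler_normD z w; rewrite !normcE -rmorphD lecR. Qed.

Lemma normcN z : normc (- z) = normc z.
Proof. by case: z => a b /=; rewrite !sqrrN. Qed.

Lemma normcB z w : normc (z - w) <= normc z + normc w.
Proof. by rewrite -(normcN w); exact: normcD. Qed.

Lemma normcBC z w : normc (z - w) = normc (w - z).
Proof. by rewrite -normcN opprB. Qed.

Lemma normc_dist z w : normc z - normc w <= normc (z - w).
Proof. by rewrite lerBlDr -{1}(subrK w z) normcD. Qed.

Lemma normc_real x : normc x%:C = `|x|.
Proof. by rewrite /= expr0n /= addr0 sqrtr_sqr. Qed.

Lemma normcX z n : normc (z ^+ n) = normc z ^+ n.
Proof. by elim: n => [|n IH]; rewrite ?expr0 ?normc1 // !exprS normcM IH. Qed.

Lemma normc_eq0 z : (normc z == 0) = (z == 0).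
Proof. by apply/eqP/eqP => [/eq0_normc//|->]; rewrite normc0. Qed.

Lemma normc_gt0 z : (0 < normc z) = (z != 0).
Proof. by rewrite lt_def normc_ge0 andbT normc_eq0. Qed.

Lemma Re_normc z : `|complex.Re z| <= normc z.
Proof. by case: z => a b /=; rewrite -sqrtr_sqr ler_wsqrtr // lerDl sqr_ge0. Qed.

Lemma Im_normc z : `|complex.Im z| <= normc z.
Proof. by case: z => a b /=; rewrite -sqrtr_sqr ler_wsqrtr // lerDr sqr_ge0. Qed.

Lemma normc_ReIm z : normc z <= `|complex.Re z| + `|complex.Im z|.
Proof.
case: z => a b /=; rewrite -[leRHS]ger0_norm ?addr_ge0// -sqrtr_sqr ler_sqrt ?sqr_ge0//.
rewrite sqrrD !real_normK ?num_real// -addrA [_ *+ 2 + _]addrC addrA lerDl.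
by rewrite mulrn_wge0 // mulr_ge0.
Qed.

Lemma normc_sqr z : normc z ^+ 2 = complex.Re z ^+ 2 + complex.Im z ^+ 2.
Proof. by case: z => a b /=; rewrite sqr_sqrtr // addr_ge0 ?sqr_ge0. Qed.

Lemma cReD z w : complex.Re (z + w) = complex.Re z + complex.Re w.
Proof. by case: z w => [? ?] []. Qed.
Lemma cImD z w : complex.Im (z + w) = complex.Im z + complex.Im w.
Proof. by case: z w => [? ?] []. Qed.
Lemma cReN z : complex.Re (- z) = - complex.Re z.
Proof. by case: z. Qed.
Lemma cImN z : complex.Im (- z) = - complex.Im z.
Proof. by case: z. Qed.
Lemma cReM z w : complex.Re (z * w) =
  complex.Re z * complex.Re w - complex.Im z * complex.Im w.
Proof. by case: z w => [? ?] []. Qed.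
Lemma cImM z w : complex.Im (z * w) =
  complex.Re z * complex.Im w + complex.Im z * complex.Re w.
Proof. by case: z w => [? ?] []. Qed.

Lemma eq_complexP z w :
  complex.Re z = complex.Re w -> complex.Im z = complex.Im w -> z = w.
Proof. by case: z w => [? ?] [? ?] /= -> ->. Qed.

End Normc.

Section Differentiation.
Context {R : realType}.
Notation C := (R[i]).
Implicit Types (F G : C -> C) (z w d : C).

Definition ccont F z := forall e : R, 0 < e -> exists2 dl : R, 0 < dl &
  forall w, normc (w - z) < dl -> normc (F w - F z) < e.

(** Stated over the real-valued [normc], so that estimates stay in [R], and multiplied out by w - z,
    so that the point w = z needs no exclusion. *)
Definition cderiv_at F z d := forall e : R, 0 < e -> exists2 dl : R, 0 < dl &
  forall w, normc (w - z) < dl ->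
    normc (F w - F z - d * (w - z)) <= e * normc (w - z).

Lemma nbhs_normcP (z : R[i]^o) (P : set R[i]^o) :
  nbhs z P <-> exists2 dl : R, 0 < dl & forall w, normc (w - z) < dl -> P w.
Proof.
split.
  move=> /nbhs_normP [e /= e0 eP]; exists (complex.Re e).
    by move: e0; rewrite ltcE => /andP[_].
  move=> w wz; apply: eP => /=.
  have eE : e = (complex.Re e)%:C.
    by move: e0; rewrite ltcE => /andP[/eqP /=]; case: (e) => ? ? /= -> .
  by rewrite eE distrC normcE ltcR.
move=> [dl dl0 dlP]; apply/nbhs_ballP; exists (dl%:C) => /=.
  by rewrite ltcR.
by move=> w; rewrite -ball_normE /= distrC normcE ltcR; exact: dlP.
Qed.

(** One half of the bridge to [differentiable], which on C means complex differentiability; the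
    converse is [cderiv_differentiable]. *)
Lemma differentiable_cderiv (F : R[i]^o -> R[i]^o) (z : R[i]^o) :
  differentiable F z -> cderiv_at F z ('D_1 F z).
Proof.
move=> /derivable1_diffP dF e e0.
have := dF; rewrite /derivable => /cvg_ex [l Fl].
have Dl : 'D_1 F z = l by apply/cvg_lim.
rewrite Dl.
have /Fl : nbhs l [set w : R[i]^o | normc (w - l) < e] by apply/nbhs_normcP; exists e.
move=> /nbhs_ballP [dl /= dl0]; rewrite -ball_normE => dlP.
have dlE : dl = (complex.Re dl)%:C.
  by move: dl0; rewrite ltcE => /andP[/eqP /=]; case: (dl) => ? ? /= -> .
exists (complex.Re dl); first by move: dl0; rewrite ltcE => /andP[_].
move=> w wz; have [->|wzN] := eqVneq w z.
  by rewrite !subrr mulr0 subrr normc0 mulr0.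
have h0 : w - z != 0 by rewrite subr_eq0.
have := dlP (w - z); rewrite /= sub0r normrN normcE dlE ltcR => /(_ wz h0).
rewrite /GRing.scale /= mulr1 subrK => H.
have -> : F w - F z - l * (w - z) = ((w - z)^-1 * (F w - F z) - l) * (w - z).
  by rewrite mulrBl mulrAC mulVf // mul1r.
by rewrite normcM ler_wpM2r ?normc_ge0 // ltW.
Qed.

Lemma cderiv_ccont F z d : cderiv_at F z d -> ccont F z.
Proof.
move=> dF e e0; have [dl dl0 H] := dF 1 ltr01.
have k0 : 0 < 1 + normc d by have := normc_ge0 d; lra.
exists (Num.min dl (e / (1 + normc d))); first by rewrite lt_min dl0 divr_gt0.
move=> w; rewrite lt_min => /andP[/H wz]; rewrite ltr_pdivlMr // => we.
have -> : F w - F z = (F w - F z - d * (w - z)) + d * (w - z) by rewrite subrK.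
apply: (le_lt_trans (normcD _ _)); rewrite normcM.
by move: wz we; lra.
Qed.

Lemma cderiv_unique F z d1 d2 : cderiv_at F z d1 -> cderiv_at F z d2 -> d1 = d2.
Proof.
move=> h1 h2; apply/eqP; rewrite -subr_eq0 -normc_eq0 eq_le normc_ge0 andbT.
apply/ler_addgt0Pr => e e0; rewrite add0r.
have e20 : 0 < e / 2 by lra.
have [a a0 ha] := h1 _ e20; have [b b0 hb] := h2 _ e20.
pose m := Num.min a b / 2.
have m0 : 0 < m by rewrite divr_gt0 // lt_min a0.
have mab : m < Num.min a b by rewrite /m ltr_pdivrMr // mulrDr mulr1 ltrDl lt_min a0.
have nm : normc (z + m%:C - z) = m by rewrite addrAC subrr add0r normc_real gtr0_norm.
have {}ha := ha (z + m%:C); have {}hb := hb (z + m%:C).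
rewrite !nm in ha hb.
have /ha A : m < a by apply: (lt_le_trans mab); rewrite ge_min lexx.
have /hb B : m < b by apply: (lt_le_trans mab); rewrite ge_min lexx orbT.
have E : (d1 - d2) * (z + m%:C - z) =
  (F (z + m%:C) - F z - d2 * (z + m%:C - z)) - (F (z + m%:C) - F z - d1 * (z + m%:C - z)).
  by ring.
have : normc (d1 - d2) * m <= e * m.
  rewrite -{1}nm -normcM E; apply: (le_trans (normcB _ _)).
  by have := lerD B A; rewrite -mulrDl -splitr.
by rewrite ler_pM2r.
Qed.

Lemma cderiv_ext F G z d : (exists2 dl : R, 0 < dl & forall w, normc (w - z) < dl -> F w = G w) ->
  cderiv_at F z d -> cderiv_at G z d.
Proof.
move=> [dl dl0 FG] dF e e0; have [a a0 ha] := dF _ e0.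
exists (Num.min dl a); first by rewrite lt_min dl0.
move=> w; rewrite lt_min => /andP[w1 w2]; rewrite -(FG w) // -(FG z) ?subrr ?normc0 //.
exact: ha.
Qed.

Lemma ccont_ext F G z : (exists2 dl : R, 0 < dl & forall w, normc (w - z) < dl -> F w = G w) ->
  ccont F z -> ccont G z.
Proof.
move=> [dl dl0 FG] dF e e0; have [a a0 ha] := dF _ e0.
exists (Num.min dl a); first by rewrite lt_min dl0.
move=> w; rewrite lt_min => /andP[w1 w2]; rewrite -(FG w) // -(FG z) ?subrr ?normc0 //.
exact: ha.
Qed.

Lemma cderiv_cst c z : cderiv_at (fun=> c) z 0.
Proof. by move=> e e0; exists 1 => // w _; rewrite mul0r !subrr normc0 mulr_ge0 ?normc_ge0 // ltW. Qed.

Lemma cderiv_id z : cderiv_at id z 1.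
Proof. by move=> e e0; exists 1 => // w _; rewrite mul1r !subrr normc0 mulr_ge0 ?normc_ge0 // ltW. Qed.

Lemma cderivD F G z a b : cderiv_at F z a -> cderiv_at G z b ->
  cderiv_at (fun w => F w + G w) z (a + b).
Proof.
move=> hF hG e e0; have e20 : 0 < e / 2 by lra.
have [x x0 hx] := hF _ e20; have [y y0 hy] := hG _ e20.
exists (Num.min x y); first by rewrite lt_min x0.
move=> w; rewrite lt_min => /andP[/hx A /hy B].
have -> : F w + G w - (F z + G z) - (a + b) * (w - z) =
  (F w - F z - a * (w - z)) + (G w - G z - b * (w - z)) by ring.
by apply: (le_trans (normcD _ _)); have := lerD A B; rewrite -mulrDl -splitr.
Qed.

Lemma cderiv_comp F G z a b : cderiv_at G z a -> cderiv_at F (G z) b ->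
  cderiv_at (F \o G) z (b * a).
Proof.
move=> hG hF e e0.
have cG := cderiv_ccont hG.
(* [K] dominates both |b| and the local Lipschitz constant 1 + |a| of [G], so each of the two error
   terms stays below e/2 times |h|. *)
pose K : R := 1 + normc a + normc b.
have K1 : 1 <= K by rewrite /K; have := normc_ge0 a; have := normc_ge0 b; lra.
have K0 : 0 < K by lra.
have eK : 0 < e / (2 * K) by rewrite divr_gt0 // mulr_gt0.
pose e1 := Num.min 1 (e / (2 * K)).
have e10 : 0 < e1 by rewrite lt_min ltr01.
have [x x0 hx] := hG _ e10; have [y y0 hy] := hF _ eK; have [u u0 hu] := cG _ y0.
exists (Num.min x u); first by rewrite lt_min x0.
move=> w; rewrite lt_min => /andP[/hx A /hu/hy B] /=.
set h := w - z in A B *; set k := G w - G z in A B *.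
have -> : F (G w) - F (G z) - b * a * h = (F (G w) - F (G z) - b * k) + b * (k - a * h) by ring.
apply: (le_trans (normcD _ _)); rewrite normcM.
have nk : normc k <= K * normc h.
  have -> : k = (k - a * h) + a * h by ring.
  apply: (le_trans (normcD _ _)); rewrite normcM.
  have : normc (k - a * h) <= 1 * normc h.
    by apply: (le_trans A); rewrite ler_wpM2r ?normc_ge0 // ge_min lexx.
  rewrite mul1r /K !mulrDl mul1r => ?.
  by have := mulr_ge0 (normc_ge0 b) (normc_ge0 h); lra.
have A' : normc (k - a * h) <= e / (2 * K) * normc h.
  by apply: (le_trans A); rewrite ler_wpM2r ?normc_ge0 // ge_min lexx orbT.
have B' : normc (F (G w) - F (G z) - b * k) <= e / 2 * normc h.
  apply: (le_trans B); apply: (le_trans (ler_wpM2l (ltW eK) nk)).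
  by rewrite mulrA -(_ : e / (2 * K) * K = e / 2) //; field; lra.
have C' : normc b * normc (k - a * h) <= e / 2 * normc h.
  apply: (le_trans (ler_wpM2l (normc_ge0 b) A')); rewrite mulrA ler_wpM2r ?normc_ge0 //.
  apply: (@le_trans _ _ (K * (e / (2 * K)))).
    by rewrite ler_wpM2r ?(ltW eK) // /K; have := normc_ge0 a; lra.
  by rewrite -(_ : K * (e / (2 * K)) = e / 2) //; field; lra.
by have := lerD B' C'; rewrite -mulrDl -splitr.
Qed.

Lemma cderivM F G z a b : cderiv_at F z a -> cderiv_at G z b ->
  cderiv_at (fun w => F w * G w) z (a * G z + F z * b).
Proof.
move=> hF hG e e0.
pose K : R := 1 + normc (G z) + normc (F z) + normc a.
have K1 : 1 <= K by rewrite /K; have := normc_ge0 (G z); have := normc_ge0 (F z); have := normc_ge0 a; lra.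
have K0 : 0 < K by lra.
have eK : 0 < e / (3 * K) by rewrite divr_gt0 // mulr_gt0.
have [x x0 hx] := hF _ eK; have [y y0 hy] := hG _ eK.
have eK1 : 0 < Num.min 1 (e / (3 * K)) by rewrite lt_min ltr01.
have [u u0 hu] := cderiv_ccont hG eK1.
exists (Num.min (Num.min x y) u); first by rewrite !lt_min x0 y0.
move=> w; rewrite !lt_min => /andP[/andP[/hx A /hy B] /hu].
rewrite lt_min => /andP[D1 D2].
set h := w - z in A B *.
have -> : F w * G w - F z * G z - (a * G z + F z * b) * h =
  (F w - F z - a * h) * G w + (a * h) * (G w - G z) + F z * (G w - G z - b * h) by ring.
have third X : normc X <= K -> K * (e / (3 * K)) * normc h = e / 3 * normc h.
  by move=> _; congr (_ * _); field; lra.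
have P1 : normc ((F w - F z - a * h) * G w) <= e / 3 * normc h.
  rewrite normcM -(third 0) ?normc0 ?(ltW K0)// mulrC -mulrA ler_pM ?normc_ge0 //.
  have -> : G w = G w - G z + G z by rewrite subrK.
  apply: (le_trans (normcD _ _)); rewrite /K.
  by have := normc_ge0 (F z); have := normc_ge0 a; move: D1; lra.
have P2 : normc (a * h * (G w - G z)) <= e / 3 * normc h.
  rewrite !normcM -(third 0) ?normc0 ?(ltW K0)// mulrAC ler_wpM2r ?normc_ge0 //.
  rewrite ler_pM ?normc_ge0 ?(ltW D2)//.
  by rewrite /K; have := normc_ge0 (F z); have := normc_ge0 (G z); lra.
have P3 : normc (F z * (G w - G z - b * h)) <= e / 3 * normc h.
  rewrite normcM -(third 0) ?normc0 ?(ltW K0)// -mulrA ler_pM ?normc_ge0 //.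
  by rewrite /K; have := normc_ge0 a; have := normc_ge0 (G z); lra.
apply: (le_trans (normcD _ _)).
have := normcD ((F w - F z - a * h) * G w) (a * h * (G w - G z)).
by move: P1 P2 P3; lra.
Qed.

Lemma cderivV z : z != 0 -> cderiv_at (fun w => w^-1) z (- z^-1 ^+ 2).
Proof.
move=> z0 e e0.
have nz0 : 0 < normc z by rewrite normc_gt0.
(* For |w - z| < |z|/2 one has |w| > |z|/2, hence the remainder (w - z)^2 / (w z^2) is at most 2 |w
   - z|^2 / |z|^3. *)
pose D := e * normc z ^+ 3 / 2.
have D0 : 0 < D by rewrite /D divr_gt0 // mulr_gt0 // exprn_gt0.
exists (Num.min (normc z / 2) D); first by rewrite lt_min D0 andbT divr_gt0.
move=> w; rewrite lt_min => /andP[w1 w2].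
have nw : normc z / 2 < normc w.
  have := normc_dist z w; rewrite normcBC; move: w1; lra.
have w0 : w != 0 by rewrite -normc_gt0; lra.
have -> : w^-1 - z^-1 - (- z^-1 ^+ 2) * (w - z) = (w - z) * ((w - z) / (w * z ^+ 2)).
  by field; rewrite z0 w0.
rewrite normcM mulrC ler_wpM2r ?normc_ge0 // normcM normcV normcM normcX.
rewrite ler_pdivrMr; last by rewrite mulr_gt0 ?exprn_gt0 //; lra.
apply: (le_trans (ltW w2)); rewrite /D -!mulrA ler_wpM2l ?(ltW e0)//.
by rewrite mulrA mulrC expr2 ler_wpM2r ?mulr_ge0 ?normc_ge0 // ltW.
Qed.

Lemma cderivZ c F z a : cderiv_at F z a -> cderiv_at (fun w => c * F w) z (c * a).
Proof.
move=> hF; have := cderivM (cderiv_cst c z) hF.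
by rewrite mul0r add0r.
Qed.

Lemma cderivX n z : exists d, cderiv_at (fun w => w ^+ n) z d.
Proof.
elim: n => [|n [d hd]].
  exists 0; apply: (cderiv_ext _ (cderiv_cst 1 z)).
  by exists 1 => // w _; rewrite expr0.
exists (1 * z ^+ n + z * d).
apply: (cderiv_ext _ (cderivM (cderiv_id z) hd)).
by exists 1 => // w _; rewrite exprS.
Qed.

End Differentiation.

(** * Integrals of complex-valued functions *)

Section ComplexIntegral.
Context d (T : measurableType d) (R : realType) (mu : {measure set T -> \bar R}).
Implicit Types (D : set T) (f g : T -> R[i]) (c : R[i]).

Definition cintegral D f : R[i] :=
  (\int[mu]_(x in D) complex.Re (f x)) +i* (\int[mu]_(x in D) complex.Im (f x)).

Definition cintegrable D f := mu.-integrable D (EFin \o (fun x => complex.Re (f x))) /\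
  mu.-integrable D (EFin \o (fun x => complex.Im (f x))).

Lemma eq_cintegral D f g : (forall x, D x -> f x = g x) ->
  cintegral D f = cintegral D g.
Proof.
by move=> fg; congr (_ +i* _); apply: eq_Rintegral => x /set_mem Dx; rewrite fg.
Qed.

Lemma eq_cintegrable D f g : measurable D -> (forall x, D x -> f x = g x) ->
  cintegrable D f -> cintegrable D g.
Proof.
move=> mD fg [fr fi].
by split; [move: fr|move: fi]; apply: eq_integrable => // x /set_mem Dx /=; rewrite fg.
Qed.

Lemma integrable_EFinD D (u v : T -> R) : measurable D ->
  mu.-integrable D (EFin \o u) -> mu.-integrable D (EFin \o v) ->
  mu.-integrable D (EFin \o (fun x => u x + v x)).
Proof. by move=> mD iu iv; exact: (integrableD mD iu iv). Qed.

Lemma integrable_EFinZ D (u : T -> R) (r : R) : measurable D ->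
  mu.-integrable D (EFin \o u) -> mu.-integrable D (EFin \o (fun x => r * u x)).
Proof. by move=> mD iu; exact: (integrableZl mD r iu). Qed.

Lemma integrable_EFinN D (u : T -> R) : measurable D ->
  mu.-integrable D (EFin \o u) -> mu.-integrable D (EFin \o (fun x => - u x)).
Proof. by move=> mD iu; exact: (integrableN iu). Qed.

Lemma cintegrableD D f g : measurable D -> cintegrable D f -> cintegrable D g ->
  cintegrable D (fun x => f x + g x).
Proof.
move=> mD [fr fi] [gr gi]; split.
  by under eq_fun do rewrite cReD; exact: integrable_EFinD.
by under eq_fun do rewrite cImD; exact: integrable_EFinD.
Qed.

Lemma cintegrableZ D f c : measurable D -> cintegrable D f ->
  cintegrable D (fun x => c * f x).
Proof.
move=> mD [fr fi]; split.
  under eq_fun do rewrite cReM -mulNr.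
  by apply: integrable_EFinD => //; exact: integrable_EFinZ.
under eq_fun do rewrite cImM.
by apply: integrable_EFinD => //; exact: integrable_EFinZ.
Qed.

Lemma cintegralD D f g : measurable D -> cintegrable D f -> cintegrable D g ->
  cintegral D (fun x => f x + g x) = cintegral D f + cintegral D g.
Proof.
move=> mD [fr fi] [gr gi]; rewrite /cintegral; apply: eq_complexP => /=.
  by under eq_Rintegral do rewrite cReD; rewrite RintegralD.
by under eq_Rintegral do rewrite cImD; rewrite RintegralD.
Qed.

Lemma cintegralZ D f c : measurable D -> cintegrable D f ->
  cintegral D (fun x => c * f x) = c * cintegral D f.
Proof.
move=> mD [fr fi]; rewrite /cintegral; apply: eq_complexP.
  rewrite cReM /=; under eq_Rintegral do rewrite cReM -mulNr.
  rewrite RintegralD //; try exact: integrable_EFinZ.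
  by rewrite !RintegralZl // mulNr.
rewrite cImM /=; under eq_Rintegral do rewrite cImM.
rewrite RintegralD //; try exact: integrable_EFinZ.
by rewrite !RintegralZl.
Qed.

Lemma cintegrableN D f : measurable D -> cintegrable D f ->
  cintegrable D (fun x => - f x).
Proof.
move=> mD /(cintegrableZ (-1) mD); apply: eq_cintegrable => // x _.
by rewrite mulN1r.
Qed.

Lemma cintegralN D f : measurable D -> cintegrable D f ->
  cintegral D (fun x => - f x) = - cintegral D f.
Proof.
move=> mD cf; rewrite -mulN1r -cintegralZ //.
by apply: eq_cintegral => x _; rewrite mulN1r.
Qed.

Lemma cintegralB D f g : measurable D -> cintegrable D f -> cintegrable D g ->
  cintegral D (fun x => f x - g x) = cintegral D f - cintegral D g.
Proof.
move=> mD cf cg; rewrite cintegralD //; last exact: cintegrableN.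
by rewrite cintegralN.
Qed.

(** The real and imaginary parts are bounded separately, whence the factor 2. *)
Lemma normc_cintegral_le D f (h : T -> R) : measurable D -> cintegrable D f ->
  mu.-integrable D (EFin \o h) -> (forall x, D x -> normc (f x) <= h x) ->
  normc (cintegral D f) <= 2 * \int[mu]_(x in D) h x.
Proof.
move=> mD [fr fi] ih fh; apply: (le_trans (normc_ReIm _)) => /=.
rewrite mulr_natl mulr2n; apply: lerD.
  apply: (le_trans (le_normr_Rintegral _ _)) => //; apply: le_Rintegral => //.
    by apply: integrable_norm.
  by move=> x /fh; apply: le_trans; exact: Re_normc.
apply: (le_trans (le_normr_Rintegral _ _)) => //; apply: le_Rintegral => //.
  by apply: integrable_norm.
by move=> x /fh; apply: le_trans; exact: Im_normc.
Qed.

Lemma cintegral_sum D (I : Type) (s : seq I) (F : I -> T -> R[i]) : measurable D ->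
  (forall i, cintegrable D (F i)) ->
  cintegrable D (fun x => \sum_(i <- s) F i x) /\
  cintegral D (fun x => \sum_(i <- s) F i x) = \sum_(i <- s) cintegral D (F i).
Proof.
move=> mD iF; elim: s => [|i s [IH1 IH2]].
  split.
    apply: (@eq_cintegrable _ (fun=> 0)) => //.
      by move=> x _; rewrite big_nil.
    by split; exact: integrable0.
  rewrite big_nil; under eq_cintegral do rewrite big_nil.
  by rewrite /cintegral /= /Rintegral !integral0.
split.
  apply: (@eq_cintegrable _ (fun x => F i x + \sum_(j <- s) F j x)) => //.
    by move=> x _; rewrite big_cons.
  exact: cintegrableD.
rewrite big_cons -IH2 -cintegralD //.
by apply: eq_cintegral => x _; rewrite big_cons.
Qed.

End ComplexIntegral.
Arguments cintegrable {d T R} mu D f.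
Arguments cintegral {d T R} mu D f.

(** * Complex functions of a real variable and the fundamental theorem of calculus *)

Section PathIntegrals.
Context {R : realType}.
Notation C := (R[i]).
Notation mu := (@lebesgue_measure R).
Implicit Types (f g : R -> C) (x a b : R).

Definition contRC f x := forall e : R, 0 < e -> exists2 dl : R, 0 < dl &
  forall y, `|y - x| < dl -> normc (f y - f x) < e.

Definition derivRC f x (d : C) := forall e : R, 0 < e -> exists2 dl : R, 0 < dl &
  forall y, `|y - x| < dl -> normc (f y - f x - d * (y - x)%:C) <= e * `|y - x|.

Definition cint a b f := cintegral mu `[a, b] f.

Lemma contRC_Re f x : contRC f x -> {for x, continuous (fun y => complex.Re (f y))}.
Proof.
move=> fx; apply/cvgrPdist_lt => e e0; have [dl dl0 H] := fx _ e0.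
apply/nbhs_ballP; exists dl => //= y; rewrite /ball_ /= distrC => /H.
by apply: le_lt_trans; rewrite distrC -cReN -cReD Re_normc.
Qed.

Lemma contRC_Im f x : contRC f x -> {for x, continuous (fun y => complex.Im (f y))}.
Proof.
move=> fx; apply/cvgrPdist_lt => e e0; have [dl dl0 H] := fx _ e0.
apply/nbhs_ballP; exists dl => //= y; rewrite /ball_ /= distrC => /H.
by apply: le_lt_trans; rewrite distrC -cImN -cImD Im_normc.
Qed.

Lemma within_continuous_pt (u : R -> R) a b :
  (forall x, a <= x <= b -> {for x, continuous u}) -> {within `[a, b], continuous u}.
Proof.
move=> H; apply/subspace_continuousP => x /=; rewrite in_itv /= => /H ux.
by apply: cvg_trans ux; apply: cvg_app; exact: cvg_within.
Qed.

Lemma cintegrable_itv f a b : (forall x, a <= x <= b -> contRC f x) ->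
  cintegrable mu `[a, b] f.
Proof.
move=> H; split; apply: continuous_compact_integrable; try exact: segment_compact.
  by apply: within_continuous_pt => x /H /contRC_Re.
by apply: within_continuous_pt => x /H /contRC_Im.
Qed.

Lemma normc_cint_le f a b (M : R) : a <= b -> (forall x, a <= x <= b -> contRC f x) ->
  (forall x, a <= x <= b -> normc (f x) <= M) -> normc (cint a b f) <= 2 * ((b - a) * M).
Proof.
move=> ab cf fM.
have -> : (b - a) * M = \int[mu]_(x in `[a, b]) M.
  rewrite Rintegral_cst // mulrC; congr (_ * _).
  transitivity (fine (if (a%:E < b%:E)%E then (b%:E - a%:E)%E else 0%E)); last first.
    by congr fine; apply/esym; exact: (lebesgue_measure_itv `[a, b]).
  rewrite lte_fin; case: ltP => //= ba; apply/eqP; rewrite subr_eq0.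
  by rewrite eq_le ab ba.
apply: normc_cintegral_le => //; first exact: cintegrable_itv.
  apply: continuous_compact_integrable; first exact: segment_compact.
  by apply: within_continuous_pt => x _; exact: cst_continuous.
Qed.

Lemma Rintegral_split (u : R -> R) a c b : a <= c <= b ->
  mu.-integrable `[a, b] (EFin \o u) ->
  \int[mu]_(x in `[a, b]) u x = \int[mu]_(x in `[a, c]) u x + \int[mu]_(x in `[c, b]) u x.
Proof.
move=> /andP[ac cb] iu.
have iu2 : mu.-integrable `]c, b] (EFin \o u).
  apply: integrableS iu => // x /=; rewrite !in_itv /= => /andP[cx ->].
  by rewrite andbT (le_trans ac) // ltW.
have := @Rintegral_itvB R u (BLeft a) (BRight b) c iu.
rewrite !bnd_simp => /(_ ac cb) H; rewrite -[LHS](subrK (\int[mu]_(x in `[a, c]) u x)).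
by rewrite H addrC Rintegral_itv_obnd_cbnd.
Qed.

Lemma cint_split f a c b : a <= c <= b -> (forall x, a <= x <= b -> contRC f x) ->
  cint a b f = cint a c f + cint c b f.
Proof.
move=> acb /cintegrable_itv [fr fi].
by rewrite /cint /cintegral (Rintegral_split acb fr) (Rintegral_split acb fi).
Qed.

Lemma derivRC_contRC f x d : derivRC f x d -> contRC f x.
Proof.
move=> dF e e0; have [dl dl0 H] := dF 1 ltr01.
have k0 : 0 < 1 + normc d by have := normc_ge0 d; lra.
exists (Num.min dl (e / (1 + normc d))); first by rewrite lt_min dl0 divr_gt0.
move=> w; rewrite lt_min => /andP[/H wz]; rewrite ltr_pdivlMr // => we.
have -> : f w - f x = (f w - f x - d * (w - x)%:C) + d * (w - x)%:C by rewrite subrK.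
apply: (le_lt_trans (normcD _ _)); rewrite normcM normc_real.
by move: wz we; lra.
Qed.

Lemma derive_ReIm (u : R -> R) x (l : R) : (forall e : R, 0 < e -> exists2 dl : R, 0 < dl &
  forall y, `|y - x| < dl -> `|u y - u x - l * (y - x)| <= e * `|y - x|) ->
  is_derive x 1 u l.
Proof.
move=> H.
have cv : (h^-1 *: (u (h + x) - u x)) @[h --> 0^'] --> l.
  apply/cvgrPdist_le => e e0; have [dl dl0 K] := H _ e0.
  apply/nbhs_ballP; exists dl => //= h; rewrite -ball_normE /= sub0r normrN => hd h0.
  have := K (h + x); rewrite addrK => /(_ hd) B.
  have -> : l - h^-1 *: (u (h + x) - u x) = - (h^-1 * (u (h + x) - u x - l * h)).
    by rewrite /GRing.scale /=; field.
  by rewrite normrN normrM normfV mulrC ler_pdivrMr // normr_gt0.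
apply: DeriveDef.
  rewrite /derivable; apply/cvg_ex; exists l.
  by under eq_fun do rewrite [_%:A]mulr1.
rewrite /derive; under eq_fun do rewrite [_%:A]mulr1.
exact/cvg_lim.
Qed.

Lemma derivRC_Re f x d : derivRC f x d -> is_derive x 1 (fun y => complex.Re (f y)) (complex.Re d).
Proof.
move=> dF; apply: derive_ReIm => e e0; have [dl dl0 H] := dF _ e0.
exists dl => // y /H; apply: le_trans; apply: le_trans (Re_normc _).
by rewrite !(cReD, cReN, cReM) /= mulr0 subr0.
Qed.

Lemma derivRC_Im f x d : derivRC f x d -> is_derive x 1 (fun y => complex.Im (f y)) (complex.Im d).
Proof.
move=> dF; apply: derive_ReIm => e e0; have [dl dl0 H] := dF _ e0.
exists dl => // y /H; apply: le_trans; apply: le_trans (Im_normc _).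
by rewrite !(cImD, cImN, cImM) /= mulr0 add0r.
Qed.

Lemma Rintegral_FTC (F u : R -> R) a b : a <= b ->
  (forall x, a <= x <= b -> is_derive x 1 F (u x)) ->
  (forall x, a <= x <= b -> {for x, continuous u}) ->
  \int[mu]_(x in `[a, b]) u x = F b - F a.
Proof.
rewrite le_eqVlt => /orP[/eqP <- _ _|ab dF cu].
  by rewrite set_itv1 Rintegral_set1 subrr.
have cF x : a <= x <= b -> {for x, continuous F}.
  by move=> /dF [dx _]; apply: differentiable_continuous; exact/derivable1_diffP.
rewrite /Rintegral (@continuous_FTC2 _ u F) //.
- exact: within_continuous_pt.
- split.
  + by move=> x; rewrite in_itv /= => /andP[ax xb]; have [] := dF x; rewrite ?(ltW ax) ?(ltW xb).
  + by apply: cvg_at_right_filter; apply: cF; rewrite lexx ltW.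
  + by apply: cvg_at_left_filter; apply: cF; rewrite lexx ltW.
- move=> x; rewrite in_itv /= => /andP[ax xb]; rewrite derive1E.
  by have [] := dF x; rewrite ?(ltW ax) ?(ltW xb).
Qed.

Lemma cint_FTC (F f : R -> C) a b : a <= b ->
  (forall x, a <= x <= b -> derivRC F x (f x)) ->
  (forall x, a <= x <= b -> contRC f x) ->
  cint a b f = F b - F a.
Proof.
move=> ab dF cf; apply: eq_complexP; rewrite /cint /cintegral /=.
  rewrite cReD cReN.
  apply: (Rintegral_FTC (F := fun y => complex.Re (F y)) (u := fun y => complex.Re (f y)) ab) => x xab.
    exact: derivRC_Re (dF _ xab).
  exact: contRC_Re (cf _ xab).
rewrite cImD cImN.
apply: (Rintegral_FTC (F := fun y => complex.Im (F y)) (u := fun y => complex.Im (f y)) ab) => x xab.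
  exact: derivRC_Im (dF _ xab).
exact: contRC_Im (cf _ xab).
Qed.

Lemma contRC_comp (F : C -> C) f x : contRC f x -> ccont F (f x) -> contRC (fun y => F (f y)) x.
Proof.
move=> cf cF e e0; have [a a0 ha] := cF _ e0; have [b b0 hb] := cf _ a0.
by exists b => // y /hb /ha.
Qed.

Lemma derivRC_comp (F : C -> C) f x d l : derivRC f x l -> cderiv_at F (f x) d ->
  derivRC (fun y => F (f y)) x (d * l).
Proof.
move=> hf hF e e0.
pose K : R := 1 + normc l + normc d.
have K1 : 1 <= K by rewrite /K; have := normc_ge0 l; have := normc_ge0 d; lra.
have K0 : 0 < K by lra.
have eK : 0 < e / (2 * K) by rewrite divr_gt0 // mulr_gt0.
have e10 : 0 < Num.min 1 (e / (2 * K)) by rewrite lt_min ltr01.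
have [p p0 hp] := hf _ e10; have [y y0 hy] := hF _ eK; have [u u0 hu] := derivRC_contRC hf y0.
exists (Num.min p u); first by rewrite lt_min p0.
move=> w; rewrite lt_min => /andP[/hp A /hu/hy B].
set h := (w - x)%:C in A *; set k := f w - f x in A B *.
have nh : normc h = `|w - x| by rewrite normc_real.
have -> : F (f w) - F (f x) - d * l * h = (F (f w) - F (f x) - d * k) + d * (k - l * h) by ring.
apply: (le_trans (normcD _ _)); rewrite normcM.
have A1 : normc (k - l * h) <= 1 * `|w - x|.
  by apply: (le_trans A); rewrite ler_wpM2r // ge_min lexx.
have A2 : normc (k - l * h) <= e / (2 * K) * `|w - x|.
  by apply: (le_trans A); rewrite ler_wpM2r // ge_min lexx orbT.
have nk : normc k <= K * `|w - x|.
  have -> : k = (k - l * h) + l * h by ring.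
  apply: (le_trans (normcD _ _)); rewrite normcM nh.
  by have := mulr_ge0 (normc_ge0 d) (normr_ge0 (w - x)); rewrite /K; move: A1; lra.
have B' : normc (F (f w) - F (f x) - d * k) <= e / 2 * `|w - x|.
  apply: (le_trans B); apply: (le_trans (ler_wpM2l (ltW eK) nk)).
  by rewrite mulrA -(_ : e / (2 * K) * K = e / 2) //; field; lra.
have C' : normc d * normc (k - l * h) <= e / 2 * `|w - x|.
  apply: (le_trans (ler_wpM2l (normc_ge0 d) A2)); rewrite mulrA ler_wpM2r //.
  apply: (@le_trans _ _ (K * (e / (2 * K)))).
    by rewrite ler_wpM2r ?(ltW eK) // /K; have := normc_ge0 l; lra.
  by rewrite -(_ : K * (e / (2 * K)) = e / 2) //; field; lra.
by have := lerD B' C'; rewrite -mulrDl -splitr.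
Qed.

Lemma derivRC_hor c x : derivRC (fun s => s +i* c) x 1.
Proof.
move=> e e0; exists 1 => // y _.
have -> : y +i* c - (x +i* c) - 1 * (y - x)%:C = 0.
  by apply: eq_complexP; rewrite !(cReD, cImD, cReN, cImN, cReM, cImM) /=; ring.
by rewrite normc0 mulr_ge0 // ltW.
Qed.

Lemma derivRC_ver c x : derivRC (fun s => c +i* s) x 'i%C.
Proof.
move=> e e0; exists 1 => // y _.
have -> : c +i* y - (c +i* x) - 'i%C * (y - x)%:C = 0.
  by apply: eq_complexP; rewrite !(cReD, cImD, cReN, cImN, cReM, cImM) /=; ring.
by rewrite normc0 mulr_ge0 // ltW.
Qed.

Lemma contRCZ c f x : contRC f x -> contRC (fun y => c * f y) x.
Proof.
move=> cf; apply: (contRC_comp (F := fun w => c * w)) => //.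
by apply: cderiv_ccont; exact: (cderivZ c (cderiv_id _)).
Qed.

Lemma contRCD f g x : contRC f x -> contRC g x -> contRC (fun y => f y + g y) x.
Proof.
move=> cf cg e e0; have e20 : 0 < e / 2 by lra.
have [p p0 hp] := cf _ e20; have [q q0 hq] := cg _ e20.
exists (Num.min p q); first by rewrite lt_min p0.
move=> y; rewrite lt_min => /andP[/hp A /hq B].
rewrite (_ : f y + g y - _ = (f y - f x) + (g y - g x)); last by ring.
by apply: (le_lt_trans (normcD _ _)); lra.
Qed.

Lemma contRC_cst c x : contRC (fun=> c) x.
Proof. by move=> e e0; exists 1 => // y _; rewrite subrr normc0. Qed.

Lemma contRCB f g x : contRC f x -> contRC g x -> contRC (fun y => f y - g y) x.
Proof.
move=> cf /(contRCZ (-1)) cg e e0.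
have [dl dl0 H] := contRCD cf cg e0; exists dl => // y /H.
by rewrite !mulN1r.
Qed.

Lemma contRC_norm_bounded f a b : a <= b -> (forall x, a <= x <= b -> contRC f x) ->
  exists M : R, forall x, a <= x <= b -> normc (f x) <= M.
Proof.
move=> ab cf.
have cn : {within `[a, b], continuous (fun x => normc (f x))}.
  apply: within_continuous_pt => x /cf fx; apply/cvgrPdist_lt => e e0.
  have [dl dl0 H] := fx _ e0; apply/nbhs_ballP; exists dl => //= y.
  rewrite /ball_ /= distrC => /H; apply: le_lt_trans.
  have h1 := normc_dist (f x) (f y); have h2 := normc_dist (f y) (f x).
  by rewrite ler_norml; move: h1 h2; rewrite (normcBC (f x)); lra.
have [c _ hc] := @EVT_max _ _ _ _ ab cn.
by exists (normc (f c)) => x xab; apply: hc; rewrite in_itv.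
Qed.

End PathIntegrals.

(** * Goursat's theorem, Cauchy's formula and Taylor coefficients *)

Section Goursat.
Context {R : realType}.
Notation C := (R[i]).
Notation mu := (@lebesgue_measure R).
Implicit Types (F G : C -> C) (a b c d : R).

Lemma nested_intervals (u v : nat -> R) : (forall n, u n <= u n.+1) ->
  (forall n, v n.+1 <= v n) -> (forall n, u n <= v n) ->
  exists x, forall n, u n <= x <= v n.
Proof.
move=> uS vS uv.
have um n k : u n <= u (n + k)%N by elim: k => [|k IH]; rewrite ?addn0 // addnS (le_trans IH).
have vm n k : v (n + k)%N <= v n by elim: k => [|k IH]; rewrite ?addn0 // addnS (le_trans _ IH).
have uvnm n m : u n <= v m.
  apply: (le_trans (um n m)); apply: (le_trans (uv _)); rewrite addnC; exact: vm.
have hs : has_sup (range u).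
  split; first by exists (u 0%N), 0%N.
  by exists (v 0%N) => _ [n _ <-].
exists (sup (range u)) => n; apply/andP; split.
  by apply: sup_upper_bound => //; exists n.
by apply: ge_sup; [exists (u 0%N), 0%N | move=> _ [m _ <-]].
Qed.

(** Choosing a bad quarter again and again halves both sides each time, so the nested rectangles
    shrink to one point (x, y) that lies in all of them. *)
Lemma bisection (P : R -> R -> R -> R -> Prop) a b c d : a <= b -> c <= d -> P a b c d ->
  (forall a b c d, a <= b -> c <= d -> P a b c d ->
    [\/ P a ((a + b) / 2) c ((c + d) / 2), P a ((a + b) / 2) ((c + d) / 2) d,
        P ((a + b) / 2) b c ((c + d) / 2) | P ((a + b) / 2) b ((c + d) / 2) d]) ->
  exists x y, forall e : R, 0 < e -> exists a' b' c' d',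
    [/\ P a' b' c' d', (a <= a') && (b' <= b), (c <= c') && (d' <= d), a' <= x <= b' /\ c' <= y <= d'
      & b' - a' + (d' - c') < e].
Proof.
move=> ab cd Pabcd step.
pose Q := (R * R * R * R)%type.
pose good (q : Q) := [/\ q.1.1.1 <= q.1.1.2, q.1.2 <= q.2 & P q.1.1.1 q.1.1.2 q.1.2 q.2].
pose sub (q r : Q) := [/\ q.1.1.1 <= r.1.1.1, r.1.1.2 <= q.1.1.2, q.1.2 <= r.1.2, r.2 <= q.2
  & r.1.1.2 - r.1.1.1 = (q.1.1.2 - q.1.1.1) / 2 /\ r.2 - r.1.2 = (q.2 - q.1.2) / 2].
(* [choice] needs a successor for every quadruple, hence the implication; a quadruple that is not
   good is sent to itself. *)
have next (q : Q) : exists r : Q, good q -> good r /\ sub q r.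
  have [gq|] := pselect (good q); last by exists q.
  move: q gq => [[[a' b'] c'] d'] [/= A B H].
  have [H1|H1|H1|H1] := step _ _ _ _ A B H.
  - exists (a', (a' + b') / 2, c', (c' + d') / 2) => _; rewrite /good /sub /=; split; split => //; try lra.
  - exists (a', (a' + b') / 2, (c' + d') / 2, d') => _; rewrite /good /sub /=; split; split => //; try lra.
  - exists ((a' + b') / 2, b', c', (c' + d') / 2) => _; rewrite /good /sub /=; split; split => //; try lra.
  - exists ((a' + b') / 2, b', (c' + d') / 2, d') => _; rewrite /good /sub /=; split; split => //; try lra.
have [s hs] := choice next.
pose q n := iter n s ((a, b), c, d).
have gq n : good (q n).
  elim: n => [|n IH]; first by split.
  by rewrite /q iterS; have [] := hs _ IH.
have sq n : sub (q n) (q n.+1) by have [] := hs _ (gq n).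
have [x hx] := nested_intervals (u := fun n => (q n).1.1.1) (v := fun n => (q n).1.1.2)
  ltac:(by move=> n; have [] := sq n) ltac:(by move=> n; have [] := sq n) ltac:(by move=> n; have [] := gq n).
have [y hy] := nested_intervals (u := fun n => (q n).1.2) (v := fun n => (q n).2)
  ltac:(by move=> n; have [] := sq n) ltac:(by move=> n; have [] := sq n) ltac:(by move=> n; have [] := gq n).
exists x, y => e e0.
have sz n : (q n).1.1.2 - (q n).1.1.1 + ((q n).2 - (q n).1.2) = (b - a + (d - c)) / 2 ^+ n.
  elim: n => [|n IH]; first by rewrite expr0 divr1.
  have [_ _ _ _ [-> ->]] := sq n; rewrite -mulrDl IH exprSr -mulrA -invfM //.
have bnd n : [/\ a <= (q n).1.1.1, (q n).1.1.2 <= b, c <= (q n).1.2 & (q n).2 <= d].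
  elim: n => [|n [h1 h2 h3 h4]]; first by split.
  have [k1 k2 k3 k4 _] := sq n.
  by split; [exact: le_trans h1 k1|exact: le_trans k2 h2|exact: le_trans h3 k3|exact: le_trans k4 h4].
have [n hn] : exists n, (b - a + (d - c)) / 2 ^+ n < e.
  pose K := b - a + (d - c); exists (Num.truncn (K / e)).+1.
  rewrite ltr_pdivrMr ?exprn_gt0 // -ltr_pdivrMl // mulrC.
  apply: (lt_trans (truncnS_gt _)); rewrite -natrX ltr_nat; exact: ltn_expl.
exists (q n).1.1.1, (q n).1.1.2, (q n).1.2, (q n).2.
have [h1 h2 h3 h4] := bnd n; have [_ _ Pn] := gq n.
by split; rewrite ?sz //; rewrite ?h1 ?h2 ?h3 ?h4.
Qed.

(** The boundary integral of F(z) dz over the rectangle, taken counterclockwise. *)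
Definition rect F a b c d : C :=
  cint a b (fun s => F (s +i* c)) - cint a b (fun s => F (s +i* d)) +
  'i%C * (cint c d (fun t => F (b +i* t)) - cint c d (fun t => F (a +i* t))).

Definition ccont_on F a b c d := forall s t, a <= s <= b -> c <= t <= d -> ccont F (s +i* t).

Lemma contRC_hor F s t : ccont F (s +i* t) -> contRC (fun s => F (s +i* t)) s.
Proof. by move=> cF; apply: contRC_comp cF; apply: derivRC_contRC; exact: derivRC_hor. Qed.

Lemma contRC_ver F s t : ccont F (s +i* t) -> contRC (fun t => F (s +i* t)) t.
Proof.
move=> cF; apply: (@contRC_comp _ F (fun t => s +i* t)) cF.
by apply: derivRC_contRC; exact: derivRC_ver.
Qed.

(** Each side contributes the difference of [G] at its end points, and the four corners cancel. *)
Lemma rect_primitive F G a b c d : a <= b -> c <= d ->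
  (forall z, cderiv_at G z (F z)) -> (forall z, ccont F z) -> rect F a b c d = 0.
Proof.
move=> ab cd GF cF.
have H t : cint a b (fun s => F (s +i* t)) = G (b +i* t) - G (a +i* t).
  rewrite (@cint_FTC _ (fun s => G (s +i* t))) // => s _; last exact: contRC_hor.
  by rewrite -[F _]mulr1; apply: derivRC_comp (GF _); exact: derivRC_hor.
have V s : 'i%C * cint c d (fun t => F (s +i* t)) = G (s +i* d) - G (s +i* c).
  have cV x : c <= x <= d -> contRC (fun t => F (s +i* t)) x by move=> _; exact: contRC_ver.
  rewrite /cint -cintegralZ //; last exact: cintegrable_itv.
  rewrite -/(cint c d _) (@cint_FTC _ (fun t => G (s +i* t))) // => t tcd; last first.
    by apply: contRCZ; exact: contRC_ver.
  by rewrite mulrC; apply: (@derivRC_comp _ G (fun t => s +i* t)) (GF _); exact: derivRC_ver.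
by rewrite /rect mulrBr !V !H; ring.
Qed.

Lemma rectB F G a b c d : a <= b -> c <= d -> ccont_on F a b c d -> ccont_on G a b c d ->
  rect (fun z => F z - G z) a b c d = rect F a b c d - rect G a b c d.
Proof.
move=> ab cd cF cG.
have h t : c <= t <= d -> cint a b (fun s => F (s +i* t) - G (s +i* t)) =
    cint a b (fun s => F (s +i* t)) - cint a b (fun s => G (s +i* t)).
  by move=> tcd; rewrite /cint cintegralB //; apply: cintegrable_itv => s sab;
    apply: contRC_hor; auto.
have v s : a <= s <= b -> cint c d (fun t => F (s +i* t) - G (s +i* t)) =
    cint c d (fun t => F (s +i* t)) - cint c d (fun t => G (s +i* t)).
  by move=> sab; rewrite /cint cintegralB //; apply: cintegrable_itv => t tcd;
    apply: contRC_ver; auto.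
by rewrite /rect !h ?v ?lexx ?ab ?cd //; ring.
Qed.

Lemma rect_quarter F a b c d : a <= b -> c <= d -> ccont_on F a b c d ->
  rect F a b c d = rect F a ((a + b) / 2) c ((c + d) / 2) + rect F a ((a + b) / 2) ((c + d) / 2) d
   + rect F ((a + b) / 2) b c ((c + d) / 2) + rect F ((a + b) / 2) b ((c + d) / 2) d.
Proof.
move=> ab cd cF; set m := (a + b) / 2; set n := (c + d) / 2.
have am : a <= m <= b by rewrite /m; lra.
have cn : c <= n <= d by rewrite /n; lra.
have h t : c <= t <= d -> cint a b (fun s => F (s +i* t)) =
    cint a m (fun s => F (s +i* t)) + cint m b (fun s => F (s +i* t)).
  by move=> tcd; apply: cint_split => // s sab; apply: contRC_hor; auto.
have v s : a <= s <= b -> cint c d (fun t => F (s +i* t)) =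
    cint c n (fun t => F (s +i* t)) + cint n d (fun t => F (s +i* t)).
  by move=> sab; apply: cint_split => // t tcd; apply: contRC_ver; auto.
by rewrite /rect !h ?v ?lexx ?ab ?cd //; ring.
Qed.

Lemma normc_i : normc ('i%C : C) = 1.
Proof. by rewrite /= expr0n /= add0r expr1n sqrtr1. Qed.

Lemma normc_rect_le F a b c d (M : R) : a <= b -> c <= d -> ccont_on F a b c d ->
  (forall s t, a <= s <= b -> c <= t <= d -> normc (F (s +i* t)) <= M) ->
  normc (rect F a b c d) <= 4 * ((b - a + (d - c)) * M).
Proof.
move=> ab cd cF FM.
have h t : c <= t <= d -> normc (cint a b (fun s => F (s +i* t))) <= 2 * ((b - a) * M).
  by move=> tcd; apply: normc_cint_le => // s sab; [apply: contRC_hor|]; auto.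
have v s : a <= s <= b -> normc (cint c d (fun t => F (s +i* t))) <= 2 * ((d - c) * M).
  by move=> sab; apply: normc_cint_le => // t tcd; [apply: contRC_ver|]; auto.
rewrite /rect; apply: (le_trans (normcD _ _)); rewrite normcM normc_i mul1r.
have h1 := h c; have h2 := h d; have v1 := v a; have v2 := v b.
move: h1 h2 v1 v2; rewrite !lexx ab cd => /(_ isT) h1 /(_ isT) h2 /(_ isT) v1 /(_ isT) v2.
have A1 := normcB (cint a b (fun s => F (s +i* c))) (cint a b (fun s => F (s +i* d))).
have A2 := normcB (cint c d (fun t => F (b +i* t))) (cint c d (fun t => F (a +i* t))).
lra.
Qed.

(** A nonzero integral would persist, relative to the square of the side lengths, on rectangles
    shrinking to a point; there the affine part of [F] integrates to 0 and the rest is too small. *)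
Theorem goursat F a b c d : a <= b -> c <= d ->
  (forall s t, a <= s <= b -> c <= t <= d -> exists l, cderiv_at F (s +i* t) l) ->
  rect F a b c d = 0.
Proof.
move=> ab cd dF.
have fld (u v : R) : 4 * (u * (v / 8 * (2 * u))) = v * u ^+ 2 by field.
have cF : ccont_on F a b c d by move=> s t sab tcd; have [l /cderiv_ccont] := dF _ _ sab tcd.
apply/eqP; rewrite -normc_eq0 eq_le normc_ge0 andbT leNgt; apply/negP => r0.
pose L := b - a + (d - c).
have [L0|L0] := eqVneq L 0.
  have := normc_rect_le (M := 0) ab cd cF.
  have E1 : a = b by move: L0 ab cd; rewrite /L; lra.
  have E2 : c = d by move: L0 ab cd; rewrite /L; lra.
  move: r0; rewrite /rect -E1 -E2.
  by rewrite !subrr mulr0 addr0 normc0 ltxx.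
have Lp : 0 < L by rewrite lt_def L0 /L; lra.
(* The half makes the inequality of [P] strict on the initial rectangle. On a quarter the sum of the
   sides halves, so the right side falls by exactly a factor 4 and at least one quarter keeps the
   inequality. *)
pose e : R := normc (rect F a b c d) / L ^+ 2 / 2.
have e0 : 0 < e by rewrite !divr_gt0 // exprn_gt0.
pose P a' b' c' d' := [/\ a <= a' /\ b' <= b, c <= c' /\ d' <= d
   & e * (b' - a' + (d' - c')) ^+ 2 < normc (rect F a' b' c' d')].
have Pabcd : P a b c d.
  split => //; rewrite -/L (_ : e * L ^+ 2 = normc (rect F a b c d) / 2); last by rewrite /e; field.
  by rewrite ltr_pdivrMr // mulrDr mulr1 ltrDl.
have [|x [y hxy]] := bisection (P := P) ab cd Pabcd.
  move=> a' b' c' d' ab' cd' [[aa bb] [cc dd] HP].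
  have sub1 s : a' <= s <= b' -> a <= s <= b by move=> /andP[u v]; rewrite (le_trans aa u) (le_trans v bb).
  have sub2 s : c' <= s <= d' -> c <= s <= d by move=> /andP[u v]; rewrite (le_trans cc u) (le_trans v dd).
  have cF' : ccont_on F a' b' c' d' by move=> s t ? ?; apply: cF; [exact: sub1|exact: sub2].
  have := rect_quarter ab' cd' cF'.
  set m := (a' + b') / 2; set n := (c' + d') / 2 => E.
  have am : a' <= m by rewrite /m; clear -ab'; lra.
  have mb : m <= b' by rewrite /m; clear -ab'; lra.
  have cn : c' <= n by rewrite /n; clear -cd'; lra.
  have nd : n <= d' by rewrite /n; clear -cd'; lra.
  have S1 : m - a' + (n - c') = (b' - a' + (d' - c')) / 2 by rewrite /m /n; field.
  have S2 : m - a' + (d' - n) = (b' - a' + (d' - c')) / 2 by rewrite /m /n; field.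
  have S3 : b' - m + (n - c') = (b' - a' + (d' - c')) / 2 by rewrite /m /n; field.
  have S4 : b' - m + (d' - n) = (b' - a' + (d' - c')) / 2 by rewrite /m /n; field.
  clearbody m n.
  have mb2 := le_trans mb bb; have am2 := le_trans aa am.
  have nd2 := le_trans nd dd; have cn2 := le_trans cc cn.
  have [H1|H1] := ltP (e * (m - a' + (n - c')) ^+ 2) (normc (rect F a' m c' n)).
    by constructor 1; split.
  have [H2|H2] := ltP (e * (m - a' + (d' - n)) ^+ 2) (normc (rect F a' m n d')).
    by constructor 2; split.
  have [H3|H3] := ltP (e * (b' - m + (n - c')) ^+ 2) (normc (rect F m b' c' n)).
    by constructor 3; split.
  have [H4|H4] := ltP (e * (b' - m + (d' - n)) ^+ 2) (normc (rect F m b' n d')).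
    by constructor 4; split.
  exfalso; move: HP; rewrite E; apply/negP; rewrite -leNgt.
  have T1 := normcD (rect F a' m c' n + rect F a' m n d' + rect F m b' c' n) (rect F m b' n d').
  have T2 := normcD (rect F a' m c' n + rect F a' m n d') (rect F m b' c' n).
  have T3 := normcD (rect F a' m c' n) (rect F a' m n d').
  move: H1 H2 H3 H4; rewrite S1 S2 S3 S4 !expr_div_n => H1 H2 H3 H4.
  by clear -H1 H2 H3 H4 T1 T2 T3; lra.
have [xab ycd] : a <= x <= b /\ c <= y <= d.
  have [a' [b' [c' [d' [_ /andP[h1 h2] /andP[h3 h4] [/andP[h5 h6] /andP[h7 h8]] _]]]]] := hxy 1 ltr01.
  by clear -h1 h2 h3 h4 h5 h6 h7 h8; split; lra.
have [l dl] := dF _ _ xab ycd.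
(* With K the sum of the sides, 4 K (e/8) (2 K) = e K^2, which is what [P] forbids. *)
have e8 : 0 < e / 8 by lra.
have [r rr hr] := dl _ e8.
have [a' [b' [c' [d' [[_ _ HP] /andP[h1 h2] /andP[h3 h4] [/andP[h5 h6] /andP[h7 h8]] small]]]]] := hxy r rr.
have ab' : a' <= b' by exact: le_trans h5 h6.
have cd' : c' <= d' by exact: le_trans h7 h8.
have sub1 s : a' <= s <= b' -> a <= s <= b by move=> /andP[u v]; rewrite (le_trans h1 u) (le_trans v h2).
have sub2 s : c' <= s <= d' -> c <= s <= d by move=> /andP[u v]; rewrite (le_trans h3 u) (le_trans v h4).
have cF' : ccont_on F a' b' c' d' by move=> s t ? ?; apply: cF; [exact: sub1|exact: sub2].
pose p : C := x +i* y.
(* The affine approximation of [F] at the limit point, with primitive [A']; by [rect_primitive] it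
   can be subtracted without changing the integral. *)
pose A z := F p + l * (z - p).
pose A' z := F p * z + (l / 2) * ((z - p) * (z - p)).
have dsub z : cderiv_at (fun w => w - p) z 1.
  by rewrite -[1]addr0; exact: cderivD (cderiv_id z) (cderiv_cst (- p) z).
have dA z : cderiv_at A' z (A z).
  have -> : A z = F p * 1 + l / 2 * (1 * (z - p) + (z - p) * 1).
    by rewrite /A; field.
  by apply: cderivD; apply: cderivZ; [exact: cderiv_id|exact: cderivM].
have cA z : ccont A z.
  apply: (cderiv_ccont (d := 0 + l * 1)); apply: cderivD; first exact: cderiv_cst.
  exact: cderivZ.
have RA : rect A a' b' c' d' = 0 by apply: rect_primitive dA _.
have : normc (rect F a' b' c' d') <= e * (b' - a' + (d' - c')) ^+ 2.
  have -> : rect F a' b' c' d' = rect (fun z => F z - A z) a' b' c' d'.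
    by rewrite rectB // ?RA ?subr0 // => s t _ _.
  set K := b' - a' + (d' - c') in small *.
  have K0 : 0 <= K by rewrite /K; clear -ab' cd'; lra.
  have : normc (rect (fun z => F z - A z) a' b' c' d') <= 4 * (K * (e / 8 * (2 * K))).
    apply: normc_rect_le => //.
      move=> s t sab tcd; have cB : ccont (fun z => (-1) * A z) (s +i* t).
        apply: (cderiv_ccont (d := (-1) * (0 + l * 1))); apply: cderivZ.
        by apply: cderivD; [exact: cderiv_cst|exact: cderivZ].
      have [k /(cderivD)] := dF s t (sub1 _ sab) (sub2 _ tcd).
      have dB : cderiv_at (fun z => (-1) * A z) (s +i* t) ((-1) * (0 + l * 1)).
        by apply: cderivZ; apply: cderivD; [exact: cderiv_cst|exact: cderivZ].
      move=> /(_ _ _ dB) /cderiv_ccont; apply: ccont_ext.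
      by exists 1 => // w _; rewrite mulN1r.
    move=> s t sab tcd.
    have E : s +i* t - p = (s - x) +i* (t - y) by rewrite /p; simpc.
    have nK : normc (s +i* t - p) <= K.
      rewrite E; apply: (le_trans (normc_ReIm _)) => /=; rewrite /K.
      by clear -h5 h6 h7 h8 sab tcd; apply: lerD; rewrite ler_norml; lra.
    have := hr (s +i* t); rewrite -/p /A opprD addrA => /(_ (le_lt_trans nK small)) H.
    apply: (le_trans H); rewrite ler_wpM2l ?(ltW e8) //; clear -nK K0; lra.
  by rewrite fld.
by rewrite leNgt HP.
Qed.

End Goursat.

(** * Circle means and the mean value property *)

Section CircleMeans.
Context {R : realType}.
Notation C := (R[i]).
Notation mu := (@lebesgue_measure R).
Implicit Types (F G : C -> C) (z w : C) (r s t x : R) (n m : nat).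

Lemma is_derive_eps (u : R -> R) x (l : R) : is_derive x 1 u l ->
  forall e : R, 0 < e -> exists2 dl : R, 0 < dl &
  forall y, `|y - x| < dl -> `|u y - u x - l * (y - x)| <= e * `|y - x|.
Proof.
move=> [du Du] e e0.
move: du; rewrite /derivable => /cvg_ex [l' Fl].
have El : l' = l by rewrite -Du; apply/esym/cvg_lim.
rewrite {}El in Fl.
move/cvgrPdist_lt: Fl => /(_ e e0) /nbhs_ballP [dl /= dl0 dlP].
exists dl => // y yx; have [->|xy] := eqVneq y x.
  by rewrite !subrr mulr0 subrr normr0 mulr0.
have h0 : y - x != 0 by rewrite subr_eq0.
have := dlP (y - x); rewrite -ball_normE /= sub0r normrN => /(_ yx h0).
rewrite /GRing.scale /= mulr1 subrK => /ltW H.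
have -> : u y - u x - l * (y - x) = - ((l - (y - x)^-1 * (u y - u x)) * (y - x)).
  by field.
by rewrite normrN normrM ler_wpM2r.
Qed.

Lemma expiD s t : expi (s + t) = expi s * expi t :> C.
Proof. by apply: eq_complexP; rewrite ?cReM ?cImM /= ?cosD ?sinD // addrC mulrC. Qed.

Lemma expi0 : expi 0 = 1 :> C.
Proof. by rewrite /expi cos0 sin0. Qed.

Lemma expi2pi : expi (2 * pi) = 1 :> C.
Proof. by rewrite /expi mulr_natl cos2pi sin2pi. Qed.

Lemma normc_expi t : normc (expi t : C) = 1.
Proof. by rewrite /= cos2Dsin2 sqrtr1. Qed.

Lemma expi_neq0 t : expi t != 0 :> C.
Proof. by rewrite -normc_gt0 normc_expi. Qed.

Lemma conjc_expi t : conjc (expi t : C) = (expi t)^-1.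
Proof.
apply: (mulfI (expi_neq0 t)); rewrite mulfV ?expi_neq0 //.
apply: eq_complexP; rewrite ?cReM ?cImM /=; last by ring.
by rewrite mulrN opprK -!expr2 cos2Dsin2.
Qed.

Lemma derivRC_expi t : derivRC (@expi R) t ('i%C * expi t).
Proof.
move=> e e0; have e20 : 0 < e / 2 by lra.
have [a a0 ha] := is_derive_eps (is_derive_cos t) e20.
have [b b0 hb] := is_derive_eps (is_derive_sin t) e20.
exists (Num.min a b); first by rewrite lt_min a0.
move=> y; rewrite lt_min => /andP[/ha A /hb B].
apply: (le_trans (normc_ReIm _)); rewrite !(cReD, cImD, cReN, cImN, cReM, cImM) /=.
rewrite (_ : e * _ = e / 2 * `|y - t| + e / 2 * `|y - t|); last by field.
apply: lerD; [move: A|move: B]; apply: le_trans; rewrite le_eqVlt; apply/orP; left; apply/eqP; congr `|_|; ring.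
Qed.

Lemma contRC_expi t : contRC (@expi R) t.
Proof. exact: derivRC_contRC (derivRC_expi t). Qed.

Definition cexp z : C := (expR (complex.Re z))%:C * expi (complex.Im z).

Lemma cexpD z w : cexp (z + w) = cexp z * cexp w.
Proof. by rewrite /cexp cReD cImD expRD rmorphM expiD; ring. Qed.

Lemma normc_cexp z : normc (cexp z) = expR (complex.Re z).
Proof. by rewrite /cexp normcM normc_expi mulr1 normc_real ger0_norm // expR_ge0. Qed.

(** By [cexpD] only the expansion at 0 matters. There exp, cos and sin are linear up to an error [d]
    times the increment, and the factor 6 K in the choice of [d] pays for all the terms. *)
Lemma cderiv_cexp z : cderiv_at cexp z (cexp z).
Proof.
have fld (u v t : C) : u * v - v - v * t = v * (u - 1 - t) by ring.
move=> e e0; set K := normc (cexp z).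
have K0 : 0 < K by rewrite /K normc_cexp expR_gt0.
pose d : R := Num.min 1 (e / (6 * K)).
have d0 : 0 < d by rewrite lt_min ltr01 divr_gt0 // mulr_gt0.
have [a a0 ha] := is_derive_eps (is_derive_expR 0) d0.
have [b b0 hb] := is_derive_eps (is_derive_cos 0) d0.
have [c c0 hc] := is_derive_eps (is_derive_sin 0) d0.
pose q : R := Num.min (Num.min a b) (Num.min c (d / 2)).
have q0 : 0 < q by rewrite !lt_min a0 b0 c0 /=; lra.
exists q => // w wz.
have -> : cexp w - cexp z - cexp z * (w - z) = cexp z * (cexp (w - z) - 1 - (w - z)).
  have := cexpD (w - z) z; rewrite subrK => ->.
  exact: fld.
rewrite normcM -/K; move: (w - z) wz => h wz.
have [nr ni] := (Re_normc h, Im_normc h).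
have sq : `|complex.Re h - 0| < q by rewrite subr0; exact: le_lt_trans wz.
have tq : `|complex.Im h - 0| < q by rewrite subr0; exact: le_lt_trans wz.
have := sq; rewrite !lt_min => /andP[/andP[/ha A _] /andP[_ S]].
have := tq; rewrite !lt_min => /andP[/andP[_ /hb B] /andP[/hc D T]].
move: A B D; rewrite !subr0 expR0 cos0 sin0 mul1r oppr0 mul0r subr0 mul1r ?addr0 ?subr0 ?oppr0 ?addr0.
set s := complex.Re h in nr sq S *; set t := complex.Im h in ni tq T * => A B D.
rewrite subr0 in S; rewrite subr0 in T.
have d1 : d <= 1 by rewrite ge_min lexx.
have dK : d <= e / (6 * K) by rewrite ge_min lexx orbT.
have [s0 t0] := (normr_ge0 s, normr_ge0 t).
have E1 : `|expR s - 1| <= d.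
  rewrite -[_ - 1](subrK s); apply: (le_trans (ler_normD _ _)).
  have : d * `|s| <= 1 * `|s| by rewrite ler_wpM2r.
  by move: A S; lra.
have E2 : expR s <= 2.
  by have := ler_norm (expR s - 1); move: E1 d1; lra.
have E : cexp h - 1 - h = ((expR s) * (cos t - 1) + (expR s - 1 - s)) +i*
   (expR s * (sin t - t) + (expR s - 1) * t).
  rewrite /cexp; apply: eq_complexP; rewrite !(cReD, cImD, cReN, cImN, cReM, cImM) /= -/s -/t; ring.
have es0 : 0 <= expR s := expR_ge0 s.
have P1 : `|expR s * (cos t - 1) + (expR s - 1 - s)| <= 2 * (d * normc h) + d * normc h.
  apply: (le_trans (ler_normD _ _)); apply: lerD.
    rewrite normrM ger0_norm //; apply: ler_pM => //; apply: (le_trans B).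
    by rewrite ler_wpM2l // ltW.
  by apply: (le_trans A); rewrite ler_wpM2l // ltW.
have P2 : `|expR s * (sin t - t) + (expR s - 1) * t| <= 2 * (d * normc h) + d * normc h.
  apply: (le_trans (ler_normD _ _)); apply: lerD.
    rewrite normrM ger0_norm //; apply: ler_pM => //; apply: (le_trans D).
    by rewrite ler_wpM2l // ltW.
  by rewrite normrM ler_pM.
have P : normc (cexp h - 1 - h) <= 6 * (d * normc h).
  rewrite E; apply: (le_trans (normc_ReIm _)) => /=; clear -P1 P2; lra.
apply: (le_trans (ler_wpM2l (ltW K0) P)).
rewrite (_ : K * _ = (6 * K * d) * normc h); last by ring.
apply: ler_wpM2r; first exact: normc_ge0.
by rewrite mulrC -ler_pdivlMr // mulr_gt0.
Qed.

(* Without the factor [1 / (2 * pi)]. *)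
Definition cmean F r : C := cint 0 (2 * pi) (fun t => F (r%:C * expi t)).

Lemma pi2_ge0 : 0 <= 2 * pi :> R.
Proof. by rewrite mulr_ge0 // pi_ge0. Qed.

Lemma normc_circle r t : 0 <= r -> normc (r%:C * expi t) = r.
Proof. by move=> r0; rewrite normcM normc_expi mulr1 normc_real ger0_norm. Qed.

Lemma contRC_circle F r t : 0 <= r -> (forall z, normc z = r -> ccont F z) ->
  contRC (fun t => F (r%:C * expi t)) t.
Proof.
move=> r0 cF; apply: (@contRC_comp _ F (fun t => r%:C * expi t)).
  by apply: contRCZ; exact: contRC_expi.
by apply: cF; rewrite normc_circle.
Qed.

Lemma cintegrable_circle F r : 0 <= r -> (forall z, normc z = r -> ccont F z) ->
  cintegrable mu `[0, 2 * pi] (fun t => F (r%:C * expi t)).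
Proof. by move=> r0 cF; apply: cintegrable_itv => t _; exact: contRC_circle. Qed.

Lemma eq_cmean F G r : 0 <= r -> (forall z, normc z = r -> F z = G z) -> cmean F r = cmean G r.
Proof. by move=> r0 FG; apply: eq_cintegral => t _; rewrite FG // normc_circle. Qed.

Lemma cmeanD F G r : 0 <= r -> (forall z, normc z = r -> ccont F z) ->
  (forall z, normc z = r -> ccont G z) ->
  cmean (fun z => F z + G z) r = cmean F r + cmean G r.
Proof. by move=> r0 cF cG; rewrite /cmean /cint cintegralD //; exact: cintegrable_circle. Qed.

Lemma cmeanB F G r : 0 <= r -> (forall z, normc z = r -> ccont F z) ->
  (forall z, normc z = r -> ccont G z) ->
  cmean (fun z => F z - G z) r = cmean F r - cmean G r.
Proof. by move=> r0 cF cG; rewrite /cmean /cint cintegralB //; exact: cintegrable_circle. Qed.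

Lemma cmeanZ c F r : 0 <= r -> (forall z, normc z = r -> ccont F z) ->
  cmean (fun z => c * F z) r = c * cmean F r.
Proof. by move=> r0 cF; rewrite /cmean /cint cintegralZ //; exact: cintegrable_circle. Qed.

Lemma cmean_cst c r : cmean (fun=> c) r = (2 * pi)%:C * c.
Proof.
rewrite /cmean (@cint_FTC _ (fun t => t%:C * c)) //.
- by rewrite rmorph0 mul0r subr0.
- exact: pi2_ge0.
- move=> x _ e e0; exists 1 => // y _.
  have -> : y%:C * c - x%:C * c - c * (y - x)%:C = 0 by rewrite rmorphB; ring.
  by rewrite normc0 mulr_ge0 // ltW.
- by move=> x _; exact: contRC_cst.
Qed.

Lemma normc_cmean_le F r (M : R) : 0 <= r -> (forall z, normc z = r -> ccont F z) ->
  (forall z, normc z = r -> normc (F z) <= M) -> normc (cmean F r) <= 4 * pi * M.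
Proof.
move=> r0 cF FM; rewrite (_ : 4 * pi * M = 2 * ((2 * pi - 0) * M)); last by ring.
apply: normc_cint_le; first exact: pi2_ge0.
  by move=> t _; exact: contRC_circle.
by move=> t _; apply: FM; rewrite normc_circle.
Qed.

(* Goursat's theorem for [F \o cexp] on a rectangle of width [2 * pi]. *)
Lemma cmean_const F r0 r1 : 0 < r0 -> r0 <= r1 ->
  (forall z, r0 <= normc z <= r1 -> exists l, cderiv_at F z l) -> cmean F r0 = cmean F r1.
Proof.
move=> r00 r01 dF; have r10 : 0 < r1 by exact: lt_le_trans r01.
have lnr : ln r0 <= ln r1 by rewrite ler_ln.
have H : rect (F \o cexp) (ln r0) (ln r1) 0 (2 * pi) = 0.
  apply: goursat => //; first exact: pi2_ge0.
  move=> s t /andP[s0 s1] _.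
  have [|l dl] := dF (cexp (s +i* t)).
    by rewrite normc_cexp /= -ler_ln ?posrE ?expR_gt0 // expRK s0 -ler_ln ?posrE ?expR_gt0 // expRK.
  by exists (l * cexp (s +i* t)); apply: cderiv_comp dl; exact: cderiv_cexp.
have V r : 0 < r -> cint 0 (2 * pi) (fun t => (F \o cexp) (ln r +i* t)) = cmean F r.
  by move=> r_0; apply: eq_cintegral => t _ /=; rewrite /cexp /= lnK.
move: H; rewrite /rect !V //.
rewrite (_ : cint _ _ (fun s => (F \o cexp) (s +i* (2 * pi))) = cint (ln r0) (ln r1) (fun s => (F \o cexp) (s +i* 0))).
  rewrite subrr add0r => /eqP; rewrite mulf_eq0 subr_eq0 => /orP[|/eqP //].
  by rewrite eq_complex /= oner_eq0 andbF.
by apply: eq_cintegral => s _; rewrite /= /cexp /= expi2pi expi0.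
Qed.

(** Compactness of [0, 2 pi] makes the variation of [F] between neighbouring circles small uniformly
    in the angle. *)
Lemma cmean_continuous F (r1 r e : R) : 0 <= r <= r1 -> (forall z, normc z <= r1 -> ccont F z) ->
  0 < e -> exists2 dl : R, 0 < dl & forall x, 0 <= x <= r1 -> `|x - r| < dl ->
    normc (cmean F x - cmean F r) <= e.
Proof.
move=> /andP[r_0 rr1] cF e0.
have p0 : 0 < pi :> R := pi_gt0 R.
pose e1 : R := e / (4 * pi).
have e10 : 0 < e1 by rewrite divr_gt0 // mulr_gt0.
pose P (x t : R) := normc (F (x%:C * expi t) - F (r%:C * expi t)) <= e1.
have : \near r, `[0, 2 * pi] `<=` P r.
  have /compact_near_coveringP ncov := @segment_compact R 0 (2 * pi).
  apply: (ncov R (nbhs r) (fun x t => P x t)) => t _.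
  have e20 : 0 < e1 / 2 by lra.
  have [a a0 ha] := cF (r%:C * expi t) ltac:(by rewrite normc_circle) _ e20.
  have a20 : 0 < a / 2 by lra.
  have a30 : 0 < a / (2 * (1 + r)) by rewrite divr_gt0 // mulr_gt0 //; lra.
  have [b b0 hb] := contRC_expi t a30.
  exists ([set t' | `|t' - t| < b], [set x | `|x - r| < a / 2]) => /=.
    split; apply/nbhs_ballP.
      by exists b => //= y; rewrite /ball_ /= distrC.
    by exists (a / 2) => //= y; rewrite /ball_ /= distrC.
  move=> [t' x] /= [/hb T X]; rewrite /P.
  have Q : r * normc (expi t' - expi t : C) <= a / 2.
    apply: (@le_trans _ _ ((1 + r) * (a / (2 * (1 + r))))).
      by apply: ler_pM => //; [exact: normc_ge0|lra|exact: ltW].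
    by rewrite (_ : (1 + r) * (a / (2 * (1 + r))) = a / 2) //; field; lra.
  have N1 : normc (F (x%:C * expi t') - F (r%:C * expi t)) < e1 / 2.
    apply: ha; rewrite (_ : _ - _ = (x - r)%:C * expi t' + r%:C * (expi t' - expi t)).
      apply: (le_lt_trans (normcD _ _)); rewrite !normcM normc_expi mulr1 !normc_real (ger0_norm r_0).
      by move: X Q; lra.
    by rewrite rmorphB; ring.
  have N2 : normc (F (r%:C * expi t') - F (r%:C * expi t)) < e1 / 2.
    apply: ha; rewrite -mulrBr normcM normc_real (ger0_norm r_0).
    by move: Q; lra.
  rewrite (_ : _ - _ = (F (x%:C * expi t') - F (r%:C * expi t)) - (F (r%:C * expi t') - F (r%:C * expi t))); last by ring.
  by apply: (le_trans (normcB _ _)); lra.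
move=> /nbhs_ballP [dl dl0 H]; exists dl => // x /andP[x0 xr1] xr.
have cFx y : 0 <= y <= r1 -> forall z, normc z = y -> ccont F z.
  by move=> /andP[_ ?] z zy; apply: cF; rewrite zy.
have cx : forall z, normc z = x -> ccont F z by apply: cFx; rewrite x0.
have cr : forall z, normc z = r -> ccont F z by apply: cFx; rewrite r_0.
have -> : cmean F x - cmean F r = cint 0 (2 * pi) (fun t => F (x%:C * expi t) - F (r%:C * expi t)).
  by rewrite /cmean /cint cintegralB //; exact: cintegrable_circle.
rewrite (_ : e = 2 * ((2 * pi - 0) * e1)); last by rewrite /e1; field; lra.
apply: normc_cint_le; first exact: pi2_ge0.
  by move=> t _; apply: contRCB; exact: contRC_circle.
move=> t tI; apply: (H x); first by rewrite -ball_normE /= distrC.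
by rewrite /= in_itv.
Qed.

(** [cmean_const] applies between the radii a + d and b - d; [cmean_continuous] then reaches [a] and
    [b] themselves, where no derivative is assumed. *)
Lemma cmean_jump F (r1 a b : R) : 0 <= a -> a < b -> b <= r1 -> (forall z, normc z <= r1 -> ccont F z) ->
  (forall z, a < normc z < b -> exists l, cderiv_at F z l) -> cmean F a = cmean F b.
Proof.
move=> a0 ab br cF dF; apply/eqP; rewrite -subr_eq0 -normc_eq0 eq_le normc_ge0 andbT.
apply/ler_addgt0Pr => e e0; rewrite add0r.
have e20 : 0 < e / 2 by lra.
have [x x0 hx] := @cmean_continuous F r1 a _ ltac:(lra) cF e20.
have [y y0 hy] := @cmean_continuous F r1 b _ ltac:(lra) cF e20.
pose d : R := Num.min (Num.min x y) (b - a) / 3.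
have d0 : 0 < d by rewrite divr_gt0 // !lt_min x0 y0 subr_gt0.
have : 3 * d = Num.min (Num.min x y) (b - a) by rewrite /d; field.
have : Num.min (Num.min x y) (b - a) <= x by rewrite !ge_min lexx.
have : Num.min (Num.min x y) (b - a) <= y by rewrite !ge_min lexx orbT.
have : Num.min (Num.min x y) (b - a) <= b - a by rewrite !ge_min lexx orbT.
move: (Num.min _ _) => M m1 m2 m3 m4.
have E : cmean F (a + d) = cmean F (b - d).
  by apply: cmean_const; [lra|lra|move=> z zb; apply: dF; lra].
have X := hx (a + d) ltac:(lra) ltac:(by rewrite addrAC subrr add0r gtr0_norm //; lra).
have Y := hy (b - d) ltac:(lra) ltac:(by rewrite addrAC subrr add0r normrN gtr0_norm //; lra).
rewrite (_ : _ - _ = (cmean F (b - d) - cmean F b) - (cmean F (a + d) - cmean F a)); last by rewrite E; ring.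
by apply: (le_trans (normcB _ _)); lra.
Qed.

(* The exceptional point is the center of a difference quotient, where only
   continuity is known. *)
Theorem mean_value F r1 z0 : 0 <= r1 -> (forall z, normc z <= r1 -> ccont F z) ->
  (forall z, normc z <= r1 -> z != z0 -> exists l, cderiv_at F z l) ->
  cmean F r1 = (2 * pi)%:C * F 0.
Proof.
move=> r10 cF dF.
have M0 : cmean F 0 = (2 * pi)%:C * F 0.
  by rewrite -(cmean_cst _ 0); apply: eq_cintegral => t _; rewrite mul0r.
rewrite -M0; move: r10; rewrite le_eqVlt => /predU1P[<- //|r10].
have [h|h] := leP r1 (normc z0).
  apply/esym; apply: (cmean_jump (r1 := r1)) => // z zb; apply: dF; first lra.
  by apply/eqP => E; move: zb; rewrite E; lra.
have [z00|z00] := eqVneq (normc z0) 0.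
  apply/esym; apply: (cmean_jump (r1 := r1)) => // z zb; apply: dF; first lra.
  by apply/eqP => E; move: zb; rewrite E z00; lra.
have z0p : 0 < normc z0 by rewrite lt_def z00 normc_ge0.
(* The circle through [z0] separates two open annuli that avoid [z0]; each is crossed by
   [cmean_jump], and they share this radius. *)
have E1 : cmean F (normc z0) = cmean F r1.
  apply: (cmean_jump (r1 := r1)) => //; first exact: ltW.
  move=> z zb; apply: dF; first lra.
  by apply/eqP => E; move: zb; rewrite E; lra.
rewrite -E1; apply/esym; apply: (cmean_jump (r1 := r1)) => //; first exact: ltW.
move=> z zb; apply: dF; first lra.
by apply/eqP => E; move: zb; rewrite E; lra.
Qed.

End CircleMeans.

(** * Cauchy's formula and the error of the truncated power series *)

Section CauchyFormula.
Context {R : realType}.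
Notation C := (R[i]).
Notation mu := (@lebesgue_measure R).
Implicit Types (F G : C -> C) (z w : C) (r s t x : R) (n m : nat).

(** Continuity bounds [F] along t -> r exp(i t) on [0, 2 pi]. That every point of the circle is
    reached is seen with [acos], replaced by 2 pi - [acos] below the real axis. *)
Lemma circle_bounded F r : 0 <= r -> (forall z, normc z = r -> ccont F z) ->
  exists2 M : R, 0 <= M & forall z, normc z = r -> normc (F z) <= M.
Proof.
move=> r0 cF.
have [M hM] := contRC_norm_bounded (@pi2_ge0 R) (fun t _ => contRC_circle t r0 cF).
have M0 : 0 <= M by apply: le_trans (hM 0 _); rewrite ?normc_ge0 // lexx pi2_ge0.
exists M => // z zr; have [r00|rN0] := eqVneq r 0.
  have -> : z = r%:C * expi 0 by apply/eqP; rewrite r00 mul0r -normc_eq0 zr r00.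
  by apply: hM; rewrite lexx pi2_ge0.
have rp : 0 < r by rewrite lt_def rN0.
pose a := complex.Re z / r; pose b := complex.Im z / r.
have ab : a ^+ 2 + b ^+ 2 = 1.
  by rewrite /a /b !expr_div_n -mulrDl -normc_sqr zr mulfV // expf_neq0.
have [t [t0 ca sb]] : exists t : R, [/\ 0 <= t <= 2 * pi, cos t = a & sin t = b].
  have a1 : -1 <= a <= 1 by rewrite -ler_norml -(@expr_le1 _ 2) // real_normK ?num_real // -ab lerDl sqr_ge0.
  have hc := acosK a1; have [h0 hp] := (acos_ge0 a1, acos_lepi a1).
  have hs : sin (acos a) = `|b|.
    by rewrite sin_acos // -ab addrAC subrr add0r sqrtr_sqr.
  have [b0|b0] := leP 0 b.
    exists (acos a); split => //; last by rewrite hs ger0_norm.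
    by rewrite h0 /=; move: hp (pi_ge0 R); lra.
  exists (2 * pi - acos a); split.
  - by move: h0 hp (pi_ge0 R); lra.
  - by rewrite mulr_natl cosB cos2pi sin2pi mul1r mul0r addr0 hc.
  - by rewrite mulr_natl sinB cos2pi sin2pi mul1r mul0r sub0r hs ltr0_norm // opprK.
have -> : z = r%:C * expi t.
  by apply: eq_complexP; rewrite ?cReM ?cImM /= ca sb /a /b; field; exact: rN0.
exact: hM.
Qed.

Lemma ccontM F G z : ccont F z -> ccont G z -> ccont (fun w => F w * G w) z.
Proof.
move=> cF cG e e0.
pose K : R := 1 + normc (F z) + normc (G z).
have K0 : 0 < K by rewrite /K; have := normc_ge0 (F z); have := normc_ge0 (G z); lra.
have eK : 0 < Num.min 1 (e / (2 * K)) by rewrite lt_min ltr01 divr_gt0 // mulr_gt0.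
have [p p0 hp] := cF _ eK; have [q q0 hq] := cG _ eK.
exists (Num.min p q); first by rewrite lt_min p0.
move=> y; rewrite lt_min => /andP[/hp A /hq B].
move: A B; rewrite !lt_min => /andP[A1 A2] /andP[B1 B2].
rewrite (_ : F y * G y - _ = (F y - F z) * (G y - G z) + (F y - F z) * G z + F z * (G y - G z)); last by ring.
apply: (le_lt_trans (normcD _ _)); rewrite normcM.
have P : normc ((F y - F z) * (G y - G z) + (F y - F z) * G z) <= e / (2 * K) * (1 + normc (G z)).
  apply: (le_trans (normcD _ _)); rewrite !normcM mulrDr.
  by apply: lerD; apply: ler_pM; rewrite ?normc_ge0 ?(ltW A2) ?(ltW B1).
have Q : normc (F z) * normc (G y - G z) <= normc (F z) * (e / (2 * K)).
  by rewrite ler_wpM2l ?normc_ge0 // ltW.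
apply: (le_lt_trans (lerD P Q)).
have -> : e / (2 * K) * (1 + normc (G z)) + normc (F z) * (e / (2 * K)) = e / (2 * K) * K.
  by rewrite /K; ring.
have -> : e / (2 * K) * K = e / 2 by field; lra.
lra.
Qed.

Lemma ccontD F G z : ccont F z -> ccont G z -> ccont (fun w => F w + G w) z.
Proof.
move=> cF cG e e0; have e20 : 0 < e / 2 by lra.
have [a a0 ha] := cF _ e20; have [b b0 hb] := cG _ e20.
exists (Num.min a b); first by rewrite lt_min a0.
move=> w; rewrite lt_min => /andP[/ha A /hb B].
rewrite (_ : F w + G w - _ = (F w - F z) + (G w - G z)); last by ring.
by apply: (le_lt_trans (normcD _ _)); lra.
Qed.

Lemma ccontB F G z : ccont F z -> ccont G z -> ccont (fun w => F w - G w) z.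
Proof.
move=> cF cG; apply: ccontD => // e e0; have [a a0 ha] := cG _ e0; exists a => // w /ha.
by rewrite -opprD normcN.
Qed.

Lemma ccont_cst c z : ccont (fun=> c) z.
Proof. exact: cderiv_ccont (cderiv_cst c z). Qed.

Lemma ccont_id z : ccont id z.
Proof. exact: cderiv_ccont (cderiv_id z). Qed.

Lemma ccontV z : z != 0 -> ccont (fun w => w^-1) z.
Proof. by move=> z0; exact: cderiv_ccont (cderivV z0). Qed.

Lemma ccont_comp F G z : ccont G z -> ccont F (G z) -> ccont (fun w => F (G w)) z.
Proof.
by move=> cG cF e e0; have [a a0 ha] := cF _ e0; have [b b0 hb] := cG _ a0; exists b => // w /hb/ha.
Qed.

Lemma ccontX F n z : ccont F z -> ccont (fun w => F w ^+ n) z.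
Proof.
move=> cF; elim: n => [|n IH].
  by apply: (ccont_ext _ (ccont_cst 1 z)); exists 1.
by apply: (ccont_ext _ (ccontM cF IH)); exists 1 => // w _; rewrite exprS.
Qed.

Lemma cderiv_Xinv n z : z != 0 -> exists l, cderiv_at (fun w => w^-1 ^+ n) z l.
Proof.
move=> z0; have [l hl] := cderivX n z^-1.
by exists (l * (- z^-1 ^+ 2)); exact: cderiv_comp (cderivV z0) hl.
Qed.

Lemma circle_neq0 z r : 0 < r -> normc z = r -> z != 0.
Proof. by move=> r0 zr; rewrite -normc_gt0 zr. Qed.

(** Scaling multiplies this mean by a power of the radius, while [cmean_const] makes it independent
    of the radius; comparing radii 1 and 2 forces it to vanish. *)
Lemma cmean_Xinv r n : 0 < r -> (0 < n)%N -> cmean (fun z => z^-1 ^+ n) r = 0.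
Proof.
move=> r0 n0.
have H s : 0 < s -> cmean (fun z => z^-1 ^+ n) s = s%:C^-1 ^+ n * cmean (fun z => z^-1 ^+ n) 1.
  move=> s0; rewrite -cmeanZ //; last first.
    by move=> z /circle_neq0 z0; apply: ccontX; apply: ccontV; exact: z0.
  rewrite /cmean; apply: eq_cintegral => t _.
  by rewrite mul1r !invfM exprMn.
rewrite H //; suff -> : cmean (fun z => z^-1 ^+ n) 1 = 0 by rewrite mulr0.
have E : cmean (fun z => z^-1 ^+ n) 1 = cmean (fun z => z^-1 ^+ n) 2 :> C.
  apply: cmean_const => //; first by rewrite ler1n.
  move=> z /andP[z1 _]; apply: cderiv_Xinv; rewrite -normc_gt0; exact: lt_le_trans z1.
move: E; rewrite [RHS]H // => /eqP; rewrite -{1}[X in X == _]mul1r -subr_eq0 -mulrBl mulf_eq0.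
case/orP => [|/eqP //]; rewrite subr_eq0 => /eqP /(congr1 (@normc R)).
rewrite normc1 normcX normcV normc_real ger0_norm // exprVn => /esym/eqP.
by rewrite invr_eq1 -natrX pnatr_eq1 -[X in _ == X](expn0 2) eqn_exp2l // (gtn_eqF n0).
Qed.

(** The mean is the same on all larger circles and tends to 0 as the radius grows. *)
Lemma cmean_inv_sub r z : normc z < r -> cmean (fun w => (w - z)^-1) r = 0.
Proof.
move=> zr; have r0 : 0 < r by exact: le_lt_trans (normc_ge0 z) zr.
have nz w s : r <= s -> normc w = s -> w - z != 0.
  move=> rs ws; rewrite -normc_gt0; apply: lt_le_trans (normc_dist w z).
  by rewrite subr_gt0 ws; exact: lt_le_trans rs.
have cc w s : r <= s -> normc w = s -> ccont (fun w => (w - z)^-1) w.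
  move=> rs /(nz w s rs) wz; apply: (ccont_comp (F := fun w => w^-1)); last exact: ccontV.
  by apply: ccontB; [exact: ccont_id|exact: ccont_cst].
apply/eqP; rewrite -normc_eq0 eq_le normc_ge0 andbT; apply/ler_addgt0Pr => e e0; rewrite add0r.
(* On this circle |w - z| >= 4 pi / e, which the constant 4 pi of [normc_cmean_le] turns into the
   bound e. *)
pose s : R := r + 4 * pi / e.
have p0 : 0 < 4 * pi / e :> R by rewrite divr_gt0 // mulr_gt0 // pi_gt0.
have -> : cmean (fun w => (w - z)^-1) r = cmean (fun w => (w - z)^-1) s.
  apply: cmean_const => //; first by rewrite /s; lra.
  move=> w /andP[rw _]; exists (- (w - z)^-1 ^+ 2 * (1 + 0)).
  apply: (cderiv_comp (F := fun w => w^-1)); last exact: cderivV (nz w _ rw erefl).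
  exact: cderivD (cderiv_id w) (cderiv_cst (- z) w).
apply: (le_trans (normc_cmean_le (M := e / (4 * pi)) _ _ _)).
- by rewrite /s; lra.
- by move=> w ws; apply: (cc w s) => //; rewrite /s; lra.
- move=> w ws; rewrite normcV -[leRHS]invrK lef_pV2 ?posrE ?invr_gt0 ?divr_gt0 ?mulr_gt0 ?pi_gt0 //.
    by rewrite invf_div; apply: le_trans (normc_dist w z); rewrite ws /s; lra.
  by rewrite normc_gt0; apply: (nz w s) => //; rewrite /s; lra.
- by rewrite mulrC divfK // mulf_neq0 // gt_eqF // pi_gt0.
Qed.

Definition diffquot F z l w := if w == z then l else (F w - F z) / (w - z).

Lemma ccont_diffquot F z l : cderiv_at F z l -> ccont (diffquot F z l) z.
Proof.
move=> dF e e0; have e20 : 0 < e / 2 by lra.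
have [d d0 hd] := dF _ e20; exists d => // w wz; rewrite /diffquot eqxx.
have [_|wN] := eqVneq w z; first by rewrite subrr normc0.
have h0 : w - z != 0 by rewrite subr_eq0.
have -> : (F w - F z) / (w - z) - l = (F w - F z - l * (w - z)) / (w - z).
  by rewrite [RHS]mulrBl mulfK.
rewrite normcM normcV ltr_pdivrMr ?normc_gt0 //.
apply: (le_lt_trans (hd w wz)); rewrite ltr_pM2r ?normc_gt0 //; lra.
Qed.

Lemma cderiv_diffquot F z l w k : w != z -> cderiv_at F w k ->
  exists q, cderiv_at (diffquot F z l) w q.
Proof.
move=> wz dF; have h0 : w - z != 0 by rewrite subr_eq0.
exists ((k + 0) * (w - z)^-1 + (F w - F z) * (- (w - z)^-1 ^+ 2 * (1 + 0))).
apply: (cderiv_ext (F := fun w => (F w - F z) * (w - z)^-1)).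
  exists (normc (w - z)); first by rewrite normc_gt0.
  move=> v vw; rewrite /diffquot; case: eqVneq => // E.
  by move: vw; rewrite E normcBC ltxx.
apply: cderivM; first exact: cderivD dF (cderiv_cst _ _).
apply: (cderiv_comp (F := fun w => w^-1)); last exact: cderivV.
exact: cderivD (cderiv_id w) (cderiv_cst (- z) w).
Qed.

Section OneFunction.
Variables (F : C -> C) (r : R).
Hypotheses (r0 : 0 < r) (dF : forall z, normc z <= r -> exists l, cderiv_at F z l).

Let cF z : normc z <= r -> ccont F z.
Proof. by move=> /dF [l /cderiv_ccont]. Qed.

Let sub_neq0 w z : normc w = r -> normc z < r -> w - z != 0.
Proof.
by move=> wr zr; rewrite -normc_gt0; apply: lt_le_trans (normc_dist w z); rewrite subr_gt0 wr.
Qed.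

(** The factor w stands for dw = i w dt, so this is Cauchy's theorem for the difference quotient.
    [mean_value] with exceptional point [z] returns the value at 0, where the factor w vanishes. *)
Lemma cmean_diffquot z : normc z < r -> cmean (fun w => w * ((F w - F z) / (w - z))) r = 0.
Proof.
move=> zr; have [l dl] := dF (ltW zr).
rewrite (_ : cmean _ r = cmean (fun w => w * diffquot F z l w) r); last first.
  apply: eq_cmean; [exact: ltW|move=> w wr; rewrite /diffquot; case: eqVneq => // E].
  by move: zr; rewrite -E wr ltxx.
rewrite (@mean_value _ _ _ z) ?mul0r ?mulr0 //; first exact: ltW.
- move=> w wr; apply: ccontM; first exact: ccont_id.
  have [->|wz] := eqVneq w z; first exact: ccont_diffquot.
  by have [k dk] := dF wr; have [m /cderiv_ccont] := cderiv_diffquot l wz dk.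
- move=> w wr wz; have [k dk] := dF wr; have [m dm] := cderiv_diffquot l wz dk.
  by exists (1 * diffquot F z l w + w * m); exact: cderivM (cderiv_id w) dm.
Qed.

Lemma ccont_circle_sub z w : normc z < r -> normc w = r -> ccont (fun w => (w - z)^-1) w.
Proof.
move=> zr wr; apply: (ccont_comp (F := fun w => w^-1)).
  by apply: ccontB; [exact: ccont_id|exact: ccont_cst].
by apply: ccontV; exact: sub_neq0.
Qed.

(** Expands [cmean_diffquot]; since w / (w - z) = 1 + z / (w - z), the kernel itself has mean 2 pi
    by [cmean_inv_sub]. *)
Lemma cauchy_formula z : normc z < r ->
  cmean (fun w => F w * w * (w - z)^-1) r = (2 * pi)%:C * F z.
Proof.
move=> zr; have r00 := ltW r0.
have cW w : normc w = r -> ccont (fun w => (w - z)^-1) w by exact: ccont_circle_sub.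
have cFr w : normc w = r -> ccont F w by move=> wr; apply: cF; rewrite wr.
have := cmean_diffquot zr.
rewrite (_ : cmean _ r = cmean (fun w => F w * w * (w - z)^-1) r - F z * cmean (fun w => w * (w - z)^-1) r); last first.
  rewrite -cmeanZ // -?cmeanB //.
  - by apply: eq_cmean => // w wr; ring.
  - by move=> w wr; do 2 (apply: ccontM; auto); exact: ccont_id.
  - by move=> w wr; apply: ccontM; [exact: ccont_cst|apply: ccontM; auto; exact: ccont_id].
  - by move=> w wr; apply: ccontM; auto; exact: ccont_id.
move=> /subr0_eq ->.
rewrite (_ : cmean (fun w => w * (w - z)^-1) r = (2 * pi)%:C); first by rewrite mulrC.
rewrite (_ : cmean _ r = cmean (fun=> 1) r + z * cmean (fun w => (w - z)^-1) r).
  by rewrite cmean_inv_sub // mulr0 addr0 cmean_cst mulr1.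
rewrite -cmeanZ // -?cmeanD //.
- apply: eq_cmean => // w wr; have h := sub_neq0 wr zr.
  by rewrite -{1}(subrK z w) mulrDl mulfV.
- by move=> w wr; exact: ccont_cst.
- by move=> w wr; apply: ccontM; auto; exact: ccont_cst.
Qed.

(** Cauchy's integral for the n-th Taylor coefficient; because dw = i w dt, the usual exponent n + 1
    becomes n. *)
Definition coef n : C := (2 * pi)%:C^-1 * cmean (fun w => F w * w^-1 ^+ n) r.

Lemma pi2C_neq0 : (2 * pi)%:C != 0 :> C.
Proof. by rewrite -normc_gt0 normc_real normr_gt0 mulf_neq0 // gt_eqF // pi_gt0. Qed.

Lemma ccont_Xinv w n : normc w = r -> ccont (fun w => w^-1 ^+ n) w.
Proof. by move=> wr; apply: ccontX; apply: ccontV; exact: circle_neq0 wr. Qed.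

(** Truncating the geometric series of the Cauchy kernel after N terms leaves the kernel multiplied
    by (z/w)^N. *)
Lemma power_series_error (B : R) z N : (0 < N)%N -> normc z < r ->
  (forall w, normc w = r -> normc (F w) <= B) ->
  normc (F z - \sum_(n < N) coef n * z ^+ n) <= 2 * (r / (r - normc z) * B) * (normc z / r) ^+ N.
Proof.
have fld (a b c w : C) : c * w * b - c * ((1 - a) * (w * b)) = c * (w * b) * a by ring.
move=> N0 zr FB; have r00 := ltW r0.
have cFr w : normc w = r -> ccont F w by move=> wr; apply: cF; rewrite wr.
have cW w : normc w = r -> ccont (fun w => (w - z)^-1) w by exact: ccont_circle_sub.
have rz : 0 < r - normc z by rewrite subr_gt0.
have B0 : 0 <= B by apply: le_trans (normc_ge0 (F r%:C)) (FB _ _); rewrite normc_real gtr0_norm.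
have ES : \sum_(n < N) coef n * z ^+ n = (2 * pi)%:C^-1 *
    cmean (fun w => F w * \sum_(n < N) (z * w^-1) ^+ n) r.
  rewrite (_ : cmean _ r = \sum_(n < N) cmean (fun w => F w * w^-1 ^+ n) r * z ^+ n).
    by rewrite mulr_sumr; apply: eq_bigr => n _; rewrite /coef mulrA.
  rewrite (_ : cmean _ r = cmean (fun w => \sum_(n < N) z ^+ n * (F w * w^-1 ^+ n)) r); last first.
    apply: eq_cmean => // w wr; rewrite mulr_sumr; apply: eq_bigr => n _.
    by rewrite exprMn; ring.
  rewrite /cmean /cint.
  have iF (n : 'I_N) : cintegrable mu `[0, 2 * pi]
      (fun t => z ^+ n * (F (r%:C * expi t) * (r%:C * expi t)^-1 ^+ n)).
    apply: (cintegrable_circle (F := fun w => z ^+ n * (F w * w^-1 ^+ n))) => // w wr.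
    by apply: ccontM; [exact: ccont_cst|apply: ccontM; auto; exact: ccont_Xinv].
  have [_ ->] := cintegral_sum (mu := mu) (F := fun (n : 'I_N) t =>
    z ^+ n * (F (r%:C * expi t) * (r%:C * expi t)^-1 ^+ n)) (index_enum 'I_N)
    (measurable_itv `[0, 2 * pi]) iF.
  apply: eq_bigr => n _; rewrite [RHS]mulrC.
  rewrite -[LHS]/(cmean (fun w => z ^+ n * (F w * w^-1 ^+ n)) r) cmeanZ //.
  by move=> w wr; apply: ccontM; auto; exact: ccont_Xinv.
have EF : (2 * pi)%:C * F z = cmean (fun w => F w * w * (w - z)^-1) r by rewrite cauchy_formula.
have -> : F z - \sum_(n < N) coef n * z ^+ n = (2 * pi)%:C^-1 *
    cmean (fun w => F w * (w * (w - z)^-1) * (z * w^-1) ^+ N) r.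
  rewrite ES -[F z](mulKf pi2C_neq0) EF -mulrBr -cmeanB //.
  - congr (_ * _); apply: eq_cmean => // w wr.
    have w0 := circle_neq0 r0 wr; have wz := sub_neq0 wr zr.
    have zw1 : z * w^-1 != 1 by rewrite -subr_eq0 -(mulfV w0) -mulrBl mulf_neq0 ?invr_eq0 // -opprB oppr_eq0.
    rewrite (_ : \sum_(n < N) _ = (1 - (z * w^-1) ^+ N) * (w * (w - z)^-1)).
      by move: ((z * w^-1) ^+ N) ((w - z)^-1) (F w) => a b c; exact: fld.
    have := subrX1 (z * w^-1) N => /(congr1 -%R); rewrite opprB => ->.
    rewrite -mulNr opprB mulrAC (_ : (1 - z * w^-1) * (w * (w - z)^-1) = 1) ?mul1r //.
    by field; rewrite w0 wz.
  - by move=> w wr; do 2 (apply: ccontM; auto); exact: ccont_id.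
  - move=> w wr; apply: ccontM; first exact: cFr.
    have cs : ccont (fun w => \sum_(n < N) (z * w^-1) ^+ n) w.
      elim: N {N0 ES} => [|n IH].
        by apply: (ccont_ext _ (ccont_cst 0 w)); exists 1 => // v _; rewrite big_ord0.
      apply: (ccont_ext (F := fun w => \sum_(n < n) (z * w^-1) ^+ n + (z * w^-1) ^+ n)).
        by exists 1 => // v _; rewrite big_ord_recr.
      apply: ccontD => //; apply: ccontX; apply: ccontM; first exact: ccont_cst.
      by apply: ccontV; exact: circle_neq0 wr.
    exact: cs.
rewrite normcM normcV normc_real gtr0_norm ?mulr_gt0 ?pi_gt0 //.
rewrite mulrC ler_pdivrMr ?mulr_gt0 ?pi_gt0 //.
apply: (le_trans (normc_cmean_le (M := r / (r - normc z) * B * (normc z / r) ^+ N) _ _ _)) => //.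
- move=> w wr; apply: ccontM.
    by apply: ccontM; auto; apply: ccontM; auto; exact: ccont_id.
  apply: ccontX; apply: ccontM; first exact: ccont_cst.
  by apply: ccontV; exact: circle_neq0 wr.
- move=> w wr; rewrite !normcM normcX normcM !normcV wr.
  apply: ler_wpM2r; first by rewrite exprn_ge0 // divr_ge0 // normc_ge0.
  rewrite mulrC; apply: ler_pM; rewrite ?normc_ge0 ?divr_ge0 ?normc_ge0 //; last exact: FB.
  rewrite ler_pM2l // lef_pV2 ?posrE //; last by rewrite normc_gt0 sub_neq0.
  by rewrite -{1}wr; exact: normc_dist.
- by rewrite le_eqVlt; apply/orP; left; apply/eqP; ring.
Qed.

End OneFunction.
End CauchyFormula.

(** * Holomorphic functions on the disc: derivatives and Taylor coefficients *)

Section Taylor.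
Context {R : realType}.
Notation C := (R[i]).
Notation mu := (@lebesgue_measure R).
Implicit Types (F G : C -> C) (z w : C) (r s t x : R) (n m : nat).

Definition cholo F := forall z, normc z < 1 -> exists l, cderiv_at F z l.

(** A total function, so that it can be iterated; 0 is the default where [F] has no derivative. *)
Definition cD F z : C := xget 0 [set l | cderiv_at F z l].

Lemma cDP F z : (exists l, cderiv_at F z l) -> cderiv_at F z (cD F z).
Proof. by move=> [l dl]; exact: (@xgetPex _ 0 _ (ex_intro _ l dl)). Qed.

Lemma cD_unique F z l : cderiv_at F z l -> cD F z = l.
Proof. by move=> dl; apply: (cderiv_unique _ dl); apply: cDP; exists l. Qed.

Lemma cderiv_quadratic F z d (K rho : R) : 0 < rho -> 0 <= K ->
  (forall w, normc (w - z) < rho -> normc (F w - F z - d * (w - z)) <= K * normc (w - z) ^+ 2) ->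
  cderiv_at F z d.
Proof.
move=> rho0 K0 H e e0; exists (Num.min rho (e / (1 + K))).
  by rewrite lt_min rho0 divr_gt0 //; lra.
move=> w; rewrite lt_min => /andP[/H B]; rewrite ltr_pdivlMr; last by lra.
move=> A; apply: (le_trans B); rewrite expr2 mulrA; apply: ler_wpM2r; first exact: normc_ge0.
by have := normc_ge0 (w - z); lra.
Qed.

Lemma normc_nat n : normc (n%:R : C) = n%:R.
Proof. by rewrite -(rmorph_nat (real_complex R)) normc_real normr_nat. Qed.

Lemma kernel_bounds z w r a : normc z < r -> normc a = r ->
  normc (w - z) < (r - normc z) / 2 -> (r - normc z) / 2 <= normc (a - w) /\ (r - normc z) / 2 <= normc (a - z).
Proof.
move=> zr ar wz; have h := normc_dist a z; split; last by rewrite ar in h; lra.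
have := normc_dist (a - z) (w - z); rewrite (_ : a - z - (w - z) = a - w); last by ring.
rewrite ar in h; lra.
Qed.

(** Differentiation under the integral sign, from explicit quadratic remainders of the kernel and of
    its square. The second part is what makes the derivative of a holomorphic function
    differentiable again. *)
Lemma cauchy_kernel_deriv (phi : C -> C) r z : 0 < r -> (forall a, normc a = r -> ccont phi a) ->
  normc z < r ->
  cderiv_at (fun w => cmean (fun a => phi a * (a - w)^-1) r) z (cmean (fun a => phi a * (a - z)^-1 ^+ 2) r) /\
  cderiv_at (fun w => cmean (fun a => phi a * (a - w)^-1 ^+ 2) r) z
    (cmean (fun a => phi a * (2 * (a - z)^-1 ^+ 3)) r).
Proof.
move=> r0 cp zr; have r00 := ltW r0.
have [B B0 hB] := circle_bounded r00 cp.
set rho : R := (r - normc z) / 2; have rho0 : 0 < rho by rewrite /rho; lra.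
have ne w a : normc (w - z) < rho -> normc a = r -> a - w != 0 /\ a - z != 0.
  move=> wz ar; have [h1 h2] := kernel_bounds zr ar wz.
  by rewrite -!normc_gt0; split; apply: lt_le_trans; [exact: rho0|exact: h1|exact: rho0|exact: h2].
have cc w a n : normc (w - z) < rho -> normc a = r -> ccont (fun a => phi a * (a - w)^-1 ^+ n) a.
  move=> wz ar; apply: ccontM; first exact: cp.
  apply: ccontX; apply: (ccont_comp (F := fun w => w^-1)); last by apply: ccontV; have [] := ne _ _ wz ar.
  by apply: ccontB; [exact: ccont_id|exact: ccont_cst].
have cc1 w a : normc (w - z) < rho -> normc a = r -> ccont (fun a => phi a * (a - w)^-1) a.
  by move=> wz ar; apply: (ccont_ext _ (cc w a 1%N wz ar)); exists 1.
have zz : normc (z - z) < rho by rewrite subrr normc0.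
have ccm (m : C) a : normc a = r -> ccont (fun a => phi a * (m * (a - z)^-1 ^+ 3)) a.
  move=> ar; apply: (ccont_ext (F := fun a => m * (phi a * (a - z)^-1 ^+ 3))).
    by exists 1 => // b _; rewrite mulrCA.
  by apply: ccontM; [exact: ccont_cst|exact: cc].
split.
  apply: (@cderiv_quadratic _ _ _ (4 * pi * (B * rho^-1 ^+ 3)) rho) => //.
    by rewrite !mulr_ge0 ?pi_ge0 ?exprn_ge0 ?invr_ge0 ?(ltW rho0).
  move=> w wz.
  have -> : cmean (fun a => phi a * (a - w)^-1) r - cmean (fun a => phi a * (a - z)^-1) r
     - cmean (fun a => phi a * (a - z)^-1 ^+ 2) r * (w - z) =
     cmean (fun a => phi a * (a - w)^-1 - phi a * (a - z)^-1 - (w - z) * (phi a * (a - z)^-1 ^+ 2)) r.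
    rewrite cmeanB //; last 2 first.
    - by move=> a ar; apply: ccontB; exact: cc1.
    - by move=> a ar; apply: ccontM; [exact: ccont_cst|exact: cc].
    rewrite cmeanB ?cmeanZ //; try by move=> a ar; first [exact: cc | exact: cc1].
    by rewrite mulrC.
  rewrite -mulrA; apply: normc_cmean_le => //.
    move=> a ar; apply: ccontB; first by apply: ccontB; exact: cc1.
    by apply: ccontM; [exact: ccont_cst|exact: cc].
  move=> a ar; have [n1 n2] := ne _ _ wz ar; have [h1 h2] := kernel_bounds zr ar wz.
  rewrite (_ : _ - _ = phi a * ((w - z) ^+ 2 * ((a - w)^-1 * (a - z)^-1 ^+ 2))); last first.
    by field; rewrite n1 n2.
  rewrite normcM normcM normcX normcM normcX !normcV -mulrA; apply: ler_pM; rewrite ?normc_ge0 //.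
    by rewrite !mulr_ge0 ?exprn_ge0 ?invr_ge0 ?normc_ge0.
    exact: hB.
  rewrite mulrC; apply: ler_wpM2r; first by rewrite exprn_ge0 // normc_ge0.
  rewrite [leRHS]exprS; apply: ler_pM; rewrite ?exprn_ge0 ?invr_ge0 ?normc_ge0 //.
    by rewrite lef_pV2 ?posrE // normc_gt0.
  by rewrite lerXn2r ?nnegrE ?invr_ge0 ?normc_ge0 ?(ltW rho0) // lef_pV2 ?posrE // normc_gt0.
apply: (@cderiv_quadratic _ _ _ (4 * pi * (B * (10 * r * rho^-1 ^+ 5))) rho) => //.
  by rewrite !mulr_ge0 ?pi_ge0 ?exprn_ge0 ?invr_ge0 ?(ltW rho0).
move=> w wz.
have -> : cmean (fun a => phi a * (a - w)^-1 ^+ 2) r - cmean (fun a => phi a * (a - z)^-1 ^+ 2) r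
   - cmean (fun a => phi a * (2 * (a - z)^-1 ^+ 3)) r * (w - z) =
   cmean (fun a => phi a * (a - w)^-1 ^+ 2 - phi a * (a - z)^-1 ^+ 2 - (w - z) * (phi a * (2 * (a - z)^-1 ^+ 3))) r.
  rewrite cmeanB //; last 2 first.
  - by move=> a ar; apply: ccontB; exact: cc.
  - by move=> a ar; apply: ccontM; [exact: ccont_cst|exact: ccm].
  rewrite cmeanB ?cmeanZ //; try by move=> a ar; first [exact: cc | exact: ccm].
  by rewrite mulrC.
rewrite -mulrA; apply: normc_cmean_le => //.
  move=> a ar; apply: ccontB; first by apply: ccontB; exact: cc.
  by apply: ccontM; [exact: ccont_cst|exact: ccm].
move=> a ar; have [n1 n2] := ne _ _ wz ar; have [h1 h2] := kernel_bounds zr ar wz.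
rewrite (_ : _ - _ = phi a * ((w - z) ^+ 2 * ((3 * (a - z) - 2 * (w - z)) * ((a - w)^-1 ^+ 2 * (a - z)^-1 ^+ 3)))); last first.
  by field; rewrite n1 n2.
rewrite normcM normcM normcX normcM normcM !normcX !normcV -mulrA; apply: ler_pM; rewrite ?normc_ge0 //.
  by rewrite !mulr_ge0 ?exprn_ge0 ?invr_ge0 ?normc_ge0.
  exact: hB.
rewrite mulrC; apply: ler_wpM2r; first by rewrite exprn_ge0 // normc_ge0.
apply: ler_pM; rewrite ?normc_ge0 //.
  by rewrite !mulr_ge0 ?exprn_ge0 ?invr_ge0 ?normc_ge0.
  apply: (le_trans (normcB _ _)); rewrite !normcM.
  rewrite !normc_nat; have := normcB a z; rewrite ar; have := normc_ge0 z; move: wz; rewrite /rho.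
  by clear -zr r0; lra.
rewrite (exprD _ 2 3); apply: ler_pM; rewrite ?exprn_ge0 ?invr_ge0 ?normc_ge0 //;
  by rewrite lerXn2r ?nnegrE ?invr_ge0 ?normc_ge0 ?(ltW rho0) // lef_pV2 ?posrE // normc_gt0.
Qed.

Lemma cholo_closed_disc F r : cholo F -> r < 1 -> forall z, normc z <= r -> exists l, cderiv_at F z l.
Proof. by move=> hF r1 z zr; apply: hF; exact: le_lt_trans r1. Qed.

(** Near [z], [cD F] is the Cauchy integral with squared kernel, which [cauchy_kernel_deriv]
    differentiates once more. *)
Theorem cholo_cD F : cholo F -> cholo (cD F).
Proof.
move=> hF z z1; pose r : R := (1 + normc z) / 2.
have [zr r1] : normc z < r /\ r < 1 by rewrite /r; split; lra.
have r0 : 0 < r by apply: le_lt_trans zr; exact: normc_ge0.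
have dF := cholo_closed_disc hF r1.
have cp a : normc a = r -> ccont (fun a => F a * a) a.
  move=> ar; apply: ccontM; last exact: ccont_id.
  by have [|l /cderiv_ccont //] := dF a; rewrite ar.
have E w : normc w < r -> F w = (2 * pi)%:C^-1 * cmean (fun a => F a * a * (a - w)^-1) r.
  by move=> wr; rewrite (cauchy_formula r0 dF wr) mulKf // pi2C_neq0.
have near_z v : normc v < r -> exists2 dl : R, 0 < dl & forall w, normc (w - v) < dl -> normc w < r.
  move=> vr; exists (r - normc v); first by rewrite subr_gt0.
  by move=> w wv; have := normc_dist w v; lra.
have D1 v : normc v < r -> cD F v = (2 * pi)%:C^-1 * cmean (fun a => F a * a * (a - v)^-1 ^+ 2) r.
  move=> vr; apply: cD_unique.
  apply: (cderiv_ext (F := fun w => (2 * pi)%:C^-1 * cmean (fun a => F a * a * (a - w)^-1) r)).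
    by have [d d0 hd] := near_z _ vr; exists d => // w /hd wr; rewrite -E.
  by apply: cderivZ; have [] := cauchy_kernel_deriv r0 cp vr.
exists ((2 * pi)%:C^-1 * cmean (fun a => F a * a * (2 * (a - z)^-1 ^+ 3)) r).
apply: (cderiv_ext (F := fun v => (2 * pi)%:C^-1 * cmean (fun a => F a * a * (a - v)^-1 ^+ 2) r)).
  by have [d d0 hd] := near_z _ zr; exists d => // w /hd wr; rewrite D1.
by apply: cderivZ; have [] := cauchy_kernel_deriv r0 cp zr.
Qed.

(* Locked, because unification would otherwise unfold it to Lebesgue integrals. *)
Definition tcoef : (C -> C) -> nat -> C := locked (fun F n => coef F 2^-1 n).

Lemma tcoefE F n : tcoef F n = coef F 2^-1 n.
Proof. by rewrite /tcoef -lock. Qed.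

Lemma coef_tcoef F r n : cholo F -> 0 < r < 1 -> coef F r n = tcoef F n.
Proof.
move=> hF /andP[r0 r1].
suff key : cmean (fun w => F w * w^-1 ^+ n) r = cmean (fun w => F w * w^-1 ^+ n) 2^-1.
  by rewrite tcoefE /coef key.
have h x y : 0 < x -> x <= y -> y < 1 ->
    cmean (fun w => F w * w^-1 ^+ n) x = cmean (fun w => F w * w^-1 ^+ n) y.
  move=> x0 xy y1; apply: cmean_const => // z /andP[xz zy].
  have [l dl] : exists l, cderiv_at F z l by apply: hF; exact: le_lt_trans y1.
  have z0 : z != 0 by rewrite -normc_gt0; exact: lt_le_trans xz.
  have [k dk] := cderiv_Xinv n z0.
  by exists (l * z^-1 ^+ n + F z * k); exact: cderivM.
have [rh|hr] := leP r 2^-1; first by apply: h => //; rewrite invf_lt1 // ltr1n.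
by apply/esym; apply: h => //; rewrite ?invr_gt0 // ltW.
Qed.

(** Integration by parts on the circle: F(w) w^-(m+1) is 2 pi-periodic in the angle, so its
    derivative has integral 0. *)
Lemma coef_cD F r m : cholo F -> 0 < r < 1 -> coef (cD F) r m = m.+1%:R * coef F r m.+1.
Proof.
move=> hF /andP[r0 r1]; have r00 := ltW r0.
have hD := cholo_cD hF.
have onr G : cholo G -> forall z, normc z = r -> exists l, cderiv_at G z l.
  by move=> hG z zr; apply: hG; rewrite zr.
have cF z : normc z = r -> ccont F z by move=> /(onr _ hF) [l /cderiv_ccont].
have cDF z : normc z = r -> ccont (cD F) z by move=> /(onr _ hD) [l /cderiv_ccont].
suff key : cmean (fun w => cD F w * w^-1 ^+ m) r = m.+1%:R * cmean (fun w => F w * w^-1 ^+ m.+1) r.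
  by rewrite /coef mulrCA key.
rewrite -cmeanZ //; last by move=> w wr; apply: ccontM; auto; apply: ccont_Xinv wr.
apply/eqP; rewrite -subr_eq0 -cmeanB //; last 2 first.
- by move=> w wr; apply: ccontM; auto; apply: ccont_Xinv wr.
- by move=> w wr; apply: ccontM; [exact: ccont_cst|apply: ccontM; auto; apply: ccont_Xinv wr].
pose G t : C := r%:C * expi t.
have nG t : normc (G t) = r by rewrite /G normc_circle.
have G0 t : G t != 0 by rewrite -normc_gt0 nG.
have dG t : derivRC G t ('i%C * G t).
  rewrite (_ : 'i%C * G t = r%:C * ('i%C * expi t)); last by rewrite /G mulrCA.
  apply: (derivRC_comp (F := fun w => r%:C * w) (derivRC_expi t)).
  by rewrite -[X in cderiv_at _ _ X]mulr1; apply: cderivZ; exact: cderiv_id.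
have dXV z n : z != 0 -> cderiv_at (fun w => w^-1 ^+ n) z (- (n%:R * z^-1 ^+ n.+1)).
  move=> z0; elim: n => [|n IH].
    rewrite mul0r oppr0; apply: (cderiv_ext _ (cderiv_cst 1 z)).
    by exists 1 => // w _; rewrite expr0.
  have := cderivM (cderivV z0) IH.
  rewrite (_ : _ + _ = - (n.+1%:R * z^-1 ^+ n.+2)); last first.
    by rewrite !exprS -natr1; move: (z^-1) (n%:R) (z^-1 ^+ n) => a b c; ring.
  by apply: cderiv_ext; exists 1 => // w _; rewrite exprS.
have dH t : derivRC (fun t => F (G t) * (G t)^-1 ^+ m.+1) t
    ('i%C * (cD F (G t) * (G t)^-1 ^+ m - m.+1%:R * (F (G t) * (G t)^-1 ^+ m.+1))).
  have dF : cderiv_at F (G t) (cD F (G t)) by apply: cDP; apply: onr hF _ _.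
  have := derivRC_comp (dG t) (cderivM dF (dXV _ m.+1 (G0 t))).
  rewrite (_ : _ * ('i%C * G t) = 'i%C * (cD F (G t) * (G t)^-1 ^+ m - m.+1%:R * (F (G t) * (G t)^-1 ^+ m.+1))) //.
  rewrite !exprS; move: ((G t)^-1 ^+ m) (cD F (G t)) (F (G t)) (m.+1%:R) => a b c d.
  by field; exact: G0.
have cI w : normc w = r -> ccont (fun w => cD F w * w^-1 ^+ m - m.+1%:R * (F w * w^-1 ^+ m.+1)) w.
  move=> wr; apply: ccontB; first by apply: ccontM; auto; apply: ccont_Xinv wr.
  by apply: ccontM; [exact: ccont_cst|apply: ccontM; auto; apply: ccont_Xinv wr].
have := cint_FTC (@pi2_ge0 R) (fun t _ => dH t) (fun t _ => contRCZ 'i%C (contRC_circle t r00 cI)).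
rewrite /G expi2pi expi0 subrr /cint cintegralZ //; last exact: (cintegrable_circle r00 cI).
move=> /eqP; rewrite mulf_eq0 => /orP[|//].
by rewrite eq_complex /= oner_eq0 andbF.
Qed.

Lemma tcoef_cD F m : cholo F -> tcoef (cD F) m = m.+1%:R * tcoef F m.+1.
Proof. by move=> hF; rewrite !tcoefE; apply: coef_cD => //; rewrite invr_gt0 ltr0n invf_lt1 ?ltr1n ?ltr0n. Qed.

End Taylor.

Section TaylorBounds.
Context {R : realType}.
Notation C := (R[i]).
Implicit Types (F G : C -> C) (z w : C) (r s t x : R) (n m : nat).

Lemma exprn_cvg0 (q K e : R) : 0 <= q < 1 -> 0 < e -> exists N0 : nat, forall N, (N0 <= N)%N -> K * q ^+ N <= e.
Proof.
move=> /andP[q0 q1] e0.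
have K1 : 0 < `|K| + 1 by have := normr_ge0 K; lra.
have := cvg_geometric (`|K| + 1) (_ : `|q| < 1); rewrite ger0_norm // => /(_ q1) /cvgrPdist_le /(_ e e0).
move=> [N0 _ hN]; exists N0 => N NN; have := hN N NN.
rewrite /geometric /= sub0r normrN normrM normrX (ger0_norm q0) (gtr0_norm K1); apply: le_trans.
by apply: ler_wpM2r; rewrite ?exprn_ge0 //; have := ler_norm K; lra.
Qed.

Lemma taylor_uniform F (rho e : R) : cholo F -> rho < 1 -> 0 < e ->
  exists N0 : nat, forall N z, (N0 <= N)%N -> normc z <= rho ->
    normc (F z - \sum_(n < N) tcoef F n * z ^+ n) <= e.
Proof.
move=> hF rho1 e0; have [rho0|rho0] := ltP rho 0.
  by exists 0%N => N z _ zr; have := normc_ge0 z; lra.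
pose r : R := (1 + rho) / 2.
have [rr r1] : rho < r /\ r < 1 by rewrite /r; split; lra.
have r0 : 0 < r by exact: le_lt_trans rr.
clearbody r.
have dF := cholo_closed_disc hF r1.
have [B B0 hB] : exists2 B : R, 0 <= B & forall z, normc z = r -> normc (F z) <= B.
  apply: circle_bounded; first exact: ltW.
  by move=> z zr; have [|l /cderiv_ccont //] := dF z; rewrite zr.
have [|N0 hN] := @exprn_cvg0 (rho / r) (2 * (r / (r - rho) * B)) e _ e0.
  by rewrite divr_ge0 ?(ltW r0) //= ltr_pdivrMr // mul1r.
exists N0.+1 => N z NN zrho.
have zr : normc z < r by exact: le_lt_trans rr.
have N0' : (0 < N)%N by exact: leq_ltn_trans NN.
have := power_series_error r0 dF N0' zr hB.
have -> : coef F r = tcoef F by apply/funext => n; apply: coef_tcoef; rewrite ?r0.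
move=> /le_trans; apply; apply: le_trans (hN N (ltnW NN)).
have d1 : 0 < r - normc z by rewrite subr_gt0.
have d2 : 0 < r - rho by rewrite subr_gt0.
apply: ler_pM.
- by rewrite !mulr_ge0 ?invr_ge0 ?(ltW d1) ?(ltW r0).
- by rewrite exprn_ge0 // divr_ge0 ?normc_ge0 ?(ltW r0).
- rewrite ler_wpM2l // ler_wpM2r // ler_wpM2l ?(ltW r0) // lef_pV2 ?posrE //; lra.
- by rewrite lerXn2r ?nnegrE ?divr_ge0 ?normc_ge0 ?(ltW r0) // ler_wpM2r // invr_ge0 ltW.
Qed.

End TaylorBounds.

Section TaylorApplications.
Context {R : realType}.
Notation C := (R[i]).
Implicit Types (F G : C -> C) (z w : C) (r s t x : R) (n m : nat).

Lemma cmean_monomial n m : cmean (fun l : C => l ^+ n * l^-1 ^+ m) 1 = (2 * pi)%:C * (n == m)%:R.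
Proof.
have nz (w : C) : normc w = 1 -> w != 0 by exact: circle_neq0.
have cX k (w : C) : ccont (fun l : C => l ^+ k) w by apply: ccontX; exact: ccont_id.
have [nm|mn|->] := ltngtP n m.
- rewrite mulr0 -(@cmean_Xinv R 1 (m - n)) ?subn_gt0 //; apply: eq_cmean => // w /nz w0.
  by rewrite -{1}(subnK (ltnW nm)) exprD mulrCA -exprMn mulfV // expr1n mulr1.
- rewrite mulr0 (@eq_cmean _ _ (fun l => l ^+ (n - m))) //; last first.
    move=> w /nz w0; rewrite -{1}(subnK (ltnW mn)) exprD -mulrA -exprMn mulfV // expr1n mulr1 //.
  rewrite (@mean_value _ _ _ 0) //.
    by rewrite expr0n subn_eq0 leqNgt mn mulr0.
  by move=> z _ _; exact: cderivX.
- rewrite (@eq_cmean _ _ (fun=> 1)) //; first by rewrite cmean_cst.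
  by move=> w /nz w0; rewrite -exprMn mulfV // expr1n.
Qed.

(** The Taylor polynomials of l -> F(l z) converge uniformly on |l| = 1, and orthogonality of
    monomials keeps only the m-th term. This is how [disc_mean] extracts one coefficient. *)
Lemma cmean_dilation F z m : cholo F -> normc z < 1 ->
  cmean (fun l => F (l * z) * l^-1 ^+ m) 1 = (2 * pi)%:C * (tcoef F m * z ^+ m).
Proof.
move=> hF z1; apply/eqP; rewrite -subr_eq0 -normc_eq0 eq_le normc_ge0 andbT.
apply/ler_addgt0Pr => e e0; rewrite add0r.
have e1 : 0 < e / (4 * pi) by rewrite divr_gt0 // mulr_gt0 // pi_gt0.
have [N0 hN] := taylor_uniform hF z1 e1.
pose N := (N0 + m.+1)%N.
have nz (w : C) : normc w = 1 -> w != 0 by exact: circle_neq0.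
have cF (w : C) : normc w = 1 -> ccont (fun l => F (l * z)) w.
  move=> w1; apply: ccont_comp; first by apply: ccontM; [exact: ccont_id|exact: ccont_cst].
  by have [|l /cderiv_ccont //] := hF (w * z); rewrite normcM w1 mul1r.
have cI (w : C) k : normc w = 1 -> ccont (fun l => l^-1 ^+ k) w.
  by move=> w1; apply: ccont_Xinv w1.
have cS (w : C) n : ccont (fun l => \sum_(i < n) tcoef F i * (l * z) ^+ i) w.
  elim: n => [|n IH].
    by apply: (ccont_ext _ (ccont_cst 0 w)); exists 1 => // v _; rewrite big_ord0.
  apply: (ccont_ext (F := fun l => \sum_(i < n) tcoef F i * (l * z) ^+ i + tcoef F n * (l * z) ^+ n)).
    by exists 1 => // v _; rewrite big_ord_recr.
  apply: ccontD => //; apply: ccontM; first exact: ccont_cst.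
  by apply: ccontX; apply: ccontM; [exact: ccont_id|exact: ccont_cst].
have E n : cmean (fun l => (\sum_(i < n) tcoef F i * (l * z) ^+ i) * l^-1 ^+ m) 1 =
    (2 * pi)%:C * (if (m < n)%N then tcoef F m * z ^+ m else 0).
  elim: n => [|n IH].
    rewrite mulr0 (@eq_cmean _ _ (fun=> 0)) // ?cmean_cst ?mulr0 // => w _.
    by rewrite big_ord0 mul0r.
  rewrite (@eq_cmean _ _ (fun l => (\sum_(i < n) tcoef F i * (l * z) ^+ i) * l^-1 ^+ m +
     (tcoef F n * z ^+ n) * (l ^+ n * l^-1 ^+ m))) //; last first.
    by move=> w _; rewrite big_ord_recr /= mulrDl exprMn; congr (_ + _); ring.
  have cX k (w : C) : ccont (fun l : C => l ^+ k) w by apply: ccontX; exact: ccont_id.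
  rewrite cmeanD //; last 2 first.
  - by move=> w w1; apply: ccontM; [exact: cS|exact: cI].
  - by move=> w w1; apply: ccontM; [exact: ccont_cst|apply: ccontM; [exact: cX|exact: cI]].
  rewrite IH cmeanZ //; last by move=> w w1; apply: ccontM; [exact: cX|exact: cI].
  rewrite cmean_monomial ltnS; have [mn|nm|->] := ltngtP m n.
  - by rewrite !mulr0 addr0.
  - by rewrite !mulr0 addr0.
  - by rewrite mulr0 add0r mulr1 mulrC.
have := E N; rewrite (_ : (m < N)%N); last by rewrite /N addnS ltnS leq_addl.
move=> <-; rewrite -cmeanB //; last 2 first.
- by move=> w w1; apply: ccontM; [exact: cF|exact: cI].
- by move=> w w1; apply: ccontM; [exact: cS|exact: cI].
rewrite (_ : e = 4 * pi * (e / (4 * pi))); last first.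
  by rewrite mulrC divfK // mulf_neq0 // gt_eqF // pi_gt0.
apply: normc_cmean_le => //.
  move=> w w1; apply: ccontB; apply: ccontM; try exact: cI; [exact: cF|exact: cS].
move=> w w1; rewrite -mulrBl normcM normcX normcV w1 invr1 expr1n mulr1.
by apply: hN; rewrite ?normcM ?w1 ?mul1r // /N leq_addr.
Qed.

(** Telescoping, from 1/(n+1)^2 <= 1/n - 1/(n+1). *)
Lemma sum_inv_sqr N : \sum_(n < N) (n.+1%:R ^+ 2)^-1 <= 2 - N%:R^-1 :> R.
Proof.
elim: N => [|N IH]; first by rewrite big_ord0 invr0 subr0.
rewrite big_ord_recr /=; case: N IH => [|N] IH.
  by rewrite big_ord0 expr1n !invr1; lra.
apply: (le_trans (lerD IH (lexx _))).
have n0 : 0 < N.+1%:R :> R by rewrite ltr0n.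
have m0 : 0 < N.+2%:R :> R by rewrite ltr0n.
have E : N.+2%:R = N.+1%:R + 1 :> R by rewrite -natr1.
suff : (N.+2%:R ^+ 2)^-1 <= N.+1%:R^-1 - N.+2%:R^-1 :> R.
  by move: (N.+1%:R^-1) (N.+2%:R^-1) ((N.+2%:R ^+ 2)^-1) => x y w; lra.
have -> : N.+1%:R^-1 - N.+2%:R^-1 = (N.+1%:R * N.+2%:R)^-1 :> R.
  rewrite E; move: (N.+1%:R : R) n0 => x x0; have x1 : x + 1 != 0 by rewrite gt_eqF //; lra.
  by field; rewrite x1 gt_eqF.
by rewrite lef_pV2 ?posrE ?mulr_gt0 ?exprn_gt0 // expr2 ler_pM2r // E; lra.
Qed.

Lemma expr_sub1_le s n : 0 <= s <= 1 -> 0 <= 1 - s ^+ n <= n%:R * (1 - s).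
Proof.
move=> /andP[s0 s1]; elim: n => [|n /andP[IH1 IH2]]; first by rewrite expr0 subrr mul0r lexx.
have sn : 0 <= s ^+ n by exact: exprn_ge0.
rewrite exprS -natr1 mulrDl mul1r; apply/andP; split.
  by rewrite subr_ge0 mulr_ile1 //; lra.
have -> : 1 - s * s ^+ n = (1 - s ^+ n) + s ^+ n * (1 - s) by ring.
apply: lerD => //; rewrite -[leRHS]mul1r; apply: ler_wpM2r; lra.
Qed.

(** On the disc |(s z)^n - z^n| <= n (1 - s), so the sum of n |a_n| serves as Lipschitz constant. *)
Lemma lipschitz_dilation F (K : R) : cholo F ->
  (forall n, normc (tcoef F (n + 5)) * n.+1%:R ^+ 3 <= K) ->
  exists2 L : R, 0 <= L & forall s z, 0 <= s <= 1 -> normc z < 1 ->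
    normc (F (s%:C * z) - F z) <= L * (1 - s).
Proof.
move=> hF hK.
have K0 : 0 <= K by apply: le_trans (hK 0%N); rewrite mulr_ge0 ?normc_ge0 // exprn_ge0.
pose a n := n%:R * normc (tcoef F n).
have a0 n : 0 <= a n by rewrite mulr_ge0 ?normc_ge0.
(* The first five terms are kept as they are. For the others n + 5 <= 5 (n + 1) bounds each term by
   5 K / (n + 1)^2, and 2 bounds the sum of inverse squares. *)
pose L : R := \sum_(n < 5) a n + 5 * K * 2.
have L0 : 0 <= L by rewrite addr_ge0 ?mulr_ge0 // sumr_ge0.
have aL N : \sum_(n < N) a n <= L.
  apply: (@le_trans _ _ (\sum_(n < 5 + N) a n)).
    by rewrite addnC big_split_ord /= lerDl sumr_ge0.
  rewrite big_split_ord /=; apply: lerD => //.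
  apply: (@le_trans _ _ (\sum_(n < N) 5 * K * (n.+1%:R ^+ 2)^-1)).
    apply: ler_sum => n _; rewrite /a addnC.
    have n0 : 0 < n.+1%:R :> R by rewrite ltr0n.
    rewrite ler_pdivlMr ?exprn_gt0 //.
    apply: (@le_trans _ _ (5 * n.+1%:R * normc (tcoef F (n + 5)) * n.+1%:R ^+ 2)).
      rewrite ler_wpM2r ?exprn_ge0 ?(ltW n0) // ler_wpM2r ?normc_ge0 //.
      by rewrite -natrM ler_nat mulnS addnC leq_add2l leq_pmull.
    rewrite -!mulrA ler_wpM2l //; apply: le_trans (hK n).
    by rewrite le_eqVlt; apply/orP; left; apply/eqP; ring.
  rewrite -mulr_sumr ler_wpM2l ?mulr_ge0 //; apply: le_trans (sum_inv_sqr N) _.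
  by rewrite gerBl invr_ge0.
exists L => // s z /[dup] s01 /andP[s0 s1] z1.
apply/ler_addgt0Pr => e e0.
have e20 : 0 < e / 2 by lra.
have [N0 hN] := taylor_uniform hF z1 e20.
have A := hN N0 z (leqnn _) (lexx _).
have B : normc (F (s%:C * z) - \sum_(n < N0) tcoef F n * (s%:C * z) ^+ n) <= e / 2.
  by apply: hN => //; rewrite normcM normc_real ger0_norm // ler_piMl ?normc_ge0.
have D : normc (\sum_(n < N0) tcoef F n * (s%:C * z) ^+ n - \sum_(n < N0) tcoef F n * z ^+ n) <= L * (1 - s).
  rewrite -sumrB; apply: (@le_trans _ _ (\sum_(n < N0) a n * (1 - s))); last first.
    by rewrite -mulr_suml ler_wpM2r // subr_ge0.
  have nsum (f : 'I_N0 -> C) : normc (\sum_(n < N0) f n) <= \sum_(n < N0) normc (f n).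
    apply: (big_ind2 (fun (x : C) (y : R) => normc x <= y)) => //.
      by rewrite normc0.
    by move=> x1 y1 x2 y2 h1 h2; apply: (le_trans (normcD _ _)); exact: lerD.
  apply: (le_trans (nsum _)); apply: ler_sum => n _.
  have -> : tcoef F n * (s%:C * z) ^+ n - tcoef F n * z ^+ n = - (tcoef F n * (z ^+ n * (1 - s ^+ n)%:C)).
    by rewrite exprMn rmorphB rmorphXn rmorph1; ring.
  have [h1 h2] := andP (expr_sub1_le n s01).
  rewrite normcN normcM normcM normcX normc_real (ger0_norm h1) /a -mulrA [leRHS]mulrCA ler_wpM2l ?normc_ge0 //.
  apply: (@le_trans _ _ (1 * (1 - s ^+ n))); last by rewrite mul1r.
  by rewrite ler_wpM2r // exprn_ile1 ?normc_ge0 // ltW.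
move: A B D; move: (\sum_(n < N0) _) (\sum_(n < N0) _) => X Y A B D.
rewrite (_ : F (s%:C * z) - F z = (F (s%:C * z) - X) + (X - Y) - (F z - Y)); last by ring.
apply: (le_trans (normcB _ _)).
by have := normcD (F (s%:C * z) - X) (X - Y); lra.
Qed.

End TaylorApplications.

(** * Changes of variables *)

Section AffineChange.
Context {R : realType}.
Notation mu := (@lebesgue_measure R).
Local Open Scope ereal_scope.

Definition affine (a b : R) (x : measurableTypeR R) : measurableTypeR R := (a * x + b)%R.

Lemma measurable_affine (a b : R) : measurable_fun setT (affine a b).
Proof.
apply: (@continuous_measurable_fun R) => x; rewrite /affine.
by apply: cvgD; [apply: cvgM; [exact: cvg_cst|exact: cvg_id]|exact: cvg_cst].
Qed.

HB.instance Definition _ (a b : R) := isMeasurableFun.Build _ _ _ _ (affine a b) (measurable_affine a b).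

(** Both sides are measures, so it is enough to compare them on half-open intervals. A negative
    slope exchanges the closed and the open end, whence the two cases. *)
Lemma lebesgue_affine (a b : R) (A : set (measurableTypeR R)) : a != 0%R -> measurable A ->
  mu A = (`|a|%R)%:E * mu (affine a b @^-1` A).
Proof.
move=> a0 mA; have ap : (0 < `|a|)%R by rewrite normr_gt0.
pose m := mscale (NngNum (normr_ge0 a)) (pushforward mu (affine a b)).
suff H : forall X, ocitv X -> mu X = m (measurable_affine a b) X.
  by rewrite (lebesgue_measure_unique H mA).
move=> _ [[u v] _ <-] /=; rewrite /m /mscale /= /pushforward.
have E i : mu [set` i] = _ := lebesgue_measure_itv i.
have [a_gt0|a_lt0] := ltP 0%R a.
  rewrite (_ : affine a b @^-1` _ = [set` `] (a^-1 * (u - b))%R, (a^-1 * (v - b))%R]]); last first.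
    apply/seteqP; split => x /=; rewrite /affine !in_itv /= ltr_pdivrMl // ler_pdivlMl //;
      by rewrite ltrBlDr lerBrDr.
  rewrite !lebesgue_measure_itv /= !lte_fin ltr_pM2l ?invr_gt0 // ltrD2r.
  case: ifP => uv; last by rewrite mule0.
  rewrite -!EFinB -EFinM gtr0_norm //; congr (_%:E).
  by rewrite -mulrBr mulrA mulfV ?gt_eqF // mul1r; ring.
have {}a_lt0 : (a < 0)%R by rewrite lt_neqAle a0.
rewrite (_ : affine a b @^-1` _ = [set` `[ (a^-1 * (v - b))%R, (a^-1 * (u - b))%R[]); last first.
  apply/seteqP; split => x /=; rewrite /affine !in_itv /= ler_ndivrMl // ltr_ndivlMl //;
    by rewrite ltrBlDr lerBrDr andbC.
rewrite !lebesgue_measure_itv /= !lte_fin ltr_nM2l ?invr_lt0 // ltrD2r.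
case: ifP => uv; last by rewrite mule0.
rewrite -!EFinB -EFinM ltr0_norm //; congr (_%:E).
by rewrite -mulrBr mulrA mulNr mulfV ?lt_eqF //; ring.
Qed.

Lemma ge0_integral_affine (a b : R) (f : measurableTypeR R -> \bar R) : a != 0%R ->
  measurable_fun setT f -> (forall x, 0 <= f x) ->
  \int[mu]_x f (a * x + b)%R = (`|a|^-1%R)%:E * \int[mu]_x f x.
Proof.
move=> a0 mf f0; have ap : (0 < `|a|)%R by rewrite normr_gt0.
have ai : (0 <= `|a|^-1)%R by rewrite invr_ge0.
transitivity (\int[pushforward mu (affine a b)]_x f x).
  by rewrite ge0_integral_pushforward //=.
transitivity (\int[mscale (NngNum ai) mu]_x f x); last by rewrite ge0_integral_mscale.
apply: eq_measure_integral => A mA _ /=; rewrite /mscale /=.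
have := lebesgue_affine b a0 mA => ->.
by rewrite muleA -EFinM mulVf ?gt_eqF // mul1e.
Qed.

End AffineChange.

Section PlaneMultiplication.
Context {R : realType}.
Notation R2 := (R * R)%type.
Notation mu := (@lebesgue_measure R).
Notation mu2 := (@lebesgue2 R).
Local Open Scope ereal_scope.

Definition toC (p : R2) : R[i] := p.1 +i* p.2.
Definition ofC (z : R[i]) : R2 := (complex.Re z, complex.Im z).

Lemma ofCK : cancel ofC toC. Proof. by case. Qed.

Definition cmul (a : R[i]) (p : R2) : R2 := ofC (a * toC p)%R.

Lemma toC_cmul a p : toC (cmul a p) = (a * toC p)%R.
Proof. by rewrite /cmul ofCK. Qed.

Lemma cmulE a p : cmul a p =
  (complex.Re a * p.1 - complex.Im a * p.2, complex.Re a * p.2 + complex.Im a * p.1)%R.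
Proof. by case: a p => [u v] [x y]. Qed.

Lemma cmulM a b p : cmul (a * b)%R p = cmul a (cmul b p).
Proof. by rewrite /cmul ofCK mulrA. Qed.

Lemma measurable_linear2 (a b : R) : measurable_fun setT (fun p : R2 => (a * p.1 + b * p.2)%R).
Proof.
by apply: measurable_funD; apply: measurable_funM => //; exact: measurable_cst.
Qed.

Lemma measurable_cmul a : measurable_fun setT (cmul a).
Proof.
apply: (eq_measurable_fun (fun p : R2 => (complex.Re a * p.1 + (- complex.Im a) * p.2,
   complex.Im a * p.1 + complex.Re a * p.2)%R)).
  by move=> p _; rewrite cmulE mulNr [(_ + complex.Re a * _)%R]addrC.
by apply: measurable_fun_pair; exact: measurable_linear2.
Qed.

Lemma ge0_integral_shear1 (a b : R) (f : R2 -> \bar R) : a != 0%R ->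
  measurable_fun setT f -> (forall x, 0 <= f x) ->
  \int[mu2]_p f (a * p.1 + b * p.2, p.2)%R = (`|a|^-1%R)%:E * \int[mu2]_p f p.
Proof.
move=> a0 mf f0.
have mg : measurable_fun setT (fun p : R2 => (a * p.1 + b * p.2, p.2)%R).
  by apply: measurable_fun_pair => //; exact: measurable_linear2.
rewrite (@fubini_tonelli2 _ _ _ _ _ mu mu (fun p => f (a * p.1 + b * p.2, p.2)%R)) //; last first.
  exact: (measurableT_comp mf mg).
rewrite (@fubini_tonelli2 _ _ _ _ _ mu mu f) // -ge0_integralZl //.
- apply: eq_integral => y _; rewrite /fubini_G /=.
  rewrite (ge0_integral_affine (b * y) (f := fun x => f (x, y))) //.
  by apply: measurableT_comp mf _; exact: pair2_measurable.
- exact: measurable_fun_fubini_tonelli_G.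
- by move=> y _; exact: integral_ge0.
Qed.

Lemma ge0_integral_shear2 (a b : R) (f : R2 -> \bar R) : a != 0%R ->
  measurable_fun setT f -> (forall x, 0 <= f x) ->
  \int[mu2]_p f (p.1, a * p.2 + b * p.1)%R = (`|a|^-1%R)%:E * \int[mu2]_p f p.
Proof.
move=> a0 mf f0.
have mg : measurable_fun setT (fun p : R2 => (p.1, a * p.2 + b * p.1)%R).
  apply: measurable_fun_pair => //.
  apply: (eq_measurable_fun (fun p : R2 => (b * p.1 + a * p.2)%R)); last exact: measurable_linear2.
  by move=> p _; rewrite addrC.
rewrite (@fubini_tonelli1 _ _ _ _ _ mu mu (fun p => f (p.1, a * p.2 + b * p.1)%R)) //; last first.
  exact: (measurableT_comp mf mg).
rewrite (@fubini_tonelli1 _ _ _ _ _ mu mu f) // -ge0_integralZl //.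
- apply: eq_integral => x _; rewrite /fubini_F /=.
  rewrite (ge0_integral_affine (b * x) (f := fun y => f (x, y))) //.
  by apply: measurableT_comp mf _; exact: pair1_measurable.
- exact: measurable_fun_fubini_tonelli_F.
- by move=> y _; exact: integral_ge0.
Qed.

(** Multiplication by p + i q with p nonzero is a product of two shears, of determinants p and (p^2
    + q^2)/p, and each shear is handled by Tonelli and [ge0_integral_affine]. *)
Lemma ge0_integral_cmul (a : R[i]) (f : R2 -> \bar R) : a != 0%R ->
  measurable_fun setT f -> (forall x, 0 <= f x) ->
  \int[mu2]_p f (cmul a p) = (normc a ^- 2)%:E * \int[mu2]_p f p.
Proof.
have H1 (b : R[i]) (h : R2 -> \bar R) : complex.Re b != 0%R ->
    measurable_fun setT h -> (forall x, 0 <= h x) ->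
    \int[mu2]_p h (cmul b p) = (normc b ^- 2)%:E * \int[mu2]_p h p.
  case: b => p q /= p0 mh h0.
  pose k : R := ((p ^+ 2 + q ^+ 2) / p)%R.
  have s0 : (0 < p ^+ 2 + q ^+ 2)%R by rewrite ltr_pwDl ?sqr_ge0 // exprn_even_gt0.
  have k0 : k != 0%R by rewrite mulf_neq0 ?invr_eq0 // gt_eqF.
  pose h2 (z : R2) := h (z.1, k * z.2 + (q / p) * z.1)%R.
  have mh2 : measurable_fun setT h2.
    apply: (measurableT_comp mh); apply: measurable_fun_pair => //.
    apply: (eq_measurable_fun (fun z : R2 => ((q / p) * z.1 + k * z.2)%R)); last exact: measurable_linear2.
    by move=> z _; rewrite addrC.
  rewrite (_ : (fun z => h (cmul (p +i* q) z)) = (fun z => h2 (p * z.1 + (- q) * z.2, z.2)%R)); last first.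
    apply/funext => z; rewrite /h2 cmulE /=; congr (h (_, _)); first by rewrite mulNr.
    by rewrite /k; field.
  rewrite (ge0_integral_shear1 (- q)%R p0 mh2); last by move=> z; exact: h0.
  rewrite (ge0_integral_shear2 (q / p)%R k0 mh) // muleA -EFinM; congr (_%:E * _).
  rewrite sqr_sqrtr ?(ltW s0) // /k normrM normfV (gtr0_norm s0).
  by field; rewrite normr_eq0 p0 gt_eqF.
move=> a0 mf f0; have [Ra|Ra] := eqVneq (complex.Re a) 0%R; last exact: H1.
have Ia : complex.Im a != 0%R by apply: contraNneq a0 => Ia; rewrite eq_complex Ra Ia /= eqxx.
(* The shears need a nonzero real part, so a purely imaginary number is written as a product of two
   multiples of 1 + i, using (1 + i)^2 = 2 i. *)
pose a1 : R[i] := (complex.Im a / 2 +i* (complex.Im a / 2))%R; pose a2 : R[i] := (1 +i* 1)%R.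
have E : a = (a1 * a2)%R by apply: eq_complexP; rewrite ?cReM ?cImM /= ?Ra; field.
rewrite E; under eq_integral do rewrite cmulM.
rewrite (H1 a2 (fun z => f (cmul a1 z))) ?oner_neq0 //; last first.
  by apply: (measurableT_comp mf); exact: measurable_cmul.
rewrite (H1 a1 f) //; last by rewrite /= mulf_neq0 // invr_eq0 pnatr_eq0.
by rewrite muleA -EFinM -invfM -exprMn -normcM mulrC.
Qed.

End PlaneMultiplication.

(** * Fubini's theorem for real- and complex-valued integrals *)

Section RealFubini.
Context d1 d2 (T1 : measurableType d1) (T2 : measurableType d2) (R : realType).
Variable m1 : {sigma_finite_measure set T1 -> \bar R}.
Variable m2 : {sigma_finite_measure set T2 -> \bar R}.
Local Open Scope ereal_scope.

(** An integrable function is finite almost everywhere, so replacing infinite values by 0 through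
    [fine] is invisible to the integral. *)
Lemma Rintegral_fine d (T : measurableType d) (m : {measure set T -> \bar R}) (F : T -> \bar R) :
  m.-integrable setT F ->
  m.-integrable setT (EFin \o (fun x => fine (F x))) /\
  \int[m]_x (fine (F x))%:E = \int[m]_x F x.
Proof.
move=> iF; have mF := measurable_int _ iF.
have mfF : measurable_fun setT (EFin \o (fun x => fine (F x))).
  by apply/measurable_EFinP; exact: measurableT_comp mF.
have ae : ae_eq m setT (EFin \o (fun x => fine (F x))) F.
  have := integrable_ae measurableT iF; apply: filterS => x /= h _.
  by rewrite fineK //; exact: h.
split; last exact: ae_eq_integral.
apply/integrableP; split => //.
have /integrableP[_ Foo] := iF.
apply: le_lt_trans Foo; apply: ge0_le_integral => //.
- exact: measurableT_comp.
- exact: measurableT_comp.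
- by move=> x _ /=; case: (F x) => [r| |] //=; rewrite ?normr0 leey.
Qed.

Lemma Rfubini1 (f : T1 * T2 -> R) : (m1 \x m2).-integrable setT (EFin \o f) ->
  m1.-integrable setT (EFin \o (fun x => (\int[m2]_y f (x, y))%R)) /\
  (\int[m1]_x (\int[m2]_y f (x, y)) = \int[m1 \x m2]_z f z)%R.
Proof.
move=> intf; have iF := integrable_fubini_F intf.
have [i1 i2] := Rintegral_fine iF; split => //.
rewrite /Rintegral; congr fine.
exact: etrans i2 (integral12_prod_meas1 intf).
Qed.

Lemma Rfubini2 (f : T1 * T2 -> R) : (m1 \x m2).-integrable setT (EFin \o f) ->
  m2.-integrable setT (EFin \o (fun y => (\int[m1]_x f (x, y))%R)) /\
  (\int[m2]_y (\int[m1]_x f (x, y)) = \int[m1 \x m2]_z f z)%R.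
Proof.
move=> intf; have mf := measurable_int _ intf.
have iF : m2.-integrable setT (fubini_G m1 (EFin \o f)).
  apply/integrableP; split; first exact: (measurable_fubini_G intf).
  have /(integrable21ltyP m1 m2 mf) := intf; apply: le_lt_trans.
  apply: ge0_le_integral => //.
  - by apply: measurableT_comp => //; exact: (measurable_fubini_G intf).
  - by apply: (measurable_fun_fubini_tonelli_G (abse \o (EFin \o f))); [exact: measurableT_comp|by move=> x; exact: abse_ge0].
  - move=> y _; apply: le_abse_integral => //.
    by apply: measurableT_comp mf _; exact: pair2_measurable.
have [i1 i2] := Rintegral_fine iF; split => //.
rewrite /Rintegral; congr fine.
exact: etrans i2 (integral21_prod_meas1 intf).
Qed.

Lemma cfubini2 (f : T1 * T2 -> R[i]) : cintegrable (m1 \x m2) setT f ->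
  cintegrable m2 setT (fun y => cintegral m1 setT (fun x => f (x, y))) /\
  cintegral m2 setT (fun y => cintegral m1 setT (fun x => f (x, y))) = cintegral (m1 \x m2) setT f.
Proof.
move=> [/Rfubini2[r1 r2] /Rfubini2[i1 i2]]; split; first by split.
by rewrite /cintegral /= r2 i2.
Qed.

End RealFubini.

(** * Rotation invariance and averages over circles *)

Section Rotation.
Context {R : realType}.
Notation R2 := (measurableTypeR R * measurableTypeR R)%type.
Notation C := (R[i]).
Notation mu := (@lebesgue_measure R).
Notation mu2 := (@lebesgue2 R).

Lemma integral_rotation (a : R[i]) (f : R2 -> \bar R) : normc a = 1 ->
  measurable_fun setT f -> (\int[mu2]_p f (cmul a p) = \int[mu2]_p f p)%E.
Proof.
move=> a1 mf; have a0 : a != 0 by rewrite -normc_gt0 a1.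
have H (h : R2 -> \bar R) : measurable_fun setT h -> (forall x, 0 <= h x)%E ->
    (\int[mu2]_p h (cmul a p) = \int[mu2]_p h p)%E.
  by move=> mh h0; rewrite ge0_integral_cmul // a1 expr1n invr1 mul1e.
rewrite [LHS]integralE [RHS]integralE; congr (_ - _)%E.
  rewrite -(H _ (measurable_funepos mf) (funepos_ge0 f)).
  by apply: eq_integral => p _; exact: (congr1 (@^~ p) (funepos_comp f (cmul a))).
rewrite -(H _ (measurable_funeneg mf) (funeneg_ge0 f)).
by apply: eq_integral => p _; exact: (congr1 (@^~ p) (funeneg_comp f (cmul a))).
Qed.

Lemma measurable_rotation : measurable_fun setT (fun q : R * R2 => cmul (expi q.1) q.2).
Proof.
have mc : measurable_fun setT (fun q : R * R2 => cos q.1).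
  apply: (measurableT_comp (f := @cos R)) => //.
  by apply: continuous_measurable_fun; exact: continuous_cos.
have ms : measurable_fun setT (fun q : R * R2 => sin q.1).
  apply: (measurableT_comp (f := @sin R)) => //.
  by apply: continuous_measurable_fun; exact: continuous_sin.
have m1 : measurable_fun setT (fun q : R * R2 => q.2.1) by apply: measurableT_comp => //.
have m2 : measurable_fun setT (fun q : R * R2 => q.2.2) by apply: measurableT_comp => //.
apply: (eq_measurable_fun (fun q : R * R2 => (cos q.1 * q.2.1 - sin q.1 * q.2.2,
   cos q.1 * q.2.2 + sin q.1 * q.2.1))).
  by move=> p _; rewrite cmulE.
apply: measurable_fun_pair.
  by apply: measurable_funB; apply: measurable_funM.
by apply: measurable_funD; apply: measurable_funM.
Qed.

(** Fubini on the product of [0, 2 pi] with the plane: for each angle the rotation preserves the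
    integral, so integrating the angle out multiplies it by 2 pi. *)
Lemma rotation_average (G : R2 -> R) : mu2.-integrable setT (EFin \o G) ->
  mu2.-integrable setT (EFin \o (fun p => \int[mu]_(t in `[0, 2 * pi]) G (cmul (expi t) p))) /\
  2 * pi * \int[mu2]_p G p = \int[mu2]_p (\int[mu]_(t in `[0, 2 * pi]) G (cmul (expi t) p)).
Proof.
move=> iG; have mG : measurable_fun setT G by apply/measurable_EFinP; exact: measurable_int iG.
pose I : set R := [set` `[0, 2 * pi]].
pose g (q : R * R2) := \1_I q.1 * G (cmul (expi q.1) q.2).
have mI : measurable_fun setT (fun q : R * R2 => \1_I q.1 : R).
  by apply: (measurableT_comp (f := \1_I : R -> R)) => //; apply: measurable_indic; exact: measurable_itv.
have mg : measurable_fun setT g.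
  apply: measurable_funM => //.
  by apply: (measurableT_comp mG); exact: measurable_rotation.
have muI : (mu I = (2 * pi)%:E)%E.
  rewrite /I; have -> : mu [set` `[0, 2 * pi]] = _ := lebesgue_measure_itv `[0, 2 * pi].
  by rewrite /= lte_fin mulr_gt0 ?pi_gt0 //= -EFinB subr0.
have iI : (\int[mu]_t (\1_I t)%:E = (2 * pi)%:E)%E.
  rewrite integral_indic //; last exact: measurable_itv.
  by rewrite -muI; congr (mu _); exact: setIT.
have ig : (mu \x mu2)%E.-integrable setT (EFin \o g).
  apply/integrable12ltyP; first exact/measurable_EFinP.
  rewrite (_ : (fun x => _) = (fun t => (\int[mu2]_p `|(G p)%:E|) * (\1_I t)%:E)%E); last first.
    apply/funext => t; rewrite muleC -(integral_rotation (a := expi t) (f := fun p => `|(G p)%:E|%E)) ?normc_expi //; last first.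
      by apply: measurableT_comp => //; exact/measurable_EFinP.
    rewrite -ge0_integralZl //.
    - by apply: eq_integral => p _; rewrite /g /= normrM ger0_norm.
    - apply: measurableT_comp => //; apply/measurable_EFinP.
      by apply: (measurableT_comp mG); exact: measurable_cmul.
  rewrite ge0_integralZl //; last 2 first.
  - by apply/measurable_EFinP; apply: measurable_indic; exact: measurable_itv.
  - by apply: integral_ge0 => p _.
  rewrite iI lte_mul_pinfty //; last by rewrite ltry.
    by apply: integral_ge0.
  have /integrableP[_ h] := iG; rewrite ge0_fin_numE //; exact: integral_ge0.
have gE p : \int[mu]_t g (t, p) = \int[mu]_(t in `[0, 2 * pi]) G (cmul (expi t) p).
  rewrite [RHS]Rintegral_mkcond; apply: eq_Rintegral => t _.
  by rewrite /g /= patchE indicE; case: ifP => _; rewrite ?mul1r ?mul0r.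
have [_ E1] := Rfubini1 ig; have [iA E2] := Rfubini2 ig.
split; first by move: iA; apply: eq_integrable => // p _; rewrite /= gE.
transitivity (\int[(mu \x mu2)%E]_z g z).
  rewrite -E1.
  have -> : (fun t => \int[mu2]_p g (t, p)) = (fun t => \int[mu2]_p G p * \1_I t).
    apply/funext => t; rewrite /g /=.
    have iGt : mu2.-integrable setT (EFin \o (fun p => G (cmul (expi t) p))).
      apply/integrableP; split.
        by apply/measurable_EFinP; apply: (measurableT_comp mG); exact: measurable_cmul.
      have /integrableP[_] := iG; congr (_ < _)%E.
      rewrite -(integral_rotation (a := expi t) (f := fun p => `|(G p)%:E|%E)) ?normc_expi //.
      by apply: measurableT_comp => //; exact/measurable_EFinP.
    rewrite RintegralZl // mulrC; congr (_ * _).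
    rewrite /Rintegral (integral_rotation (a := expi t) (f := EFin \o G)) ?normc_expi //.
    exact/measurable_EFinP.
  have fI : mu.-integrable setT (EFin \o (\1_I : R -> R)).
    apply/integrableP; split.
      by apply/measurable_EFinP; apply: measurable_indic; exact: measurable_itv.
    under eq_integral => t _ do rewrite /= ger0_norm //.
    by rewrite iI ltry.
  rewrite RintegralZl // mulrC; congr (_ * _).
  by rewrite /Rintegral iI.
by rewrite -E2; apply: eq_Rintegral => p _; rewrite gE.
Qed.

Lemma crotation_average (G : R2 -> C) : cintegrable mu2 setT G ->
  let A p := cint 0 (2 * pi) (fun t => G (cmul (expi t) p)) in
  cintegrable mu2 setT A /\ (2 * pi)%:C * cintegral mu2 setT G = cintegral mu2 setT A.
Proof.
move=> [/rotation_average[ra rE] /rotation_average[ia iE]] A; split; first by split.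
rewrite /A /cint /cintegral; apply: eq_complexP.
  by rewrite cReM /= mul0r subr0 rE.
by rewrite cImM /= mul0r addr0 iE.
Qed.

Definition discR2 : set R2 := [set p | normc (toC p) < 1].

Lemma cintegral_mkcond d (T : measurableType d) (m : {measure set T -> \bar R}) (D : set T) (f : T -> C) :
  cintegral m D f = cintegral m setT (patch (fun=> 0) D f).
Proof.
rewrite /cintegral Rintegral_mkcond [in X in _ +i* X]Rintegral_mkcond.
by congr (_ +i* _); apply: eq_Rintegral => x _; rewrite /patch; case: ifP.
Qed.

Lemma cintegrable_mkcond d (T : measurableType d) (m : {measure set T -> \bar R}) (D : set T) (f : T -> C) :
  measurable D -> cintegrable m D f <-> cintegrable m setT (patch (fun=> 0) D f).
Proof.
move=> mD; split=> [[fr fi]|[fr fi]]; split.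
- move/(integrable_mkcond _ mD): fr; apply: eq_integrable => // x _.
  by rewrite /= /patch; case: ifP.
- move/(integrable_mkcond _ mD): fi; apply: eq_integrable => // x _.
  by rewrite /= /patch; case: ifP.
- apply/(integrable_mkcond _ mD); move: fr; apply: eq_integrable => // x _.
  by rewrite /= /patch; case: ifP.
- apply/(integrable_mkcond _ mD); move: fi; apply: eq_integrable => // x _.
  by rewrite /= /patch; case: ifP.
Qed.

(** After averaging over rotations, the factor conj(z)^m singles out the m-th Taylor term of [v] on
    every circle, and radial factors are unaffected. *)
Lemma disc_mean (v : C -> C) (m : nat) (Q : R -> R) : cholo v -> measurable discR2 ->
  let F p := v (toC p) * conjc (toC p) ^+ m * (Q (normc (toC p)))%:C in
  cintegrable mu2 discR2 F ->
  cintegral mu2 discR2 F =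
  cintegral mu2 discR2 (fun p => tcoef v m * (normc (toC p) ^+ (2 * m) * Q (normc (toC p)))%:C).
Proof.
move=> hv mD F iF; apply: (mulfI (@pi2C_neq0 R)).
have iF0 := iffLR (cintegrable_mkcond _ _ mD) iF.
rewrite [in LHS]cintegral_mkcond [in RHS]cintegral_mkcond.
have E p : cint 0 (2 * pi) (fun t => (patch (fun=> 0) discR2 F) (cmul (expi t) p)) =
   (2 * pi)%:C * patch (fun=> 0) discR2 (fun p => tcoef v m * (normc (toC p) ^+ (2 * m) * Q (normc (toC p)))%:C) p.
  have [pD|pD] := boolP (p \in discR2); last first.
    have -> : forall h : R2 -> C, patch (fun=> 0) discR2 h p = 0 by move=> h; rewrite /patch (negbTE pD).
    rewrite -(cmean_cst 0 1).
    apply: eq_cintegral => t _; rewrite /patch; case: ifPn => //.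
    by rewrite !inE /discR2 /mkset toC_cmul normcM normc_expi mul1r => h; move: pD; rewrite notin_setE /discR2 /mkset h.
  have -> : forall h : R2 -> C, patch (fun=> 0) discR2 h p = h p by move=> h; rewrite /patch pD.
  move: pD; rewrite inE => pD.
  set z := toC p.
  have hm := cmean_dilation m hv pD.
  have cF0 : forall w : C, normc w = 1 -> ccont (fun l => v (l * z) * l^-1 ^+ m) w.
    move=> w w1; apply: ccontM; last exact: (@ccont_Xinv _ 1 ltr01).
    apply: ccont_comp; first by apply: ccontM; [exact: ccont_id|exact: ccont_cst].
    by have [|l /cderiv_ccont //] := hv (w * z); rewrite normcM w1 mul1r.
  transitivity (cmean (fun l => (conjc z ^+ m * (Q (normc z))%:C) * (v (l * z) * l^-1 ^+ m)) 1).
    apply: eq_cintegral => t _; rewrite /patch mem_set; last first.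
      by rewrite /discR2 /mkset toC_cmul normcM normc_expi mul1r.
    rewrite /F toC_cmul normcM normc_expi mul1r -/z mul1r.
    have -> : conjc (expi t * z) = (expi t)^-1 * conjc z.
      by rewrite -conjc_expi; case: (expi t) (z) => a b [c d]; apply: eq_complexP => /=; ring.
    rewrite exprMn; ring.
  rewrite cmeanZ ?ler01 // hm mulrCA; congr (_ * _).
  have -> : (normc z ^+ (2 * m) * Q (normc z))%:C = z ^+ m * conjc z ^+ m * (Q (normc z))%:C.
    rewrite rmorphM; congr (_ * _); rewrite -exprMn exprM rmorphXn; congr (_ ^+ _).
    by rewrite normc_sqr; case: (z) => a b; apply: eq_complexP => /=; ring.
  ring.
have [iA ->] := crotation_average iF0.
rewrite -cintegralZ //; first by apply: eq_cintegral => p _; exact: E.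
move: iA => /(cintegrableZ (2 * pi)%:C^-1 measurableT).
by apply: eq_cintegrable => // p _; rewrite [X in _ * X]E mulKf // pi2C_neq0.
Qed.

End Rotation.

(** * Measurability of open sets and of continuous functions on R^2 and R^4 *)

Section OpenMeasurable.

(** The base must consist of sets in [M]. With [M] the product sigma-algebra, this turns
    topologically open sets into measurable ones. *)
Definition countable_base (T : topologicalType) (M : set (set T)) :=
  exists B : nat -> set T, (forall n, M (B n)) /\
    forall x U, nbhs x U -> exists2 n, B n x & B n `<=` U.

Lemma countable_base_setX (T1 T2 : topologicalType) (M1 : set (set T1)) (M2 : set (set T2))
    (M : set (set (T1 * T2))) :
  countable_base M1 -> countable_base M2 -> (forall A B, M1 A -> M2 B -> M (A `*` B)) ->
  countable_base M.
Proof.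
move=> [B1 [m1 b1]] [B2 [m2 b2]] mX.
pose B n := let p := odflt (0, 0)%N (unpickle n) in B1 p.1 `*` B2 p.2.
exists B; split=> [n|[x y] U [[P Q] /= [Px Qy] PQ]]; first by apply: mX.
have [n Bx Bn] := b1 _ _ Px; have [m By Bm] := b2 _ _ Qy.
exists (pickle (n, m)); rewrite /B pickleK //=.
by move=> [u v] [/= /Bn Pu /Bm Qv]; exact: PQ.
Qed.

Lemma countable_base_bigcup (T : topologicalType) (M : set (set T)) (U : set T) :
  countable_base M -> (forall F : nat -> set T, (forall n, M (F n)) -> M (\bigcup_n F n)) ->
  M set0 -> open U -> M U.
Proof.
move=> [B [mB bB]] Mcup M0 oU.
have -> : U = \bigcup_n (if pselect (B n `<=` U) then B n else set0).
  apply/seteqP; split=> [x Ux|x [n _]]; last by case: pselect => // BU /BU.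
  have [|n Bx BU] := bB x U; first exact: open_nbhs_nbhs.
  by exists n => //; case: pselect.
by apply: Mcup => n; case: pselect => [BU|nBU]; [exact: mB|exact: M0].
Qed.

Context {R : realType}.
Notation R1 := (measurableTypeR R).
Notation R2 := (R1 * R1)%type.
Notation R4 := (R2 * R2)%type.

Lemma countable_base_real : countable_base (measurable : set (set R1)).
Proof.
pose B n : set R := let p : rat * rat := odflt (0, 0)%R (unpickle n) in
  [set` `]ratr p.1, ratr p.2[].
exists B; split=> [n|x U /nbhs_ballP[e /= e0 xU]]; first exact: measurable_itv.
have [|a] := @rat_in_itvoo R (x - e) x; first by rewrite ltrBlDr ltrDl.
have [|b] := @rat_in_itvoo R x (x + e); first by rewrite ltrDl.
rewrite !in_itv /= => /andP[xb be] /andP[ea ax].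
exists (pickle (a, b)); rewrite /B pickleK /= ?in_itv /= ?ax //.
move=> y /=; rewrite in_itv /= => /andP[ay yb]; apply: xU.
rewrite /ball /= ltr_norml; apply/andP; split; first by rewrite ltrBrDl; move: yb be; clear; lra.
by rewrite ltrBlDl; move: ay ea; clear; lra.
Qed.

Lemma countable_base_R2 : countable_base (measurable : set (set R2)).
Proof.
apply: countable_base_setX countable_base_real countable_base_real _ => A B mA mB.
exact: measurableX.
Qed.

Lemma open_measurable2 (U : set R2) : open U -> measurable U.
Proof.
apply: (countable_base_bigcup countable_base_R2); last exact: measurable0.
by move=> F mF; exact: bigcup_measurable.
Qed.

Lemma open_measurable4 (U : set R4) : open U -> measurable U.
Proof.
apply: (@countable_base_bigcup R4 (measurable : set (set R4))); last exact: measurable0.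
  apply: countable_base_setX countable_base_R2 countable_base_R2 _ => A B mA mB.
  exact: measurableX.
by move=> F mF; exact: bigcup_measurable.
Qed.

Lemma continuous_on_open_preimage (T : topologicalType) (D : set T) (f : T -> R) (U : set R) :
  open D -> (forall p, D p -> {for p, continuous f}) -> open U -> open (D `&` f @^-1` U).
Proof.
move=> oD cf oU; rewrite openE => p [Dp Up].
apply: filterI; first exact: open_nbhs_nbhs.
by apply: cf => //; exact: open_nbhs_nbhs.
Qed.

Lemma measurable_fun_continuous2 (D : set R2) (f : R2 -> R) :
  open D -> (forall p, D p -> {for p, continuous f}) -> measurable_fun D f.
Proof.
move=> oD cf; apply: (measurability (@RGenOpens.G R)).
  exact: RGenOpens.measurableE.
move=> _ [_ [a [b ->]] <-]; apply: open_measurable2.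
by apply: continuous_on_open_preimage => //; exact: interval_open.
Qed.

Lemma measurable_fun_continuous4 (D : set R4) (f : R4 -> R) :
  open D -> (forall p, D p -> {for p, continuous f}) -> measurable_fun D f.
Proof.
move=> oD cf; apply: (measurability (@RGenOpens.G R)).
  exact: RGenOpens.measurableE.
move=> _ [_ [a [b ->]] <-]; apply: open_measurable4.
by apply: continuous_on_open_preimage => //; exact: interval_open.
Qed.

End OpenMeasurable.

(** * Complex rescaling of the second coordinate, depending on the first *)

Section FiberScaling.
Context {R : realType}.
Notation R1 := (measurableTypeR R).
Notation R2 := (R1 * R1)%type.
Notation R4 := (R2 * R2)%type.
Notation C := (R[i]).
Notation mu2 := (@lebesgue2 R).
Notation mu4 := (@lebesgue4 R).
Variable s : R2 -> C.
Hypothesis mRe : measurable_fun setT (fun p => complex.Re (s p)).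
Hypothesis mIm : measurable_fun setT (fun p => complex.Im (s p)).
Hypothesis s0 : forall p, s p != 0.
Local Open Scope ereal_scope.

Definition fiber_scaling (p : R4) : R4 := (p.1, cmul (s p.1) p.2).
Notation Psi := fiber_scaling.
Notation kappa p := (normc (s p) ^+ 2)%R.

Lemma measurable_fiber_scaling : measurable_fun setT Psi.
Proof.
have c1 (f : R2 -> R) : measurable_fun setT f -> measurable_fun setT (fun p : R4 => f p.1).
  by move=> mf; apply: (measurableT_comp mf).
have m1 : measurable_fun setT (fun q : R4 => q.2.1) by apply: measurableT_comp => //.
have m2 : measurable_fun setT (fun q : R4 => q.2.2) by apply: measurableT_comp => //.
apply: (eq_measurable_fun (fun p : R4 => (p.1,
   ((complex.Re (s p.1) * p.2.1 - complex.Im (s p.1) * p.2.2)%R,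
   (complex.Re (s p.1) * p.2.2 + complex.Im (s p.1) * p.2.1)%R)))).
  by move=> p _; rewrite /Psi cmulE.
apply: measurable_fun_pair => //; apply: measurable_fun_pair.
  by apply: measurable_funB; apply: measurable_funM => //;
    first [exact: (c1 _ mRe)|exact: (c1 _ mIm)].
by apply: measurable_funD; apply: measurable_funM => //;
    first [exact: (c1 _ mRe)|exact: (c1 _ mIm)].
Qed.

Lemma measurable_kappa : measurable_fun setT (fun p => kappa p).
Proof.
apply: (eq_measurable_fun (fun p => complex.Re (s p) ^+ 2 + complex.Im (s p) ^+ 2)%R).
  by move=> p _; rewrite normc_sqr.
by apply: measurable_funD; apply: measurable_funX.
Qed.

Lemma kappa_gt0 p : (0 < kappa p)%R.
Proof. by rewrite exprn_gt0 // normc_gt0. Qed.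

(** By Tonelli the inner integral is a multiplication by the constant s(p), whose Jacobian |s(p)|^2
    cancels the weight. *)
Lemma ge0_integral_fiber_scaling (F : R4 -> \bar R) : measurable_fun setT F -> (forall p, 0 <= F p) ->
  \int[mu4]_p ((kappa p.1)%:E * F (Psi p)) = \int[mu4]_p F p.
Proof.
move=> mF F0; have mP := measurable_fiber_scaling; have mk := measurable_kappa.
have mG : measurable_fun setT (fun p : R4 => (kappa p.1)%:E * F (Psi p)).
  apply: emeasurable_funM; last exact: measurableT_comp mF mP.
  by apply/measurable_EFinP; apply: (measurableT_comp mk).
rewrite (@fubini_tonelli1 _ _ _ _ _ mu2 mu2 _ mG); last first.
  by move=> p; rewrite mule_ge0 // lee_fin sqr_ge0.
rewrite (@fubini_tonelli1 _ _ _ _ _ mu2 mu2 F) //.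
apply: eq_integral => p _; rewrite /fubini_F /=.
have mF2 : measurable_fun setT (fun q => F (p, q)) by apply: measurableT_comp mF _; exact: pair1_measurable.
rewrite ge0_integralZl //.
- by rewrite (ge0_integral_cmul (s0 p) mF2) // muleA -EFinM mulfV ?mul1e // gt_eqF // kappa_gt0.
- exact: (measurableT_comp mF2 (measurable_cmul (s p))).
- by rewrite lee_fin sqr_ge0.
Qed.

Lemma integral_fiber_scaling (F : R4 -> \bar R) : measurable_fun setT F ->
  \int[mu4]_p ((kappa p.1)%:E * F (Psi p)) = \int[mu4]_p F p.
Proof.
move=> mF; rewrite [LHS]integralE [RHS]integralE; congr (_ - _).
- rewrite -(ge0_integral_fiber_scaling (measurable_funepos mF) (funepos_ge0 F)).
  apply: eq_integral => p _; have k0 := ltW (kappa_gt0 p.1).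
  rewrite (_ : (fun p => _) = fun p : R4 => (kappa p.1)%:E * (F \o Psi) p) //.
  by rewrite !funeposE /= maxe_pMr ?lee_fin // mule0.
- rewrite -(ge0_integral_fiber_scaling (measurable_funeneg mF) (funeneg_ge0 F)).
  apply: eq_integral => p _; have k0 := ltW (kappa_gt0 p.1).
  by rewrite !funenegE /= maxe_pMr ?lee_fin // mule0 muleN.
Qed.

Lemma Rintegral_fiber_scaling (F : R4 -> R) : mu4.-integrable setT (EFin \o F) ->
  mu4.-integrable setT (EFin \o (fun p => (kappa p.1 * F (Psi p))%R)) /\
  (\int[mu4]_p (kappa p.1 * F (Psi p)) = \int[mu4]_p F p)%R.
Proof.
move=> iF; have mF : measurable_fun setT F by apply/measurable_EFinP; exact: measurable_int iF.
have mP := measurable_fiber_scaling; have mk := measurable_kappa.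
split; last first.
  rewrite /Rintegral; congr fine.
  by rewrite -(@integral_fiber_scaling (EFin \o F)) //; exact/measurable_EFinP.
apply/integrableP; split.
  apply/measurable_EFinP; apply: measurable_funM; last exact: measurableT_comp mF mP.
  by apply: (measurableT_comp mk).
have /integrableP[_] := iF; congr (_ < _).
rewrite -(@ge0_integral_fiber_scaling (fun p => `|(F p)%:E|)) //.
  by apply: eq_integral => p _; rewrite /= normrM ger0_norm ?sqr_ge0.
by apply: measurableT_comp => //; exact/measurable_EFinP.
Qed.

Lemma cintegral_fiber_scaling (F : R4 -> C) : cintegrable mu4 setT F ->
  cintegrable mu4 setT (fun p => ((kappa p.1)%:C * F (Psi p))%R) /\
  cintegral mu4 setT (fun p => ((kappa p.1)%:C * F (Psi p))%R) = cintegral mu4 setT F.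
Proof.
move=> [/Rintegral_fiber_scaling[ri rE] /Rintegral_fiber_scaling[ii iE]].
have E p : ((kappa p.1)%:C * F (Psi p))%R =
  (kappa p.1 * complex.Re (F (Psi p)))%R +i* (kappa p.1 * complex.Im (F (Psi p)))%R.
  by apply: eq_complexP; rewrite ?cReM ?cImM /= mul0r ?subr0 ?addr0.
split.
  by split; [move: ri|move: ii]; apply: eq_integrable => // p _; rewrite [in RHS]/= E.
rewrite /cintegral; congr (_ +i* _); rewrite -?rE -?iE;
  by apply: eq_Rintegral => p _; rewrite E.
Qed.

End FiberScaling.

Section ProductIntegral.
Context d1 d2 (T1 : measurableType d1) (T2 : measurableType d2) {R : realType}.
Variable m1 : {sigma_finite_measure set T1 -> \bar R}.
Variable m2 : {sigma_finite_measure set T2 -> \bar R}.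
Local Open Scope ereal_scope.

Lemma integral_prodM (a : T1 -> R) (b : T2 -> R) :
  m1.-integrable setT (EFin \o a) -> m2.-integrable setT (EFin \o b) ->
  (m1 \x m2).-integrable setT (EFin \o (fun p => (a p.1 * b p.2)%R)) /\
  (\int[m1 \x m2]_p (a p.1 * b p.2) = \int[m1]_x a x * \int[m2]_y b y)%R.
Proof.
move=> ia ib; have ma : measurable_fun setT a by apply/measurable_EFinP; exact: measurable_int ia.
have mb : measurable_fun setT b by apply/measurable_EFinP; exact: measurable_int ib.
have iab : (m1 \x m2).-integrable setT (EFin \o (fun p => (a p.1 * b p.2)%R)).
  apply/integrable12ltyP.
    apply/measurable_EFinP; apply: measurable_funM.
      by apply: (measurableT_comp ma).
    by apply: (measurableT_comp mb).
  have /integrableP[_ ha] := ia; have /integrableP[_ hb] := ib.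
  rewrite (_ : (fun x => _) = (fun x => `|(a x)%:E| * \int[m2]_y `|(b y)%:E|)); last first.
    apply/funext => x; rewrite -ge0_integralZl //.
    - by apply: eq_integral => y _; rewrite /= normrM.
    - by apply: measurableT_comp => //; exact/measurable_EFinP.
  rewrite ge0_integralZr //.
  - by apply: lte_mul_pinfty => //; [exact: integral_ge0|rewrite ge0_fin_numE //; exact: integral_ge0].
  - by apply: measurableT_comp => //; exact/measurable_EFinP.
  - exact: integral_ge0.
split=> //; have [_ <-] := Rfubini1 iab.
rewrite -RintegralZr //; apply: eq_Rintegral => x _.
by rewrite -RintegralZl.
Qed.

Lemma cintegral_prodM (a : T1 -> R[i]) (b : T2 -> R) :
  cintegrable m1 setT a -> m2.-integrable setT (EFin \o b) ->
  cintegrable (m1 \x m2) setT (fun p => (a p.1 * (b p.2)%:C)%R) /\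
  cintegral (m1 \x m2) setT (fun p => (a p.1 * (b p.2)%:C)%R) = (cintegral m1 setT a * (\int[m2]_y b y)%R%:C)%R.
Proof.
move=> [/integral_prodM hr /integral_prodM hi] ib.
have [ri rE] := hr _ ib; have [ii iE] := hi _ ib.
have E p : (a p.1 * (b p.2)%:C)%R = (complex.Re (a p.1) * b p.2)%R +i* (complex.Im (a p.1) * b p.2)%R.
  by apply: eq_complexP; rewrite ?cReM ?cImM /= mulr0 ?subr0 ?add0r.
split.
  by split; [move: ri|move: ii]; apply: eq_integrable => // p _; rewrite [in RHS]/= E.
apply: eq_complexP; rewrite /cintegral ?cReM ?cImM /= mulr0 ?subr0 ?add0r -?rE -?iE;
  by apply: eq_Rintegral => p _; rewrite E.
Qed.

End ProductIntegral.

(** * Smooth functions and weak derivatives *)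

Section Bump.
Context {R : realType}.

(* The factors [s ^- n] make the family stable under differentiation. *)
Definition ebump n (s : R) : R := if 0 < s then s ^- n * expR (- s^-1) else 0.

Lemma bump_ge0 n s : 0 <= ebump n s.
Proof.
rewrite /ebump; case: ifP => // s0.
by rewrite mulr_ge0 ?expR_ge0 // invr_ge0 exprn_ge0 // ltW.
Qed.

Lemma bump_gt0 n s : 0 < s -> 0 < ebump n s.
Proof. by move=> s0; rewrite /ebump s0 mulr_gt0 ?expR_gt0 // invr_gt0 exprn_gt0. Qed.

Lemma bump_neg n s : s <= 0 -> ebump n s = 0.
Proof. by rewrite /ebump; case: ltP => // s0; rewrite leNgt s0. Qed.

Lemma bump0_le1 s : ebump 0 s <= 1.
Proof.
rewrite /ebump; case: ifP => // s0; rewrite expr0 invr1 mul1r -[leRHS]expR0 ler_expR.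
by rewrite oppr_le0 invr_ge0 ltW.
Qed.

Lemma bump0_nondecreasing s t : s <= t -> ebump 0 s <= ebump 0 t.
Proof.
move=> st; rewrite {1}/ebump; case: ifP => s0; last exact: bump_ge0.
have t0 := lt_le_trans s0 st.
by rewrite /ebump t0 !expr0 !invr1 !mul1r ler_expR lerN2 lef_pV2 // posrE.
Qed.

(** With x = 1/s and m = n + 2, the inequality exp(x/m) >= x/m raised to the power m gives x^m
    exp(-x) <= m^m. The quadratic decay yields the derivative at 0. *)
Lemma bump_small n : exists2 K : R, 0 < K & forall s, ebump n s <= K * s ^+ 2.
Proof.
pose m := n.+2; pose K : R := m%:R ^+ m.
have m0 : (0 : R) < m%:R by rewrite ltr0n.
exists K; first exact: exprn_gt0.
move=> s; rewrite /ebump; case: ifP => s0; last by rewrite mulr_ge0 ?sqr_ge0 // exprn_ge0 // ltW.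
rewrite expRN ler_pdivrMl ?exprn_gt0 // mulrCA -exprD (_ : (n + 2)%N = m); last by rewrite addn2.
rewrite -(ler_pM2r (expR_gt0 s^-1)) mulVf ?gt_eqF ?expR_gt0 //.
have -> : expR s^-1 = expR (s^-1 / m%:R) ^+ m.
  by rewrite -expRM_natl; congr expR; rewrite mulrC divfK // gt_eqF.
rewrite /K -!exprMn; apply: exprn_ege1.
have h : s^-1 / m%:R <= expR (s^-1 / m%:R).
  by apply: le_trans (expR_ge1Dx _); rewrite lerDr.
have ms : 0 < m%:R * s by rewrite mulr_gt0.
have := ler_wpM2l (ltW ms) h; apply: le_trans.
have -> : m%:R * s * (s^-1 / m%:R) = 1; last by [].
by move: (m%:R : R) m0 s0 {ms h} => M M0 s0; field; rewrite !gt_eqF.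
Qed.

(** On either side of 0 this is calculus; at 0 the bound [bump_small] makes the derivative 0. *)
Lemma is_derive_bump n (s : R) :
  is_derive s (1 : R) (ebump n) (ebump n.+2 s - n%:R * ebump n.+1 s).
Proof.
have [s0|s0|s0] := ltgtP s 0.
- rewrite !bump_neg ?ltW // mulr0 subrr.
  apply: (@near_eq_is_derive R R R (cst 0)).
  apply: filterS (lt_nbhsl s0) => t /ltW t0.
  by rewrite bump_neg.
- apply: (@near_eq_is_derive R R R (fun y : R => (y^-1) ^+ n * expR (- y^-1))).
    apply: filterS (lt_nbhsr s0) => t t0.
    by rewrite /ebump t0 exprVn.
  have sn0 : s != 0 by rewrite gt_eqF.
  have d1 : is_derive s (1 : R) (fun y : R => y^-1) (- s ^- 2).
    by have := @is_deriveV R id s 1 1 sn0 (is_derive_id s (1 : R)); rewrite /GRing.scale /= mulr1.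
  have d2 : is_derive s (1 : R) (fun y : R => - y^-1) (s ^- 2).
    by have := is_deriveN d1; rewrite opprK.
  have d3 : is_derive s (1 : R) (fun y : R => expR (- y^-1)) (s ^- 2 * expR (- s^-1)).
    by have := @is_derive1_comp _ expR (fun y : R => - y^-1) s _ _ (is_derive_expR _) d2; rewrite mulrC.
  have d4 := is_deriveX n d1.
  have fX : forall m, ([eta GRing.inv] ^+ m : R -> R) = (fun y : R => y^-1 ^+ m).
    by elim=> [|m IH]; apply/funext => y; rewrite ?exprS ?IH // !expr0.
  have := is_deriveM d4 d3; rewrite fX; congr (is_derive _ _ _ _).
  rewrite /ebump s0 /GRing.scale /=; case: n {d4} => [|n]; first by rewrite !expr0 !mul0r; field.
  by rewrite -!exprVn /= !exprS; move: (n.+1%:R : R) (s^-1 ^+ n) => N v; ring.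
- rewrite s0 !bump_neg // mulr0 subrr; apply: derive_ReIm => e e0.
  have [K K0 hK] : exists2 K : R, 0 < K & forall s, ebump n s <= K * s ^+ 2 by exact: bump_small.
  exists (e / K); first exact: divr_gt0.
  move=> y; rewrite !subr0 mul0r subr0 => yK.
  rewrite [ebump n 0]bump_neg // subr0 ger0_norm ?bump_ge0 //; apply: le_trans (hK y) _.
  rewrite -real_normK ?num_real // expr2 mulrA ler_wpM2r //.
  by rewrite mulrC -ler_pdivlMr // ltW.
Qed.

End Bump.

(** * Real differentiability in four variables and a class stable under it *)

Section Frechet.
Context {R : realType}.
Notation R2 := (R * R)%type.
Notation R4 := (R2 * R2)%type.

Lemma differentiable_linear_approx (V : normedModType R) (f : V -> R) (L : {linear V -> R}) (p : V) :
  continuous L ->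
  (forall e : R, 0 < e -> \forall h \near (0 : V), `|f (h + p) - f p - L h| <= e * `|h|) ->
  differentiable f p /\ forall v, 'D_v f p = L v.
Proof.
move=> cL H.
have E : f \o shift p = cst (f p) + L +o_ (0 : V) id.
  apply/eqaddoP => e e0; apply: filterS (H e e0) => h.
  by rewrite /= !fctE opprD addrA.
have dL : 'd f p = L :> (V -> R) by apply: diff_unique.
have df : differentiable f p by apply/diff_locallyP; rewrite dL.
by split=> // v; rewrite deriveE // dL.
Qed.

Lemma near_eq_differentiable (V : normedModType R) (f g : V -> R) (p : V) :
  (\near p, f p = g p) -> differentiable g p -> differentiable f p.
Proof.
move=> fg /diff_locallyP[cL /eqaddoP H].
have fgp := nbhs_singleton fg.
apply: (proj1 (@differentiable_linear_approx V f ('d g p) p cL _)).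
move=> e e0; have fgh : \forall h \near (0 : V), f (h + p) = g (h + p).
  move: fg => /nbhs_normP[d d0 fgd]; apply/nbhs_normP; exists d => // h hd.
  by apply: fgd; move: hd; rewrite /= sub0r normrN opprD addrC subrK normrN.
apply: filterS2 fgh (H e e0) => h -> ; rewrite fgp.
by rewrite /= !fctE opprD addrA.
Qed.

Definition linear_form4 (a b c d : R) (h : R4) : R :=
  a * h.1.1 + b * h.1.2 + c * h.2.1 + d * h.2.2.

Lemma linear_form4_linear a b c d : linear (linear_form4 a b c d).
Proof.
have E (k x y z w x' y' z' w' : R) : a * (k * x + x') + b * (k * y + y') + c * (k * z + z') + d * (k * w + w') =
  k * (a * x + b * y + c * z + d * w) + (a * x' + b * y' + c * z' + d * w') by ring.
by move=> k [[x y] [z w]] [[x' y'] [z' w']]; exact: E.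
Qed.

HB.instance Definition _ a b c d := GRing.isLinear.Build R R4 R *:%R (linear_form4 a b c d)
  (linear_form4_linear a b c d).

Lemma coord4_continuous (p : R4) : [/\ {for p, continuous (fun h : R4 => h.1.1)},
  {for p, continuous (fun h : R4 => h.1.2)}, {for p, continuous (fun h : R4 => h.2.1)} &
  {for p, continuous (fun h : R4 => h.2.2)}].
Proof.
have c1 (T1 T2 : topologicalType) (q : T1 * T2) : {for q, continuous fst} by exact: cvg_fst.
have c2 (T1 T2 : topologicalType) (q : T1 * T2) : {for q, continuous snd} by exact: cvg_snd.
by split; [apply: (continuous_comp (c1 _ _ p) (c1 _ _ p.1))|
  apply: (continuous_comp (c1 _ _ p) (c2 _ _ p.1))|
  apply: (continuous_comp (c2 _ _ p) (c1 _ _ p.2))|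
  apply: (continuous_comp (c2 _ _ p) (c2 _ _ p.2))].
Qed.

Lemma linear_form4_continuous a b c d : continuous (linear_form4 a b c d).
Proof.
move=> p; have [h1 h2 h3 h4] := coord4_continuous p.
by apply: cvgD; [apply: cvgD; [apply: cvgD|]|]; apply: cvgM => //; exact: cvg_cst.
Qed.

Lemma coord4_le (h : R4) : [/\ `|h.1.1| <= `|h|, `|h.1.2| <= `|h|, `|h.2.1| <= `|h| & `|h.2.2| <= `|h|].
Proof.
have m (V W : normedModType R) (q : V * W) : `|q.1| <= `|q| /\ `|q.2| <= `|q|.
  by rewrite /Num.norm /= le_max lexx le_max lexx orbT.
have [h1 h2] := m _ _ h; have [h11 h12] := m _ _ h.1; have [h21 h22] := m _ _ h.2.
by split; [exact: le_trans h11 _|exact: le_trans h12 _|exact: le_trans h21 _|exact: le_trans h22 _].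
Qed.

Lemma nbhs_coord4 (e : R) : 0 < e -> \forall h \near (0 : R4), normc (toC h.1) < e.
Proof.
move=> e0; apply/nbhs_normP; exists (e / 2); first exact: divr_gt0.
move=> h hh; have he : `|h| < e / 2 by move: hh; rewrite /= sub0r normrN.
apply: le_lt_trans (normc_ReIm _) _; have [h1 h2 _ _] := coord4_le h.
by move: he h1 h2 => /=; clear; lra.
Qed.

Definition diff4 (f : R4 -> R) (D : 'I_4 -> R) (p : R4) :=
  differentiable f p /\ forall i, 'D_(basis4 i) f p = D i.

Lemma linear_form4_basis a b c d (i : 'I_4) :
  linear_form4 a b c d (basis4 i) = nth 0 [:: a; b; c; d] i.
Proof.
by case: i => -[|[|[|[|//]]]] i4; rewrite /linear_form4 /= ?mulr1 ?mulr0 ?addr0 ?add0r.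
Qed.

Lemma diff4_linear_form (a b c d : R) p : diff4 (linear_form4 a b c d) (fun i => nth 0 [:: a; b; c; d] i) p.
Proof.
have cL := @linear_form4_continuous a b c d.
split; first exact: linear_differentiable.
move=> i; rewrite deriveE; last exact: linear_differentiable.
by rewrite diff_lin //; exact: linear_form4_basis.
Qed.

Lemma diff4_cst c p : diff4 (fun=> c) (fun=> 0) p.
Proof. by split; [exact: differentiable_cst|move=> i; exact: derive_cst]. Qed.

Lemma diff4D f g D E p : diff4 f D p -> diff4 g E p -> diff4 (fun p => f p + g p) (fun i => D i + E i) p.
Proof.
move=> [df hf] [dg hg]; split; first exact: differentiableD.
by move=> i; rewrite -hf -hg; apply: deriveD; exact: diff_derivable.
Qed.

Lemma diff4M f g D E p : diff4 f D p -> diff4 g E p ->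
  diff4 (fun p => f p * g p) (fun i => f p * E i + g p * D i) p.
Proof.
move=> [df hf] [dg hg]; split; first exact: differentiableM.
by move=> i; rewrite -hf -hg; apply: deriveM; exact: diff_derivable.
Qed.

Lemma diff4_comp (b b' : R -> R) f D p : diff4 f D p -> is_derive (f p) (1 : R) b (b' (f p)) ->
  diff4 (fun p => b (f p)) (fun i => b' (f p) * D i) p.
Proof.
move=> [df hf] db; have db1 : differentiable b (f p).
  by apply/derivable1_diffP; exact: ex_derive.
have dbf : differentiable (b \o f) p by exact: differentiable_comp.
split=> // i; rewrite -hf !deriveE // diff_comp //= diff1E // derive1E derive_val.
by rewrite /GRing.scale /= mulrC.
Qed.

(** The Cauchy-Riemann equations: the real differential of [F] is multiplication by [l], and [F]
    does not see the last two coordinates. *)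
Lemma diff4_holo (F : R[i] -> R[i]) p l : cderiv_at F (toC p.1) l ->
  diff4 (fun p => complex.Re (F (toC p.1))) (fun i => nth 0 [:: complex.Re l; - complex.Im l; 0; 0] i) p /\
  diff4 (fun p => complex.Im (F (toC p.1))) (fun i => nth 0 [:: complex.Im l; complex.Re l; 0; 0] i) p.
Proof.
move=> dF.
have H (e : R) : 0 < e -> \forall h \near (0 : R4),
    normc (F (toC (h + p).1) - F (toC p.1) - l * toC h.1) <= e * `|h|.
  move=> e0; have e2 : 0 < e / 2 by exact: divr_gt0.
  have [dl dl0 K] := dF _ e2.
  apply: filterS (nbhs_coord4 dl0) => h hd.
  have E : toC (h + p).1 - toC p.1 = toC h.1.
    by rewrite /toC; apply: eq_complexP => /=; ring.
  have := K (toC (h + p).1); rewrite E => /(_ hd) /le_trans; apply.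
  have hh : normc (toC h.1) <= `|h.1.1| + `|h.1.2| := normc_ReIm (toC h.1).
  have [h1 h2 _ _] := coord4_le h.
  have : normc (toC h.1) <= 2 * `|h| by move: hh h1 h2; move: (normc _) => N; clear; lra.
  by move=> /(ler_wpM2l (ltW e2)) /le_trans; apply; rewrite mulrA divfK.
have S f (a b : R) : (forall e : R, 0 < e -> \forall h \near (0 : R4), `|f (h + p) - f p - linear_form4 a b 0 0 h| <= e * `|h|) ->
    diff4 f (fun i => nth 0 [:: a; b; 0; 0] i) p.
  move=> /(differentiable_linear_approx (@linear_form4_continuous a b 0 0)) [df hf].
  by split=> // i; rewrite hf; exact: linear_form4_basis.
split; apply: S => e e0; apply: filterS (H _ e0) => h; apply: le_trans.
- apply: le_trans (Re_normc _).
  rewrite cReD cReN cReD cReN cReM /linear_form4 /toC /= -lerN2.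
  by rewrite lerN2 le_eqVlt; apply/orP; left; apply/eqP; congr `|_|; ring.
- apply: le_trans (Im_normc _).
  rewrite cImD cImN cImD cImN cImM /linear_form4 /toC /= -lerN2.
  by rewrite lerN2 le_eqVlt; apply/orP; left; apply/eqP; congr `|_|; ring.
Qed.

(* Smooth functions on the product of the disc and C.  Holomorphic functions of
   z1, coordinates of z2 and bumps suffice here, and the class is stable under
   partial derivatives. *)
Inductive alg : (R4 -> R) -> Prop :=
| alg_cst c : alg (fun=> c)
| alg_x2 : alg (fun p => p.2.1)
| alg_y2 : alg (fun p => p.2.2)
| alg_Re F : cholo F -> alg (fun p => complex.Re (F (toC p.1)))
| alg_Im F : cholo F -> alg (fun p => complex.Im (F (toC p.1)))
| alg_add f g : alg f -> alg g -> alg (fun p => f p + g p)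
| alg_mul f g : alg f -> alg g -> alg (fun p => f p * g p)
| alg_bump n f : alg f -> alg (fun p => ebump n (f p)).

Definition bidisc4 : set R4 := [set p | normc (toC p.1) < 1].
Notation O := bidisc4.

(** Structural induction: [cD] preserves the holomorphic generators, and [is_derive_bump] expresses
    the derivative of a bump by bumps. *)
Lemma alg_diff f : alg f -> exists D : 'I_4 -> R4 -> R,
  (forall i, alg (D i)) /\ forall p, O p -> diff4 f (D^~ p) p.
Proof.
elim=> {f} [c|||F hF|F hF|f g _ [D [aD hD]] _ [E [aE hE]]|f g af [D [aD hD]] ag [E [aE hE]]|n f af [D [aD hD]]].
- exists (fun _ => fun=> 0); split=> [i|p _]; [exact: alg_cst|exact: diff4_cst].
- exists (fun i => fun=> nth 0 [:: 0; 0; 1; 0] i); split=> [i|p _]; first exact: alg_cst.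
  have := diff4_linear_form 0 0 1 0 p; congr (diff4 _ _ _).
  by apply/funext => q; rewrite /linear_form4 !mul0r !add0r addr0 mul1r.
- exists (fun i => fun=> nth 0 [:: 0; 0; 0; 1] i); split=> [i|p _]; first exact: alg_cst.
  have := diff4_linear_form 0 0 0 1 p; congr (diff4 _ _ _).
  by apply/funext => q; rewrite /linear_form4 !mul0r !add0r mul1r.
- exists (fun i p => nth 0 [:: complex.Re (cD F (toC p.1)); - complex.Im (cD F (toC p.1)); 0; 0] i).
  have hD := cholo_cD hF.
  split=> [|p Op]; last by have [] := diff4_holo (cDP (hF _ Op)).
  case=> -[|[|[|[|//]]]] i4 /=; [exact: alg_Re| |exact: alg_cst|exact: alg_cst].
  rewrite (_ : (fun p => _) = (fun p : R4 => (-1) * complex.Im (cD F (toC p.1)))).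
    by apply: alg_mul; [exact: alg_cst|exact: alg_Im].
  by apply/funext => p; rewrite mulN1r.
- exists (fun i p => nth 0 [:: complex.Im (cD F (toC p.1)); complex.Re (cD F (toC p.1)); 0; 0] i).
  have hD := cholo_cD hF.
  split=> [|p Op]; last by have [] := diff4_holo (cDP (hF _ Op)).
  by case=> -[|[|[|[|//]]]] i4 /=; [exact: alg_Im|exact: alg_Re|exact: alg_cst|exact: alg_cst].
- exists (fun i p => D i p + E i p); split=> [i|p Op]; first exact: alg_add.
  by apply: diff4D; [exact: hD|exact: hE].
- exists (fun i p => f p * E i p + g p * D i p); split=> [i|p Op].
    by apply: alg_add; apply: alg_mul.
  by apply: diff4M; [exact: hD|exact: hE].
- exists (fun i p => (ebump n.+2 (f p) + - n%:R * ebump n.+1 (f p)) * D i p); split=> [i|p Op].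
    apply: alg_mul => //; apply: alg_add; first exact: alg_bump.
    by apply: alg_mul; [exact: alg_cst|exact: alg_bump].
  apply: (@diff4_comp _ (fun s => ebump n.+2 s + - n%:R * ebump n.+1 s)); first exact: hD.
  by rewrite mulNr; exact: is_derive_bump.
Qed.

Lemma alg_continuous f p : alg f -> O p -> {for p, continuous f}.
Proof.
by move=> /alg_diff[D [_ hD]] /hD[df _]; exact: differentiable_continuous.
Qed.

End Frechet.

(** * Compactly supported functions and integration by parts *)

Section BoundedSupport.
Context {R : realType}.
Notation R1 := (measurableTypeR R).
Notation R2 := (R1 * R1)%type.
Notation R4 := (R2 * R2)%type.
Notation mu := (@lebesgue_measure R).
Notation mu2 := (@lebesgue2 R).
Notation mu4 := (@lebesgue4 R).

Lemma bounded_support_integrable d (T : measurableType d) (m : {measure set T -> \bar R})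
    (D : set T) (f : T -> R) (B : R) : measurable D -> (m D < +oo)%E -> measurable_fun setT f ->
  (forall x, `|f x| <= B) -> (forall x, ~ D x -> f x = 0) -> m.-integrable setT (EFin \o f).
Proof.
move=> mD Doo mf fB f0.
apply: (@le_integrable _ _ _ m _ measurableT _ (fun x => (B * \1_D x)%:E)).
- exact/measurable_EFinP.
- move=> x _; rewrite /= lee_fin indicE; case: (boolP (x \in D)) => xD.
    by rewrite mulr1; apply: le_trans (fB x) (ler_norm _).
  by rewrite f0 ?normr0 // => /mem_set; exact/negP.
apply: (eq_integrable measurableT (fun x => (B%:E * (\1_D x)%:E)%E)) => //.
apply: integrableZl => //; apply/integrableP; split.
  by apply/measurable_EFinP; exact: measurable_indic.
under eq_integral => x _ do rewrite /= ger0_norm //.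
rewrite integral_indic //.
by have -> : D `&` setT = D by exact: setIT.
Qed.

Definition box1 (M : R) : set R1 := [set` `[-M, M]].
Definition box2 M : set R2 := box1 M `*` box1 M.
Definition box4 M : set R4 := box2 M `*` box2 M.

Lemma measurable_box1 M : measurable (box1 M). Proof. exact: measurable_itv. Qed.
Lemma measurable_box2 M : measurable (box2 M).
Proof. by apply: measurableX; exact: measurable_box1. Qed.
Lemma measurable_box4 M : measurable (box4 M).
Proof. by apply: measurableX; exact: measurable_box2. Qed.

Lemma box1_lty M : (mu (box1 M) < +oo)%E.
Proof.
rewrite /box1; have -> : mu [set` `[-M, M]] = _ := lebesgue_measure_itv `[-M, M].
by case: ifP => _; rewrite ltry.
Qed.

Lemma box2_lty M : (mu2 (box2 M) < +oo)%E.
Proof.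
rewrite /box2 /lebesgue2 product_measure1E; try exact: measurable_box1.
by rewrite lte_mul_pinfty ?box1_lty // ge0_fin_numE ?box1_lty.
Qed.

Lemma box4_lty M : (mu4 (box4 M) < +oo)%E.
Proof.
rewrite /box4 /lebesgue4 product_measure1E; try exact: measurable_box2.
by rewrite lte_mul_pinfty ?box2_lty // ge0_fin_numE ?box2_lty.
Qed.

Lemma compact_box4 M : compact (box4 M : set ((R * R) * (R * R))%type).
Proof. by apply: compact_setX; apply: compact_setX; exact: segment_compact. Qed.

Lemma compact_sub_box4 (K : set ((R * R) * (R * R))%type) : compact K -> exists2 M, 0 < M & K `<=` box4 M.
Proof.
move=> /compact_bounded [M0 [Mr hM]]; exists (`|M0| + 1); first by rewrite ltr_wpDl.
move=> p Kp; have hp : `|p| <= `|M0| + 1.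
  by apply: hM Kp; apply: le_lt_trans (ler_norm _) _; rewrite ltrDl.
have [h1 h2 h3 h4] := coord4_le p.
by split; split; rewrite /box1 /= in_itv /= -ler_norml; apply: le_trans hp.
Qed.

Lemma continuous_bounded_support (f : ((R * R) * (R * R))%type -> R) M :
  continuous f -> (forall p, ~ box4 M p -> f p = 0) -> exists2 B, 0 <= B & forall p, `|f p| <= B.
Proof.
move=> cf f0.
have /compact_bounded[B0 [_ hB]] : compact (f @` (box4 M)).
  apply: continuous_compact; last exact: compact_box4.
  exact: continuous_subspaceT.
exists (`|B0| + 1); first by rewrite addr_ge0.
move=> p; have [bp|bp] := pselect (box4 M p); last by rewrite f0 // normr0 addr_ge0.
apply: hB; last by exists p.
by apply: le_lt_trans (ler_norm _) _; rewrite ltrDl.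
Qed.

Lemma continuous_support_integrable (f : R4 -> R) M : continuous (f : ((R * R) * (R * R))%type -> R) ->
  (forall p, ~ box4 M p -> f p = 0) -> mu4.-integrable setT (EFin \o f).
Proof.
move=> cf f0; have [B B0 fB] := continuous_bounded_support cf f0.
apply: (bounded_support_integrable (measurable_box4 M) (box4_lty M) _ fB f0).
by apply: measurable_fun_continuous4 => [|p _]; [exact: openT|exact: cf].
Qed.

Lemma integral_derivative0 (F u : R -> R) (M : R) : 0 < M -> (forall x, is_derive x (1 : R) F (u x)) ->
  continuous u -> (forall x, ~ box1 M x -> F x = 0 /\ u x = 0) -> \int[mu]_x u x = 0.
Proof.
move=> M0 dF cu F0.
have b1 x : M + 1 < `|x| + 1 -> ~ box1 M x.
  by rewrite ltrD2r => h; rewrite /box1 /= in_itv /= -ler_norml => /(lt_le_trans h); rewrite ltxx.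
(* M + 1 rather than M, because [F] is known to vanish only strictly outside the closed interval
   [-M, M]. *)
have -> : \int[mu]_x u x = \int[mu]_(x in `[- (M + 1), M + 1]) u x.
  rewrite [RHS]Rintegral_mkcond; apply: eq_Rintegral => x _; rewrite patchE.
  case: ifPn => // /negP xM; have [] // := F0 x; apply: b1.
  rewrite ltrD2r ltNge; apply/negP => xM'; apply: xM; rewrite inE /= in_itv /= -ler_norml.
  by apply: le_trans xM' _; rewrite lerDl.
have hM : - (M + 1) <= M + 1 by move: M0; clear; lra.
have bM : M < `|M + 1| by rewrite ger0_norm ?addr_ge0 ?ltW // ltrDl.
rewrite (Rintegral_FTC (F := F) hM) // ; first last.
- by move=> x _; exact: cu.
- have [-> _] : F (M + 1) = 0 /\ u (M + 1) = 0 by apply: F0; apply: b1; rewrite ltrD2r.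
  have [-> _] : F (- (M + 1)) = 0 /\ u (- (M + 1)) = 0 by apply: F0; apply: b1; rewrite ltrD2r normrN.
  exact: subrr.
Qed.

End BoundedSupport.

Section IntegrationByParts.
Context {R : realType}.
Notation V4 := ((R * R) * (R * R))%type.
Notation R1 := (measurableTypeR R).
Notation R2 := (R1 * R1)%type.
Notation R4 := (R2 * R2)%type.
Notation mu := (@lebesgue_measure R).
Notation mu2 := (@lebesgue2 R).
Notation mu4 := (@lebesgue4 R).

Lemma is_derive_line (V : normedModType R) (F : V -> R) (v q : V) (t : R) :
  differentiable F (t *: v + q) ->
  is_derive t (1 : R) (fun s => F (s *: v + q)) ('D_v F (t *: v + q)).
Proof.
move=> dF; set p := t *: v + q.
have E : (fun h : R => h^-1 *: (((fun s => F (s *: v + q)) \o shift t) (h *: (1 : R)) - F p)) =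
    (fun h => h^-1 *: ((F \o shift p) (h *: v) - F p)).
  apply/funext => h /=; congr (_ *: (F _ - _)).
  by rewrite /p addrA -scalerDl [h *: 1]mulr1.
have dv : derivable F p v by exact: diff_derivable.
by apply: DeriveDef; [rewrite /derivable E|rewrite /derive E].
Qed.

Lemma box4_outside (M : R) (p : V4) : ~ box1 M p.1.1 \/ ~ box1 M p.1.2 \/ ~ box1 M p.2.1 \/ ~ box1 M p.2.2 ->
  ~ box4 M p.
Proof. by move=> h [[h1 h2] [h3 h4]]; case: h => [|[|[|]]]; apply. Qed.

Lemma Rintegral_zero d (T : measurableType d) (m : {measure set T -> \bar R}) (f : T -> R) :
  (forall x, f x = 0) -> \int[m]_x f x = 0.
Proof. by move=> f0; rewrite /Rintegral; under eq_integral => x _ do rewrite f0; rewrite integral0. Qed.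

Lemma integral2_zero (f : R2 -> R) : mu2.-integrable setT (EFin \o f) ->
  (forall y, \int[mu]_x f (x, y) = 0) \/ (forall x, \int[mu]_y f (x, y) = 0) -> \int[mu2]_p f p = 0.
Proof.
move=> fi [h|h]; [have [_ E] := Rfubini2 fi|have [_ E] := Rfubini1 fi].
  rewrite -[LHS]E. exact: Rintegral_zero.
rewrite -[LHS]E. exact: Rintegral_zero.
Qed.
(** Fubini with the i-th coordinate innermost reduces the claim to [integral_derivative0] on lines
    parallel to [basis4 i]. *)
Lemma integral_partial0 (F G : V4 -> R) (i : 'I_4) (M : R) : 0 < M ->
  (forall p, differentiable F p) -> (forall p, 'D_(basis4 i) F p = G p) ->
  continuous G -> (forall p, ~ box4 M p -> F p = 0 /\ G p = 0) ->
  \int[mu4]_p G p = 0.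
Proof.
move=> M0 dF FG cG F0.
have G0 p : ~ box4 M p -> G p = 0 by move=> /F0[].
have iG := continuous_support_integrable cG G0.
have [B B0 GB] := continuous_bounded_support cG G0.
have bb1 : box1 M (0 : R) by rewrite /box1 /= in_itv /= oppr_le0 ltW.
have Z (w : R1 -> V4) (q : V4) : (forall s, w s = s *: (basis4 i : V4) + q) ->
    (forall s, ~ box1 M s -> ~ box4 M (w s)) -> \int[mu]_s G (w s) = 0.
  move=> wE wb; have cw : continuous (w : R -> V4).
    by move=> s; rewrite (funext wE); apply: cvgD; [apply: cvgZr_tmp; exact: cvg_id|exact: cvg_cst].
  apply: (@integral_derivative0 _ (fun s => F (w s)) _ M) => //.
  - by move=> s; rewrite (funext wE) -FG; exact: is_derive_line.
  - by move=> s; apply: (continuous_comp (cw s)); exact: cG.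
  - by move=> s /wb /F0.
have I2 (w : R2 -> V4) : continuous (w : (R * R)%type -> V4) ->
    (forall s, ~ box2 M s -> ~ box4 M (w s)) -> mu2.-integrable setT (EFin \o (fun s => G (w s))).
  move=> cw wb; apply: (bounded_support_integrable (B := B) (measurable_box2 M) (box2_lty M)) => //.
  - apply: measurable_fun_continuous2; first exact: openT.
    by move=> s _; apply: (continuous_comp (cw s)); exact: cG.
  - by move=> s /wb /G0.
have c1 (q : (R * R)%type) : continuous (fun s : (R * R)%type => (s, q) : V4).
  by move=> s; exact: (cvg_pair (@cvg_id _ (nbhs s)) (cvg_cst q)).
have c2 (q : (R * R)%type) : continuous (fun s : (R * R)%type => (q, s) : V4).
  by move=> s; exact: (cvg_pair (cvg_cst q) (@cvg_id _ (nbhs s))).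
have I21 q := I2 _ (c1 q) (fun s h => fun hb => h hb.1).
have I22 q := I2 _ (c2 q) (fun s h => fun hb => h hb.2).
have [_ E1] := Rfubini1 iG; have [_ E2] := Rfubini2 iG.
have bE (k : R) (h : 'I_4) (x y z w : R) : k *: (basis4 h : V4) + ((x, y), (z, w)) =
   ((k * (h == 0 :> nat)%:R + x, k * (h == 1 :> nat)%:R + y), (k * (h == 2 :> nat)%:R + z, k * (h == 3 :> nat)%:R + w)) by [].
case: (i) Z => -[|[|[|[|//]]]] i4 Z.
- rewrite -E2; apply: Rintegral_zero => q; apply: (integral2_zero (I21 q)); left => y.
  apply: (Z _ ((0, y), q)); last by move=> s h; apply: box4_outside; left.
  by case: q => z w s; rewrite bE /= mulr1 !mulr0 !add0r addr0.
- rewrite -E2; apply: Rintegral_zero => q; apply: (integral2_zero (I21 q)); right => y.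
  apply: (Z _ ((y, 0), q)); last by move=> s h; apply: box4_outside; right; left.
  by case: q => z w s; rewrite bE /= mulr1 !mulr0 !add0r addr0.
- rewrite -E1; apply: Rintegral_zero => q; apply: (integral2_zero (I22 q)); left => y.
  apply: (Z _ (q, (0, y))); last by move=> s h; apply: box4_outside; right; right; left.
  by case: q => z w s; rewrite bE /= mulr1 !mulr0 !add0r addr0.
- rewrite -E1; apply: Rintegral_zero => q; apply: (integral2_zero (I22 q)); right => y.
  apply: (Z _ (q, (y, 0))); last by move=> s h; apply: box4_outside; right; right; right.
  by case: q => z w s; rewrite bE /= mulr1 !mulr0 !add0r addr0.
Qed.

End IntegrationByParts.

Section TestFunctions.
Context {R : realType}.
Notation V4 := ((R * R) * (R * R))%type.
Notation R1 := (measurableTypeR R).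
Notation R2 := (R1 * R1)%type.
Notation R4 := (R2 * R2)%type.
Notation mu4 := (@lebesgue4 R).

Definition tsupport (f : V4 -> R) : set V4 := closure [set p | f p != 0].

Lemma tsupport_out f p : ~ tsupport f p -> \near p, f p = 0.
Proof.
move=> np; have : nbhs p (~` tsupport f).
  by apply: open_nbhs_nbhs; split=> //; apply: closed_openC; exact: closed_closure.
apply: filterS => q nq; apply/eqP; apply/negPn/negP => fq.
by apply: nq; exact: subset_closure.
Qed.

Lemma partial_near0 i (f : V4 -> R) p : (\near p, f p = 0) -> partial i f p = 0.
Proof.
move=> f0; rewrite /partial -[RHS](derive_cst (0 : R) p (basis4 i)).
exact: near_eq_derive.
Qed.

Lemma test_function_partial i (W : set V4) (phi : V4 -> R) : test_function W phi -> test_function W (partial i phi).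
Proof.
move=> [sm cpt sub].
have S : tsupport (partial i phi) `<=` tsupport phi.
  rewrite [X in _ `<=` X](closure_id _).1; last exact: closed_closure.
  apply: closure_subset => p /= h; apply: contrapT => np; move/negP: h; apply; apply/eqP.
  by apply: partial_near0; exact: tsupport_out.
split.
- by move=> s p; rewrite -foldr_rcons; exact: sm.
- by apply: (subclosed_compact _ cpt S); exact: closed_closure.
- exact: subset_trans S sub.
Qed.

Lemma test_function_continuous (W : set V4) (phi : V4 -> R) : test_function W phi -> continuous phi.
Proof. by move=> [sm _ _] p; apply: differentiable_continuous; exact: (sm [::] p). Qed.

Section Extension.
Variables (W K : set V4) (f psi : V4 -> R).
Hypothesis oW : open W.
Hypothesis cK : closed K.
Hypothesis KW : K `<=` W.
Hypothesis cf : forall p, W p -> {for p, continuous f}.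
Hypothesis cpsi : continuous psi.
Hypothesis psi0 : forall p, ~ K p -> psi p = 0.

(** [f] is controlled only on [W], but [psi] vanishes off a closed subset of [W], so the extension
    of the product by 0 is continuous everywhere. *)
Let E : V4 -> R := patch (fun=> 0) W (fun p => f p * psi p).

Lemma extension_in p : W p -> \near p, E p = f p * psi p.
Proof.
move=> Wp; have : nbhs p W by exact: open_nbhs_nbhs.
by apply: filterS => q Wq; rewrite /E /patch mem_set.
Qed.

Lemma extension_out p : ~ K p -> E p = 0.
Proof. by move=> Kp; rewrite /E /patch; case: ifP => // _; rewrite psi0 // mulr0. Qed.

Lemma extension_near0 p : ~ K p -> \near p, E p = 0.
Proof.
move=> Kp; have : nbhs p (~` K) by apply: open_nbhs_nbhs; split=> //; exact: closed_openC.
by apply: filterS => q; exact: extension_out.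
Qed.

Lemma extension_continuous : continuous E.
Proof.
move=> p; have [Wp|Wp] := pselect (W p).
  apply: cvg_trans (_ : (fun p => f p * psi p) x @[x --> p] --> E p).
    by apply: near_eq_cvg; apply: filterS (extension_in Wp) => q ->.
  rewrite /E /patch mem_set //; apply: cvgM; [exact: cf|exact: cpsi].
have Kp : ~ K p by move=> /KW.
rewrite /continuous_at [E p]extension_out //; apply: cvg_trans (_ : (fun=> 0) x @[x --> p] --> (0 : R)); last exact: cvg_cst.
by apply: near_eq_cvg; apply: filterS (extension_near0 Kp) => q ->.
Qed.

Lemma extension_integrable M : K `<=` box4 M -> mu4.-integrable setT (EFin \o E).
Proof.
move=> KM; apply: (continuous_support_integrable extension_continuous (M := M)).
by move=> p pM; apply: extension_out => /KM.
Qed.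

End Extension.

Lemma integrable_patch (W : set R4) (F : R4 -> R) : measurable W ->
  mu4.-integrable setT (EFin \o patch (fun=> 0) W F) -> mu4.-integrable W (EFin \o F).
Proof.
move=> mW iF; apply/(integrable_mkcond _ mW); move: iF; apply: eq_integrable => // p _.
by rewrite /= patchE /patch; case: ifP.
Qed.

Lemma test_function_integrable (W : set V4) (f phi : V4 -> R) : open W ->
  (forall p, W p -> {for p, continuous f}) -> test_function W phi ->
  mu4.-integrable W (EFin \o (fun p => f p * phi p)).
Proof.
move=> oW cf tphi; have cphi := test_function_continuous tphi.
have [_ cpt sub] := tphi; have [M _ KM] := compact_sub_box4 cpt.
apply: integrable_patch; first exact: open_measurable4.
have phi0 p : ~ tsupport phi p -> phi p = 0 by move=> /tsupport_out /nbhs_singleton.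
refine (@extension_integrable _ _ _ _ oW (@closed_closure _ _) sub cf cphi phi0 _ KM).
Qed.

(** The extension of f phi by 0 is differentiable on the whole space, and its partial derivative,
    the sum of both integrands, has integral 0 by [integral_partial0]. *)
Lemma partial_by_parts (W : set V4) (f f' phi : V4 -> R) i : open W ->
  (forall p, W p -> [/\ differentiable f p, 'D_(basis4 i) f p = f' p & {for p, continuous f'}]) ->
  test_function W phi ->
  \int[mu4]_(p in W) (f p * partial i phi p) = - \int[mu4]_(p in W) (f' p * phi p).
Proof.
move=> oW df tphi; have tp := test_function_partial i tphi.
have cphi := test_function_continuous tphi; have cp := test_function_continuous tp.
have cf p : W p -> {for p, continuous f} by move=> /df[/differentiable_continuous].
have cf' p : W p -> {for p, continuous f'} by move=> /df[].
have i1 := test_function_integrable oW cf tp.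
have i2 := test_function_integrable oW cf' tphi.
have mW : measurable (W : set R4) by exact: open_measurable4.
apply/eqP; rewrite -subr_eq0 opprK -RintegralD //; apply/eqP.
have [sm cpt sub] := tphi; have [M M0 KM] := compact_sub_box4 cpt.
pose K := tsupport phi.
have cK : closed K by exact: closed_closure.
have phi0 p : ~ K p -> phi p = 0 by move=> /tsupport_out /nbhs_singleton.
have pphi0 p : ~ K p -> partial i phi p = 0 by move=> /tsupport_out /partial_near0.
rewrite Rintegral_mkcond.
pose E1 : V4 -> R := patch (fun=> 0) W (fun p => f p * phi p).
pose E2 : V4 -> R := patch (fun=> 0) W (fun p => f p * partial i phi p).
pose E3 : V4 -> R := patch (fun=> 0) W (fun p => f' p * phi p).
have c2 : continuous E2 := extension_continuous oW cK sub cf cp pphi0.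
have c3 : continuous E3 := extension_continuous oW cK sub cf' cphi phi0.
transitivity (\int[mu4]_p (E2 p + E3 p)).
  by apply: eq_Rintegral => p _; rewrite /E2 /E3 patchE /patch; case: ifP => _; rewrite ?addr0.
have H p : differentiable E1 p /\ 'D_(basis4 i) E1 p = E2 p + E3 p.
  have [Kp|Kp] := pselect (K p); last first.
    have n0 : \near p, E1 p = cst 0 p by refine (@extension_near0 W _ f _ cK phi0 _ Kp).
    split; first by apply: near_eq_differentiable n0 _; exact: differentiable_cst.
    rewrite (near_eq_derive _ n0) derive_cst /E2 /E3 /patch.
    by case: ifP => _; rewrite ?addr0 // phi0 // pphi0 // !mulr0 addr0.
  have Wp := sub _ Kp; have n1 : \near p, E1 p = f p * phi p by apply: extension_in.
  have [dfp Dfp _] := df _ Wp; have dphi : differentiable phi p := sm [::] p.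
  split; first by apply: near_eq_differentiable n1 _; exact: differentiableM.
  rewrite (near_eq_derive _ n1) deriveM; try exact: diff_derivable.
  by rewrite /E2 /E3 /patch mem_set // Dfp /GRing.scale /= [f' p * _]mulrC.
apply: (@integral_partial0 _ E1 _ i M) => //.
- by move=> p; have [] := H p.
- by move=> p; have [] := H p.
- by move=> p; apply: cvgD; [exact: c2|exact: c3].
- move=> p pM; have Kp : ~ K p by move=> /KM.
  by rewrite /E1 /E2 /E3 !(@extension_out _ K) ?addr0.
Qed.

End TestFunctions.

Section WeakDerivatives.
Context {R : realType}.
Notation C := (R[i]^o)%type.
Notation C2 := (C * C)%type.
Notation V4 := ((R * R) * (R * R))%type.
Notation mu4 := (@lebesgue4 R).

(** The head of [s] acts first on [f], whereas [foldr partial phi s] applies it last to [phi]: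
    integration by parts peels off the outermost derivative of [phi]. *)
Fixpoint derivation_chain (W : set V4) (s : seq 'I_4) (f h : V4 -> R) : Prop :=
  match s with
  | [::] => f = h
  | i :: s' => exists f1, (forall p, W p -> [/\ differentiable f p, 'D_(basis4 i) f p = f1 p
      & {for p, continuous f1}]) /\ derivation_chain W s' f1 h
  end.

Lemma test_function_foldr (W : set V4) s (phi : V4 -> R) :
  test_function W phi -> test_function W (foldr partial phi s).
Proof. by move=> t; elim: s => //= i s IH; exact: test_function_partial. Qed.

Lemma partials_by_parts (W : set V4) s (f h phi : V4 -> R) : open W -> test_function W phi ->
  derivation_chain W s f h ->
  \int[mu4]_(p in W) (f p * foldr partial phi s p) = (-1) ^+ size s * \int[mu4]_(p in W) (h p * phi p).
Proof.
move=> oW tphi; elim: s f => /= [|i s IH] f; first by move=> ->; rewrite expr0 mul1r.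
move=> [f1 [df ch]].
rewrite (partial_by_parts oW df (test_function_foldr s tphi)) IH //.
by rewrite exprS mulN1r mulNr.
Qed.

(** The last clause says that derivatives vanish on every open set where [f] does; it confines the
    derivatives of the source to the support of its cutoff. *)
Lemma alg_chain (W : set V4) s f : open W -> alg f -> W `<=` bidisc4 -> exists h : V4 -> R,
  [/\ derivation_chain W s f h, alg h &
    forall V : set V4, open V -> (forall p, V p -> f p = 0) -> forall p, V p -> W p -> h p = 0].
Proof.
move=> oW + WO; elim: s f => [|i s IH] f af; first by exists f; split => // V _ H p /H.
have [D [aD hD]] := alg_diff af.
have [h [ch ah h0]] := IH _ (aD i).
exists h; split=> //.
  exists (D i); split=> // p /WO Op; have [df Df] := hD _ Op.
  by split => //; exact: alg_continuous.
move=> V oV f0 p Vp Wp; apply: (h0 (V `&` W)) => //; first exact: openI.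
move=> q [Vq Wq]; have [_ <-] := hD _ (WO _ Wq).
apply: partial_near0; have : nbhs q V by exact: open_nbhs_nbhs.
by apply: filterS => r; exact: f0.
Qed.

Definition derivation_order (alpha : 'I_4 -> nat) : seq 'I_4 :=
  flatten [seq nseq (alpha i) i | i <- enum 'I_4].

Lemma partialsE alpha (phi : V4 -> R) : partials alpha phi = foldr partial phi (derivation_order alpha).
Proof.
rewrite /partials /derivation_order; elim: (enum _) => //= i l IH.
by rewrite foldr_cat -IH; elim: (alpha i) => //= n ->.
Qed.

Lemma size_derivation_order alpha : size (derivation_order alpha) = (\sum_i alpha i)%N.
Proof.
rewrite /derivation_order size_flatten /shape -map_comp sumnE big_map big_enum.
by apply: eq_bigr => i _; rewrite /= size_nseq.
Qed.

Lemma weak_derivative_chain (W : set C2) alpha (f h : C2 -> C) : open (toC2 @^-1` W : set V4) ->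
  derivation_chain (toC2 @^-1` W) (derivation_order alpha)
    (fun p => complex.Re (f (toC2 p))) (fun p => complex.Re (h (toC2 p))) ->
  derivation_chain (toC2 @^-1` W) (derivation_order alpha)
    (fun p => complex.Im (f (toC2 p))) (fun p => complex.Im (h (toC2 p))) ->
  is_weak_derivative W alpha f h.
Proof.
move=> oW cr ci phi tphi; rewrite /integralC partialsE.
have Er (F : C2 -> C) (psi : V4 -> R) p : complex.Re (F (toC2 p) * (psi p)%:C) = complex.Re (F (toC2 p)) * psi p.
  by rewrite cReM /= mulr0 subr0.
have Ei (F : C2 -> C) (psi : V4 -> R) p : complex.Im (F (toC2 p) * (psi p)%:C) = complex.Im (F (toC2 p)) * psi p.
  by rewrite cImM /= mulr0 add0r.
have Es n (a b : R) : (-1) ^+ n * (a +i* b) = ((-1) ^+ n * a) +i* ((-1) ^+ n * b).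
  elim: n => [|n IH]; first by rewrite !expr0 !mul1r.
  by rewrite !exprS -!mulrA IH !mulN1r; apply: eq_complexP; rewrite ?cReN ?cImN.
rewrite Es -size_derivation_order; congr (_ +i* _).
- under eq_Rintegral => p _ do rewrite Er.
  under [in RHS]eq_Rintegral => p _ do rewrite Er.
  exact: partials_by_parts.
- under eq_Rintegral => p _ do rewrite Ei.
  under [in RHS]eq_Rintegral => p _ do rewrite Ei.
  exact: partials_by_parts.
Qed.

End WeakDerivatives.

(** * Test functions obtained by cutting off near |z1| = 1 *)

Section SmoothCut.
Context {R : realType}.
Notation V4 := ((R * R) * (R * R))%type.

Definition sqnorm1 (p : V4) : R := p.1.1 ^+ 2 + p.1.2 ^+ 2.

Lemma sqnorm1E p : sqnorm1 p = normc (toC p.1) ^+ 2.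
Proof. by rewrite normc_sqr. Qed.

Lemma bidisc4E p : bidisc4 p <-> sqnorm1 p < 1.
Proof. by rewrite /bidisc4 /= sqnorm1E expr_lt1 ?normc_ge0. Qed.

Lemma sqnorm1_continuous : continuous sqnorm1.
Proof.
move=> p; have [h1 h2 _ _] := coord4_continuous p.
by apply: cvgD; rewrite [X in _ --> X]expr2; apply: cvgM.
Qed.

Lemma alg_sqnorm1 : alg sqnorm1.
Proof.
have i0 : cholo (fun z : R[i] => z) by move=> z _; exists 1; exact: cderiv_id.
have a1 : alg (fun p : V4 => p.1.1) by exact: (alg_Re i0).
have a2 : alg (fun p : V4 => p.1.2) by exact: (alg_Im i0).
by apply: alg_add; apply: alg_mul.
Qed.

Lemma open_bidisc4 : open (@bidisc4 R).
Proof.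
rewrite (_ : bidisc4 = sqnorm1 @^-1` [set x | x < 1]).
  by apply: open_comp; [move=> p _; exact: sqnorm1_continuous|exact: open_lt].
by apply/seteqP; split=> p /bidisc4E.
Qed.

Lemma alg_foldr (V : set V4) s (f f0 : V4 -> R) : open V -> V `<=` bidisc4 -> alg f0 ->
  (forall p, V p -> f p = f0 p) ->
  exists f', alg f' /\ forall p, V p -> foldr partial f s p = f' p.
Proof.
move=> oV VO af ff; elim: s => [|i s [f' [af' hf']]]; first by exists f0.
have [D [aD hD]] := alg_diff af'; exists (D i); split=> // p Vp /=.
have [_ <-] := hD _ (VO _ Vp); apply: near_eq_derive.
by have : nbhs p V by [exact: open_nbhs_nbhs]; apply: filterS => q /hf'.
Qed.

Lemma zero_foldr (V : set V4) s (f : V4 -> R) : open V -> (forall p, V p -> f p = 0) ->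
  forall p, V p -> foldr partial f s p = 0.
Proof.
move=> oV f0; elim: s => [|i s IH] p Vp //=; first exact: f0.
apply: partial_near0.
by have : nbhs p V by [exact: open_nbhs_nbhs]; apply: filterS => q /IH.
Qed.

(** Members of [alg] are smooth only over the disc. The open sets |z1|^2 < 1 and |z1|^2 > 1 - e
    cover the space, and on the second one the function is 0. *)
Lemma smooth_cut (f : V4 -> R) (e : R) : alg f -> 0 < e -> (forall p, 1 - e < sqnorm1 p -> f p = 0) -> smooth f.
Proof.
move=> af e0 f0 s p; have [pO|pO] := ltP (sqnorm1 p) 1.
  have Op : bidisc4 p by apply/bidisc4E.
  have [f' [af' hf']] := alg_foldr s open_bidisc4 (@subset_refl _ _) af (fun _ _ => erefl).
  have [D [_ hD]] := alg_diff af'; have [df' _] := hD _ Op.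
  apply: near_eq_differentiable df'.
  by have : nbhs p (@bidisc4 R) by [apply: open_nbhs_nbhs; split=> //; exact: open_bidisc4]; apply: filterS => q /hf'.
pose V : set V4 := sqnorm1 @^-1` [set x | 1 - e < x].
have oV : open V by apply: open_comp; [move=> q _; exact: sqnorm1_continuous|exact: open_gt].
have Vp : V p by rewrite /V /=; apply: lt_le_trans pO; rewrite ltrBlDr ltrDl.
apply: (@near_eq_differentiable _ _ _ (cst 0)); last exact: differentiable_cst.
by have : nbhs p V by [exact: open_nbhs_nbhs]; apply: filterS => q; exact: zero_foldr.
Qed.

(** The non-strict conditions on |z1| and [psi] survive the closure, by continuity over the disc, so
    the support is compact and stays in [W]. *)
Lemma test_function_cut (W : set V4) (f psi : V4 -> R) (e a M : R) : alg f -> 0 < e ->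
  alg psi -> (forall p, bidisc4 p -> psi p <= a -> W p) ->
  (forall p, f p != 0 -> [/\ sqnorm1 p <= 1 - e, psi p <= a & box4 M p]) -> test_function W f.
Proof.
move=> af e0 apsi WP supp.
have sm : smooth f.
  apply: (smooth_cut af e0) => p h; apply/eqP/negPn/negP => /supp[]; rewrite leNgt h //.
have cb : closed (box4 M : set V4) by apply: compact_closed; [exact: norm_hausdorff|exact: compact_box4].
have cs : closed (sqnorm1 @^-1` [set x | x <= 1 - e]).
  by apply: preimage_closed; [move=> p _; exact: sqnorm1_continuous|exact: closed_le].
have sub : tsupport f `<=` box4 M `&` sqnorm1 @^-1` [set x | x <= 1 - e].
  rewrite [X in _ `<=` X](closure_id _).1; last exact: closedI.
  by apply: closure_subset => p /supp[].
split=> //.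
  have cM : compact (box4 M : set V4) by exact: compact_box4.
  by refine (subclosed_compact (@closed_closure _ _) cM _) => p /sub[].
move=> p pf; have [_ ps] := sub _ pf.
have Op : bidisc4 p by apply/bidisc4E; apply: le_lt_trans ps _; rewrite ltrBlDr ltrDl.
apply: WP => //; rewrite leNgt; apply/negP => ap.
have : nbhs p (psi @^-1` [set x | a < x]).
  by apply: (alg_continuous apsi Op); apply: open_nbhs_nbhs; split=> //; exact: open_gt.
by move=> /pf[q [/supp[_ h _]]]; rewrite /= ltNge h.
Qed.

End SmoothCut.

(** * The Bergman projection of the Hartogs domain *)

Section SquareIntegrable.
Context {R : realType}.
Notation C := (R[i]^o)%type.
Notation C2 := (C * C)%type.
Notation V4 := ((R * R) * (R * R))%type.
Notation R1 := (measurableTypeR R).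
Notation R4 := ((R1 * R1) * (R1 * R1))%type.
Notation mu4 := (@lebesgue4 R).

Lemma integralCE (D : set V4) (F : V4 -> C) : integralC D F = cintegral mu4 D F.
Proof. by []. Qed.

Variable W : set C2.
Notation W4 := (toC2 @^-1` W : set V4).
Hypothesis mW : measurable (W4 : set R4).

Definition normsq (f : C2 -> C) (p : V4) : R := complex.Re (f (toC2 p)) ^+ 2 + complex.Im (f (toC2 p)) ^+ 2.

Lemma normsqE f p : normsq f p = normc (f (toC2 p)) ^+ 2.
Proof. by rewrite normc_sqr. Qed.

Lemma normsq_ge0 f p : 0 <= normsq f p.
Proof. by rewrite addr_ge0 ?sqr_ge0. Qed.

Lemma L2_integrable f : L2 W f -> mu4.-integrable W4 (EFin \o normsq f).
Proof.
move=> [mr mi foo]; apply/integrableP; split.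
  by apply/measurable_EFinP; apply: measurable_funD; apply: measurable_funX.
apply: le_lt_trans foo; rewrite /sqnorm le_eqVlt; apply/orP; left; apply/eqP.
by apply: eq_integral => p _ /=; rewrite ger0_norm // normsq_ge0.
Qed.

Lemma integrable_L2 f : measurable_fun W4 (fun p => complex.Re (f (toC2 p))) ->
  measurable_fun W4 (fun p => complex.Im (f (toC2 p))) ->
  mu4.-integrable W4 (EFin \o normsq f) -> L2 W f.
Proof.
move=> mr mi /integrableP[_ foo]; split=> //.
apply: le_lt_trans foo; rewrite /sqnorm le_eqVlt; apply/orP; left; apply/eqP.
by apply: eq_integral => p _ /=; rewrite ger0_norm // normsq_ge0.
Qed.

Lemma L2_le f (G : V4 -> R) : measurable_fun W4 (fun p => complex.Re (f (toC2 p))) ->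
  measurable_fun W4 (fun p => complex.Im (f (toC2 p))) ->
  mu4.-integrable W4 (EFin \o G) -> (forall p, W4 p -> normsq f p <= G p) -> L2 W f.
Proof.
move=> mr mi iG fG; apply: integrable_L2 => //; apply: le_integrable iG => //.
  by apply/measurable_EFinP; apply: measurable_funD; apply: measurable_funX.
move=> p Wp; rewrite /= lee_fin ger0_norm ?normsq_ge0 //.
by apply: le_trans (fG _ Wp) (ler_norm _).
Qed.

Lemma L2_bounded (f : C2 -> C) (B : R) : measurable_fun W4 (fun p => complex.Re (f (toC2 p))) ->
  measurable_fun W4 (fun p => complex.Im (f (toC2 p))) -> (mu4 W4 < +oo)%E ->
  (forall p, W4 p -> normc (f (toC2 p)) <= B) -> L2 W f.
Proof.
move=> mr mi Woo fB; apply: (@L2_le _ (fun=> B ^+ 2)) => //.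
  apply/integrableP; split; first by apply/measurable_EFinP; exact: measurable_cst.
  rewrite (_ : (fun x => _) = cst (`|B ^+ 2|)%:E) //.
  by rewrite integral_cst // lte_mul_pinfty // ?lee_fin.
by move=> p Wp; rewrite normsqE ler_pXn2r ?nnegrE ?normc_ge0 ?fB // (le_trans (normc_ge0 _) (fB _ Wp)).
Qed.

Lemma L2D f h : L2 W f -> L2 W h -> L2 W (f \+ h).
Proof.
move=> fL hL; have iF := L2_integrable fL; have iH := L2_integrable hL.
have [mr mi _] := fL; have [nr ni _] := hL.
apply: (@L2_le _ (fun p => 2 * normsq f p + 2 * normsq h p)).
- apply: (eq_measurable_fun (fun p => complex.Re (f (toC2 p)) + complex.Re (h (toC2 p)))).
    by move=> p _; rewrite /= cReD.
  exact: measurable_funD.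
- apply: (eq_measurable_fun (fun p => complex.Im (f (toC2 p)) + complex.Im (h (toC2 p)))).
    by move=> p _; rewrite /= cImD.
  exact: measurable_funD.
- by apply: integrable_EFinD => //; apply: integrable_EFinZ.
- move=> p _; rewrite /normsq /= cReD cImD.
  move: (complex.Re (f _)) (complex.Im (f _)) (complex.Re (h _)) (complex.Im (h _)) => a b c d.
  rewrite -subr_ge0 (_ : _ - _ = (a - c) ^+ 2 + (b - d) ^+ 2); last by ring.
  by rewrite addr_ge0 ?sqr_ge0.
Qed.

Lemma L2N f : L2 W f -> L2 W (fun z => - f z).
Proof.
move=> fL; have iF := L2_integrable fL; have [mr mi _] := fL.
apply: (@L2_le _ (normsq f)) => //.
- apply: (eq_measurable_fun (fun p => - complex.Re (f (toC2 p)))).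
    by move=> p _; rewrite /= cReN.
  exact: measurable_funN.
- apply: (eq_measurable_fun (fun p => - complex.Im (f (toC2 p)))).
    by move=> p _; rewrite /= cImN.
  exact: measurable_funN.
- by move=> p _; rewrite /normsq cReN cImN !sqrrN.
Qed.

Lemma L2B f h : L2 W f -> L2 W h -> L2 W (f \- h).
Proof. by move=> fL /L2N; exact: L2D. Qed.

Lemma L2_inner_integrable f h : L2 W f -> L2 W h ->
  cintegrable mu4 W4 (fun p => f (toC2 p) * conjc (h (toC2 p))).
Proof.
move=> fL hL; have iF := L2_integrable fL; have iH := L2_integrable hL.
have [mr mi _] := fL; have [nr ni _] := hL.
have iFH : mu4.-integrable W4 (EFin \o (fun p => normsq f p + normsq h p)) by exact: integrable_EFinD.
split.
- apply: le_integrable iFH => //.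
    apply/measurable_EFinP; apply: (eq_measurable_fun (fun p => complex.Re (f (toC2 p)) * complex.Re (h (toC2 p)) + complex.Im (f (toC2 p)) * complex.Im (h (toC2 p)))).
      by move=> p _; rewrite cReM; case: (f _) (h _) => a b [c d] /=; ring.
    by apply: measurable_funD; exact: measurable_funM.
  move=> p _; rewrite /= lee_fin (ger0_norm (addr_ge0 (normsq_ge0 _ _) (normsq_ge0 _ _))).
  rewrite cReM /normsq; case: (f _) (h _) => a b [c d] /=; rewrite ler_norml; apply/andP; split.
    rewrite -subr_ge0 (_ : _ - _ = ((a + c) ^+ 2 + (b + d) ^+ 2 + (a ^+ 2 + b ^+ 2 + c ^+ 2 + d ^+ 2)) / 2); last by field.
    by rewrite divr_ge0 // !addr_ge0 ?sqr_ge0.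
  rewrite -subr_ge0 (_ : _ - _ = ((a - c) ^+ 2 + (b - d) ^+ 2 + (a ^+ 2 + b ^+ 2 + c ^+ 2 + d ^+ 2)) / 2); last by field.
  by rewrite divr_ge0 // !addr_ge0 ?sqr_ge0.
- apply: le_integrable iFH => //.
    apply/measurable_EFinP; apply: (eq_measurable_fun (fun p => complex.Im (f (toC2 p)) * complex.Re (h (toC2 p)) - complex.Re (f (toC2 p)) * complex.Im (h (toC2 p)))).
      by move=> p _; rewrite cImM; case: (f _) (h _) => a b [c d] /=; ring.
    by apply: measurable_funB; exact: measurable_funM.
  move=> p _; rewrite /= lee_fin (ger0_norm (addr_ge0 (normsq_ge0 _ _) (normsq_ge0 _ _))).
  rewrite cImM /normsq; case: (f _) (h _) => a b [c d] /=; rewrite ler_norml; apply/andP; split.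
    rewrite -subr_ge0 (_ : _ - _ = ((a - d) ^+ 2 + (b + c) ^+ 2 + (a ^+ 2 + b ^+ 2 + c ^+ 2 + d ^+ 2)) / 2); last by field.
    by rewrite divr_ge0 // !addr_ge0 ?sqr_ge0.
  rewrite -subr_ge0 (_ : _ - _ = ((a + d) ^+ 2 + (b - c) ^+ 2 + (a ^+ 2 + b ^+ 2 + c ^+ 2 + d ^+ 2)) / 2); last by field.
  by rewrite divr_ge0 // !addr_ge0 ?sqr_ge0.
Qed.

Definition norm2 (f : C2 -> C) : R := \int[mu4]_(p in W4) normsq f p.

(** Young's inequality |a b| <= (t a^2 + b^2/t)/2 in place of Cauchy-Schwarz: its 1/2 cancels the
    factor of [normc_cintegral_le], and the free parameter permits absorption in [hmass_le]. *)
Lemma normc_inner_le f h (t : R) : 0 < t -> L2 W f -> L2 W h ->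
  normc (inner W f h) <= t * norm2 f + t^-1 * norm2 h.
Proof.
move=> t0 fL hL; have iF := L2_integrable fL; have iH := L2_integrable hL.
have iP := L2_inner_integrable fL hL.
have i1 := integrable_EFinZ t mW iF; have i2 := integrable_EFinZ t^-1 mW iH.
have i3 := integrable_EFinD mW i1 i2.
rewrite /inner integralCE.
have i4 := integrable_EFinZ 2^-1 mW i3.
have B (p : R4) : W4 p -> normc (f (toC2 p) * conjc (h (toC2 p))) <= 2^-1 * (t * normsq f p + t^-1 * normsq h p).
  move=> _; rewrite normcM (_ : normc (conjc _) = normc (h (toC2 p))); last first.
    by case: (h _) => a b /=; rewrite sqrrN.
  rewrite !normsqE -subr_ge0.
  move: (normc (f _)) (normc (h _)) => a b.
  rewrite (_ : _ - _ = 2^-1 * t^-1 * (t * a - b) ^+ 2); last by field; rewrite gt_eqF.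
  by apply: mulr_ge0; [rewrite divr_ge0 // ltW|exact: sqr_ge0].
have := normc_cintegral_le mW iP i4 B; rewrite RintegralZl // mulrA divff // mul1r.
by rewrite RintegralD // !RintegralZl.
Qed.

End SquareIntegrable.

(** * The Hartogs domain and functions on it *)

Section Hartogs.
Context {R : realType}.
Notation C := (R[i]^o)%type.
Notation C2 := (C * C)%type.
Notation V4 := ((R * R) * (R * R))%type.
Notation R1 := (measurableTypeR R).
Notation R2 := (R1 * R1)%type.
Notation R4 := (R2 * R2)%type.
Notation mu4 := (@lebesgue4 R).
Implicit Types F G : R[i] -> R[i].

Lemma normc_lt_real (z : C) (x : R) : (`|z| < x%:C) = (normc z < x).
Proof. exact: (ltcR (normc z) x). Qed.

Lemma disc_normc (z : C) : disc z <-> normc z < 1.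
Proof. by rewrite /disc /= -normc_lt_real. Qed.

Lemma cholo_cst (c : R[i]) : cholo (fun=> c).
Proof. by move=> z _; exists 0; exact: cderiv_cst. Qed.

Lemma cholo_id : cholo (fun z : R[i] => z).
Proof. by move=> z _; exists 1; exact: cderiv_id. Qed.

Lemma choloM F G : cholo F -> cholo G -> cholo (fun z => F z * G z).
Proof.
move=> hF hG z z1; have [a da] := hF _ z1; have [b db] := hG _ z1.
by eexists; exact: cderivM da db.
Qed.

Lemma choloX F n : cholo F -> cholo (fun z => F z ^+ n).
Proof.
move=> hF; elim: n => [|n IH].
  by rewrite (_ : (fun z => _) = (fun=> 1)); [exact: cholo_cst|apply/funext => z; rewrite expr0].
rewrite (_ : (fun z => _) = (fun z => F z * F z ^+ n)); first exact: choloM.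
by apply/funext => z; rewrite exprS.
Qed.

Lemma choloV F : cholo F -> (forall z, normc z < 1 -> F z != 0) -> cholo (fun z => (F z)^-1).
Proof.
move=> hF F0 z z1; have [a da] := hF _ z1.
by eexists; apply: (cderiv_comp da); exact: cderivV (F0 _ z1).
Qed.

Variable g : C -> C.
Hypothesis g_holo : cholo g.
Hypothesis g_neq0 : forall z, normc z < 1 -> g z != 0.
Variable Mg : R.
Hypothesis g_le : forall z, normc z < 1 -> normc (g z) <= Mg.

Definition hinv (z : R[i]) : R[i] := (g z)^-1.
Definition ksq (z : R[i]) : R[i] := hinv z ^+ 2.

Lemma cholo_hinv : cholo hinv. Proof. exact: choloV. Qed.
Lemma cholo_ksq : cholo ksq. Proof. exact: choloX cholo_hinv. Qed.

Lemma hinv_neq0 z : normc z < 1 -> hinv z != 0.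
Proof. by move=> z1; rewrite invr_eq0 g_neq0. Qed.

Notation W := (hartogs g).
Notation W4 := (toC2 @^-1` W : set V4).

(** This is |z2 / g(z1)|^2, squared and spelled out in real and imaginary parts so that it belongs
    to [alg]. *)
Definition fiber_ratio (p : V4) : R :=
  (p.2.1 ^+ 2 + p.2.2 ^+ 2) * (complex.Re (hinv (toC p.1)) ^+ 2 + complex.Im (hinv (toC p.1)) ^+ 2).

Lemma fiber_ratioE p : fiber_ratio p = normc (toC p.2 * hinv (toC p.1)) ^+ 2.
Proof. by rewrite normcM exprMn !normc_sqr. Qed.

Lemma hartogsE p : W4 p <-> normc (toC p.1) < 1 /\ normc (toC p.2) < normc (g (toC p.1)).
Proof.
split=> [[/disc_normc h1 h2]|[h1 h2]].
  by split=> //; rewrite -(normc_lt_real (toC p.2)).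
by split; [exact/disc_normc|rewrite -(normc_lt_real (toC p.2)) in h2].
Qed.

Lemma alg_fiber_ratio : alg fiber_ratio.
Proof.
have hh := cholo_hinv.
have a2 : alg (fun p : V4 => p.2.1) by exact: alg_x2.
have b2 : alg (fun p : V4 => p.2.2) by exact: alg_y2.
have ar := alg_Re hh; have ai := alg_Im hh.
by apply: alg_mul; apply: alg_add; apply: alg_mul.
Qed.

Lemma hartogs_ratio p : normc (toC p.1) < 1 -> W4 p <-> fiber_ratio p < 1.
Proof.
move=> Op; rewrite hartogsE fiber_ratioE expr_lt1 ?normc_ge0 // normcM /hinv.
have g0 : 0 < normc (g (toC p.1)) by rewrite normc_gt0 g_neq0.
have -> : normc (g (toC p.1))^-1 = (normc (g (toC p.1)))^-1.
  by apply: (mulfI (lt0r_neq0 g0)); rewrite -normcM !mulfV ?g_neq0 ?gt_eqF // [LHS]normc_real normr1.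
rewrite ltr_pdivrMr // mul1r; split=> [[]//|h]; by split.
Qed.

Lemma open_hartogs : open W4.
Proof.
rewrite (_ : W4 = @bidisc4 R `&` fiber_ratio @^-1` [set x | x < 1]).
  apply: continuous_on_open_preimage; [exact: open_bidisc4| |exact: open_lt].
  by move=> p Op; exact: alg_continuous alg_fiber_ratio Op.
apply/seteqP; split=> p.
  by move=> Wp; have [h _] := (hartogsE p).1 Wp; split => //; apply/hartogs_ratio.
by move=> [Op h]; apply/hartogs_ratio.
Qed.

Lemma hartogs_sub_bidisc : W4 `<=` @bidisc4 R.
Proof. by move=> p /hartogsE[]. Qed.

Lemma measurable_hartogs : measurable (W4 : set R4).
Proof. by apply: open_measurable4; exact: open_hartogs. Qed.

Definition hbound : R := Num.max 1 Mg.

Lemma hartogs_sub_box : W4 `<=` box4 hbound.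
Proof.
move=> p /hartogsE[h1 h2]; have h3 := g_le h1.
have b z : normc z <= hbound -> box1 hbound (complex.Re z) /\ box1 hbound (complex.Im z).
  move=> h; rewrite /box1 /= !in_itv /= -!ler_norml; split.
    exact: le_trans (Re_normc _) h.
  exact: le_trans (Im_normc _) h.
have l1 : normc (toC p.1) <= hbound by rewrite le_max ltW.
have l2 : normc (toC p.2) <= hbound by rewrite le_max (le_trans (ltW h2) h3) orbT.
by have [a1 a2] := b _ l1; have [a3 a4] := b _ l2; split; split.
Qed.

Lemma hartogs_lty : (mu4 W4 < +oo)%E.
Proof.
apply: le_lt_trans (box4_lty hbound); apply: le_measure; rewrite ?inE.
- exact: measurable_hartogs.
- exact: measurable_box4.
- exact: hartogs_sub_box.
Qed.

Definition calg (F : V4 -> R[i]) := alg (fun p => complex.Re (F p)) /\ alg (fun p => complex.Im (F p)).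

Lemma alg_opp f : @alg R f -> alg (fun p => - f p).
Proof.
move=> af; rewrite (_ : (fun p => _) = (fun p : V4 => -1 * f p)).
  by apply: alg_mul => //; exact: alg_cst.
by apply/funext => p; rewrite mulN1r.
Qed.

Lemma calg_mul (F G : V4 -> R[i]) : calg F -> calg G -> calg (fun p => F p * G p).
Proof.
move=> [fr fi] [gr gi]; split.
  rewrite (_ : (fun p => _) = (fun p : V4 => complex.Re (F p) * complex.Re (G p) + - (complex.Im (F p) * complex.Im (G p)))).
    by apply: alg_add; [exact: alg_mul|apply: alg_opp; exact: alg_mul].
  by apply/funext => p; rewrite cReM.
rewrite (_ : (fun p => _) = (fun p : V4 => complex.Re (F p) * complex.Im (G p) + complex.Im (F p) * complex.Re (G p))).
  by apply: alg_add; exact: alg_mul.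
by apply/funext => p; rewrite cImM.
Qed.

Lemma calg_holo F : cholo F -> calg (fun p => F (toC p.1)).
Proof. by move=> hF; split; [exact: alg_Re|exact: alg_Im]. Qed.

Lemma calg_conj (F : V4 -> R[i]) : calg F -> calg (fun p => conjc (F p)).
Proof.
move=> [fr fi]; split.
  by rewrite (_ : (fun p => _) = (fun p : V4 => complex.Re (F p))) //; apply/funext => p; case: (F p).
rewrite (_ : (fun p => _) = (fun p : V4 => - complex.Im (F p))); first exact: alg_opp.
by apply/funext => p; case: (F p).
Qed.

Lemma calg_real (f : V4 -> R) : alg f -> calg (fun p => (f p)%:C).
Proof. by move=> af; split => //=; exact: alg_cst. Qed.

Lemma calg_z2 : calg (fun p => toC p.2).
Proof. by split; [exact: alg_x2|exact: alg_y2]. Qed.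

Lemma alg_measurable f : alg f -> measurable_fun (W4 : set R4) f.
Proof.
move=> af; apply: measurable_fun_continuous4; first exact: open_hartogs.
by move=> p /hartogs_sub_bidisc; exact: alg_continuous.
Qed.

Definition ofC2 (z : C2) : V4 :=
  ((complex.Re z.1, complex.Im z.1), (complex.Re z.2, complex.Im z.2)).

Lemma toC2K : cancel toC2 ofC2. Proof. by move=> [[a b] [c d]]. Qed.
Lemma ofC2K : cancel ofC2 toC2. Proof. by move=> [[a b] [c d]]. Qed.

Definition func2 (F : V4 -> R[i]) (z : C2) : C := F (ofC2 z).

Lemma func2E (F : V4 -> R[i]) p : func2 F (toC2 p) = F p.
Proof. by rewrite /func2 toC2K. Qed.

Lemma calg_L2 (F : V4 -> R[i]) (B : R) : calg F -> (forall p, W4 p -> normc (F p) <= B) -> L2 W (func2 F).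
Proof.
move=> [ar ai] FB; apply: (@L2_bounded _ _ measurable_hartogs _ B).
- by apply: (eq_measurable_fun (fun p => complex.Re (F p))); [move=> p _; rewrite func2E|exact: alg_measurable].
- by apply: (eq_measurable_fun (fun p => complex.Im (F p))); [move=> p _; rewrite func2E|exact: alg_measurable].
- exact: hartogs_lty.
- by move=> p Wp; rewrite func2E; exact: FB.
Qed.

End Hartogs.

Section DiscIntegrals.
Context {R : realType}.
Notation R1 := (measurableTypeR R).
Notation R2 := (R1 * R1)%type.
Notation mu := (@lebesgue_measure R).
Notation mu2 := (@lebesgue2 R).
Notation D := (@discR2 R).

Definition sqn (p : R2) : R := p.1 ^+ 2 + p.2 ^+ 2.

Lemma sqnE p : sqn p = normc (toC p) ^+ 2.
Proof. by rewrite normc_sqr. Qed.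

Lemma discR2E p : D p <-> sqn p < 1.
Proof. by rewrite /discR2 /= sqnE expr_lt1 ?normc_ge0. Qed.

Lemma sqn_continuous : continuous (sqn : (R * R)%type -> R).
Proof.
by move=> p; apply: cvgD; rewrite [X in _ --> X]expr2; apply: cvgM; (exact: cvg_fst || exact: cvg_snd).
Qed.

Lemma open_discR2 : open (D : set (R * R)%type).
Proof.
rewrite (_ : discR2 = sqn @^-1` [set x | x < 1]).
  by apply: open_comp; [move=> p _; exact: sqn_continuous|exact: open_lt].
by apply/seteqP; split=> p /discR2E.
Qed.

Lemma measurable_discR2 : measurable D.
Proof. by apply: open_measurable2; exact: open_discR2. Qed.

Lemma discR2_sub_box : D `<=` box2 1.
Proof.
move=> p pD; split; rewrite /box1 /= in_itv /= -ler_norml.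
  exact: le_trans (Re_normc (toC p)) (ltW pD).
exact: le_trans (Im_normc (toC p)) (ltW pD).
Qed.

Lemma discR2_lty : (mu2 D < +oo)%E.
Proof.
apply: le_lt_trans (box2_lty 1); apply: le_measure; rewrite ?inE.
- exact: measurable_discR2.
- exact: measurable_box2.
- exact: discR2_sub_box.
Qed.

Lemma disc_bounded_integrable (f : R2 -> R) (B : R) : (forall p, D p -> {for p, continuous (f : (R * R)%type -> R)}) ->
  (forall p, D p -> `|f p| <= B) -> mu2.-integrable D (EFin \o f).
Proof.
move=> cf fB; have mf : measurable_fun D f.
  by apply: measurable_fun_continuous2 => //; exact: open_discR2.
apply: (@le_integrable _ _ _ mu2 _ measurable_discR2 _ (fun=> B%:E)).
- exact/measurable_EFinP.
- by move=> p pD; rewrite /= lee_fin; apply: le_trans (fB _ pD) (ler_norm _).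
- apply/integrableP; split; first exact: measurable_cst.
  rewrite (_ : (fun x => _) = cst (`|B|)%:E) //.
  by rewrite integral_cst ?lte_mul_pinfty ?discR2_lty ?lee_fin //; exact: measurable_discR2.
Qed.

(** A crude bound that keeps only a rectangle inside the disc; it gives positivity in
    [bump_mass_gt0] and the rate in [window_integral_ge]. *)
Lemma Rintegral_disc_ge (f : R2 -> R) (a b c d v : R) : mu2.-integrable D (EFin \o f) ->
  (forall p, D p -> 0 <= f p) -> a <= b -> c <= d -> 0 <= v ->
  (forall x y, a <= x <= b -> c <= y <= d -> D (x, y) /\ v <= f (x, y)) ->
  v * ((b - a) * (d - c)) <= \int[mu2]_(p in D) f p.
Proof.
move=> fi f0 ab cd v0 fv.
pose I1 : set R1 := [set` `[a, b]]; pose I2 : set R1 := [set` `[c, d]].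
pose E : set R2 := I1 `*` I2.
have m1 : measurable I1 by exact: measurable_itv.
have m2 : measurable I2 by exact: measurable_itv.
have mE : measurable E by exact: measurableX.
have ED : E `<=` D.
  by move=> [x y] [+ +]; rewrite /I1 /I2 /= !in_itv /= => hx hy; have [] := fv _ _ hx hy.
have muI (u w : R) : u <= w -> (mu [set` `[u, w]] = (w - u)%:E)%E.
  move=> uw; have -> : mu [set` `[u, w]] = _ := lebesgue_measure_itv `[u, w].
  rewrite /= lte_fin; case: ltP => // wu.
  by have -> : u = w; [apply/eqP; rewrite eq_le uw wu|rewrite subrr].
have muE : (mu2 E = ((b - a) * (d - c))%:E)%E.
  rewrite /E /lebesgue2 product_measure1E // EFinM.
  by congr (_ * _)%E; exact: muI.
have mD := measurable_discR2.
have mf := measurable_int _ fi.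
rewrite /Rintegral -lee_fin fineK; last exact: integrable_fin_num.
rewrite EFinM -muE -integral_cst //.
apply: (@le_trans _ _ (\int[mu2]_(p in E) (f p)%:E)%E).
  apply: ge0_le_integral => //.
  - exact: measurable_funS mf.
  - by move=> [x y] [+ +]; rewrite /I1 /I2 /= !in_itv /= => hx hy; have [_] := fv _ _ hx hy; rewrite lee_fin.
exact: ge0_subset_integral.
Qed.

End DiscIntegrals.

(** * Flattening the domain to a product of discs *)

Section Twist.
Context {R : realType}.
Notation C := (R[i]^o)%type.
Notation C2 := (C * C)%type.
Notation V4 := ((R * R) * (R * R))%type.
Notation R1 := (measurableTypeR R).
Notation R2 := (R1 * R1)%type.
Notation R4 := (R2 * R2)%type.
Notation mu2 := (@lebesgue2 R).
Notation mu4 := (@lebesgue4 R).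
Notation D := (@discR2 R).

(** The value 1 outside the disc allows a multiplier that vanishes nowhere on the plane, as the
    fibre scaling requires. *)
Lemma measurable_disc_patch (F : R[i] -> R[i]) : cholo F ->
  let s p := if normc (toC p) < 1 then F (toC p) else 1 in
  measurable_fun (setT : set R2) (fun p => complex.Re (s p)) /\
  measurable_fun (setT : set R2) (fun p => complex.Im (s p)).
Proof.
move=> hF s.
have mb : measurable_fun (setT : set R2) (fun p => normc (toC p) < 1).
  apply: (measurable_fun_bool true); rewrite setTI.
  rewrite (_ : _ @^-1` _ = D); first exact: measurable_discR2.
  by apply/seteqP; split=> p /=.
have cF p : D p -> {for p, continuous ((fun p => complex.Re (F (toC p))) : (R * R)%type -> R)} /\
    {for p, continuous ((fun p => complex.Im (F (toC p))) : (R * R)%type -> R)}.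
  move=> pD; have c0 : {for p, continuous ((fun q => (q, (0, 0))) : (R * R)%type -> V4)}.
    exact: (cvg_pair (@cvg_id _ (nbhs p)) (cvg_cst ((0 : R), (0 : R)))).
  have O : bidisc4 ((p, (0, 0)) : V4) by [].
  split; first exact: (continuous_comp c0 (alg_continuous (alg_Re hF) O)).
  exact: (continuous_comp c0 (alg_continuous (alg_Im hF) O)).
have tD : (setT `&` (fun p : R2 => normc (toC p) < 1) @^-1` [set true]) = D.
  by apply/seteqP; split=> p /=; [case|].
split.
- rewrite (_ : (fun p => _) = (fun p : R2 => if normc (toC p) < 1 then complex.Re (F (toC p)) else 1)); last first.
    by apply/funext => p; rewrite /s; case: ifP.
  apply: measurable_fun_if => //.
  by rewrite tD; apply: measurable_fun_continuous2; [exact: open_discR2|move=> p /cF[]].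
- rewrite (_ : (fun p => _) = (fun p : R2 => if normc (toC p) < 1 then complex.Im (F (toC p)) else 0)); last first.
    by apply/funext => p; rewrite /s; case: ifP.
  apply: measurable_fun_if => //.
  by rewrite tD; apply: measurable_fun_continuous2; [exact: open_discR2|move=> p /cF[]].
Qed.

Variable g : C -> C.
Hypothesis g_holo : cholo g.
Hypothesis g_neq0 : forall z, normc z < 1 -> g z != 0.
Notation W := (hartogs g).
Notation W4 := (toC2 @^-1` W : set V4).
Notation h := (hinv g).

(* The change of variables z2 = g(z1) w, where h = 1/g. *)
Lemma twist (a : R2 -> R[i]) (b : R2 -> R) : cintegrable mu2 D a ->
  mu2.-integrable setT (EFin \o b) -> (forall q, 1 <= normc (toC q) -> b q = 0) ->
  let F (p : R4) := (normc (h (toC p.1)) ^+ 2)%:C * (a p.1 * (b (cmul (h (toC p.1)) p.2))%:C) in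
  cintegrable mu4 W4 F /\ cintegral mu4 W4 F = cintegral mu2 D a * (\int[mu2]_q b q)%:C.
Proof.
move=> ia ib b1 F.
have mD := @measurable_discR2 R.
have mW := measurable_hartogs g_holo g_neq0.
have hh := cholo_hinv g_holo g_neq0.
pose s (p : R2) := if normc (toC p) < 1 then h (toC p) else 1.
have [mr mi] := measurable_disc_patch hh.
have s0 p : s p != 0.
  by rewrite /s; case: ifP => [p1|_]; [exact: hinv_neq0|exact: oner_neq0].
have ia' := (cintegrable_mkcond mu2 a mD).1 ia.
have [iG EG] := cintegral_prodM ia' ib.
have [iH EH] := cintegral_fiber_scaling mr mi s0 iG.
have E (p : R4) : patch (fun=> 0) W4 F p =
    (normc (s p.1) ^+ 2)%:C * (patch (fun=> 0) D a (fiber_scaling s p).1 * (b (fiber_scaling s p).2)%:C).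
  rewrite /fiber_scaling /= /s [LHS]/patch [X in _ = _ * (X * _)]/patch.
  case: ifPn => [|/negP pW].
    rewrite inE => pW; have [p1 _] := (hartogsE g p).1 pW.
    by rewrite p1 mem_set.
  have [p1|_] := boolP (p.1 \in D); last by rewrite mul0r mulr0.
  have {}p1 : normc (toC p.1) < 1 by move: p1; rewrite inE.
  rewrite p1 b1 ?mulr0 //.
  rewrite toC_cmul normcM leNgt; apply/negP => hlt; apply: pW; rewrite inE.
  apply/(hartogs_ratio g_neq0 p1); rewrite fiber_ratioE expr_lt1 ?normc_ge0 //.
  by rewrite normcM mulrC.
split.
  apply/(cintegrable_mkcond mu4 F mW); move: iH.
  by apply: eq_cintegrable => // p _; rewrite E.
rewrite cintegral_mkcond (cintegral_mkcond mu2 D a) -EG -EH.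
by apply: eq_cintegral => p _; exact: E.
Qed.

Lemma Rtwist (a : R2 -> R) (b : R2 -> R) : mu2.-integrable D (EFin \o a) ->
  mu2.-integrable setT (EFin \o b) -> (forall q, 1 <= normc (toC q) -> b q = 0) ->
  let F (p : R4) := normc (h (toC p.1)) ^+ 2 * (a p.1 * b (cmul (h (toC p.1)) p.2)) in
  mu4.-integrable W4 (EFin \o F) /\
  \int[mu4]_(p in W4) F p = \int[mu2]_(p in D) a p * \int[mu2]_q b q.
Proof.
move=> ia ib b1 F.
have ia' : cintegrable mu2 D (fun p => (a p)%:C).
  split; first exact: ia.
  apply: (eq_integrable (measurable_discR2) (EFin \o cst 0)) => //.
  exact: (integrable0 _ _).
have [[ir _] E] := twist ia' ib b1.
have EF (p : R4) : complex.Re ((normc (h (toC p.1)) ^+ 2)%:C * ((a p.1)%:C * (b (cmul (h (toC p.1)) p.2))%:C)) = F p.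
  by rewrite -!rmorphM.
split; first by move: ir; apply: eq_integrable; [exact: measurable_hartogs|move=> p _; exact: (congr1 EFin (EF p))].
transitivity (complex.Re (cintegral mu4 W4 (fun p : R4 =>
    (normc (h (toC p.1)) ^+ 2)%:C * ((a p.1)%:C * (b (cmul (h (toC p.1)) p.2))%:C)))).
  by apply: eq_Rintegral => p _; rewrite [RHS]EF.
by rewrite [X in complex.Re X]E cReM [complex.Im (_%:C)]/= mulr0 subr0.
Qed.

End Twist.
Lemma Rintegral_ae0 d (T : measurableType d) (R : realType) (m : {measure set T -> \bar R}) (f : T -> R) :
  m.-integrable setT (EFin \o f) -> (\forall q \ae m, f q = 0) -> \int[m]_q f q = 0.
Proof.
move=> fi f0; rewrite /Rintegral.
have -> : (\int[m]_q (f q)%:E = \int[m]_q (cst 0 q))%E.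
  apply: (@ae_eq_integral _ _ _ m setT (cst 0%E) (EFin \o f)) => //.
  - exact: measurable_int fi.
  - by apply: filterS f0 => q /= -> _.
by rewrite integral0.
Qed.

(** * The source function and its Bergman projection *)

Section Projection.
Context {R : realType}.
Notation C := (R[i]^o)%type.
Notation C2 := (C * C)%type.
Notation V4 := ((R * R) * (R * R))%type.
Notation R1 := (measurableTypeR R).
Notation R2 := (R1 * R1)%type.
Notation R4 := (R2 * R2)%type.
Notation mu2 := (@lebesgue2 R).
Notation mu4 := (@lebesgue4 R).
Notation D := (@discR2 R).

Lemma cderiv_differentiable (F : C -> C) (z l : C) : cderiv_at F z l -> differentiable F z.
Proof.
move=> dF; apply/derivable1_diffP; rewrite /derivable; apply/cvg_ex; exists l.
apply/cvgrPdist_le => e e0.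
have eE : e = (complex.Re e)%:C.
  by move: e0; rewrite ltcE => /andP[/eqP /=]; case: (e) => ? ? /= -> .
have re0 : 0 < complex.Re e by move: e0; rewrite ltcE => /andP[_].
have [dl dl0 H] := dF _ re0.
apply/nbhs_normP; exists dl%:C; first by rewrite /= ltcR.
move=> w; rewrite /= sub0r normrN => wd w0.
have wd' : normc w < dl by rewrite -ltcR; exact: wd.
have := H (w + z); rewrite addrK => /(_ wd') B.
have nw : 0 < normc w by rewrite normc_gt0.
have hh : normc (l - w^-1 * (F (w * 1 + z) - F z)) <= complex.Re e.
  rewrite mulr1 -(ler_pM2r nw) -normcM; apply: le_trans B; rewrite le_eqVlt; apply/orP; left; apply/eqP.
  rewrite -[RHS]normcN; congr normc.
  have fld (a x y : R[i]) : x != 0 -> (a - x^-1 * y) * x = - (y - a * x).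
    by move=> x0; rewrite mulrBl mulrAC mulVf // mul1r opprB.
  exact: fld.
by rewrite eE; rewrite -lecR in hh; exact: hh.
Qed.

Lemma fst_differentiable (z : C2) : differentiable (fst : C2 -> C) z.
Proof. by apply: linear_differentiable => w; exact: cvg_fst. Qed.

Lemma snd_differentiable (z : C2) : differentiable (snd : C2 -> C) z.
Proof. by apply: linear_differentiable => w; exact: cvg_snd. Qed.

Lemma cintegral_conj d (T : measurableType d) (m : {measure set T -> \bar R}) (E : set T) (F : T -> R[i]) :
  measurable E -> cintegrable m E F -> cintegral m E (fun x => conjc (F x)) = conjc (cintegral m E F).
Proof.
move=> mE [ir ii]; rewrite /cintegral; apply: eq_complexP => /=.
  by apply: eq_Rintegral => x _; case: (F x).
rewrite -mulN1r -RintegralZl //; apply: eq_Rintegral => x _.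
by case: (F x) => a b /=; rewrite mulN1r.
Qed.

Lemma cintegrable_conj d (T : measurableType d) (m : {measure set T -> \bar R}) (E : set T) (F : T -> R[i]) :
  measurable E -> cintegrable m E F -> cintegrable m E (fun x => conjc (F x)).
Proof.
move=> mE [ir ii]; split.
  by move: ir; apply: eq_integrable => // x _; rewrite /=; case: (F x).
by move: (integrable_EFinN mE ii); apply: eq_integrable => // x _; rewrite /=; case: (F x).
Qed.

Definition disc_area : R := \int[mu2]_(p in D) (1 : R).
Definition bump_mass : R := \int[mu2]_(p in D) ebump 0 (2^-1 - sqn p).
(* Normalized so that [cutoff (|z|^2)] has mean 1 on the disc. *)
Definition cutoff (t : R) : R := disc_area / bump_mass * ebump 0 (2^-1 - t).

Lemma bump_continuous n (s : R) : {for s, continuous (ebump n)}.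
Proof. by apply: differentiable_continuous; apply/derivable1_diffP; have [] := is_derive_bump n s. Qed.

Lemma radial_bump_integrable (a b : R) : mu2.-integrable D (EFin \o (fun p => ebump 0 (a - b * sqn p))).
Proof.
apply: (@disc_bounded_integrable _ _ 1) => p _; last by rewrite ger0_norm ?bump_ge0 ?bump0_le1.
have c1 : {for p, continuous ((fun p => a - b * sqn p) : (R * R)%type -> R)}.
  apply: cvgB; first exact: cvg_cst.
  by apply: cvgM; [exact: cvg_cst|exact: sqn_continuous].
by refine (continuous_comp c1 (@bump_continuous _ _)).
Qed.

Lemma bump_mass_gt0 : 0 < bump_mass.
Proof.
have i1 : mu2.-integrable D (EFin \o (fun p => ebump 0 (2^-1 - sqn p))).
  by have := radial_bump_integrable 2^-1 1; apply: eq_integrable => [|p _]; [exact: measurable_discR2|rewrite /= mul1r].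
(* On the square [0, 1/4]^2 one has |z|^2 <= 1/8, so the argument of the bump is at least 3/8, hence
   at least 1/4. *)
have q0 : (0 : R) <= 4^-1 by rewrite invr_ge0.
have v0 : 0 < ebump 0 (4^-1 : R) by apply: bump_gt0; rewrite invr_gt0.
apply: lt_le_trans (Rintegral_disc_ge i1 (fun p _ => bump_ge0 _ _) q0 q0 (ltW v0) _).
  by rewrite subr0 !mulr_gt0 ?invr_gt0.
move=> x y /andP[x0 x1] /andP[y0 y1].
have s : sqn (x, y) <= 8^-1.
  by rewrite /sqn /=; nra.
split; first by apply/discR2E; move: s; clear; lra.
by apply: bump0_nondecreasing; move: s; clear; lra.
Qed.

Lemma disc_area_ge0 : 0 <= disc_area.
Proof. by apply: Rintegral_ge0 => p _; exact: ler01. Qed.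

Lemma cutoff_ge0 t : 0 <= cutoff t.
Proof. by rewrite mulr_ge0 ?bump_ge0 // divr_ge0 ?disc_area_ge0 // ltW ?bump_mass_gt0. Qed.

Lemma cutoff_le t : cutoff t <= disc_area / bump_mass.
Proof. by rewrite ler_piMr ?bump0_le1 // divr_ge0 ?disc_area_ge0 // ltW ?bump_mass_gt0. Qed.

Lemma cst_disc_integrable (c : R) : mu2.-integrable D (EFin \o (fun=> c)).
Proof. by apply: (@disc_bounded_integrable _ _ `|c|) => // p _; exact: cvg_cst. Qed.

Lemma cutoff_integrable : mu2.-integrable D (EFin \o (fun p => cutoff (sqn p))).
Proof.
have i1 := integrable_EFinZ (disc_area / bump_mass) (measurable_discR2 (R := R)) (radial_bump_integrable 2^-1 1).
by move: i1; apply: eq_integrable => [|p _]; [exact: measurable_discR2|rewrite /= mul1r].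
Qed.

Lemma cutoff_mean : \int[mu2]_(p in D) (cutoff (sqn p) - 1) = 0.
Proof.
have mD := measurable_discR2 (R := R).
rewrite RintegralB //; [|exact: cutoff_integrable|exact: cst_disc_integrable].
have i1 : mu2.-integrable D (EFin \o (fun p => ebump 0 (2^-1 - sqn p))).
  by have := radial_bump_integrable 2^-1 1; apply: eq_integrable => [|p _]; [exact: measurable_discR2|rewrite /= mul1r].
rewrite RintegralZl // -/bump_mass -/disc_area divfK ?subrr //.
by rewrite gt_eqF // bump_mass_gt0.
Qed.

Variable g : C -> C.
Hypothesis g_holo : cholo g.
Hypothesis g_neq0 : forall z, normc z < 1 -> g z != 0.
Variable Mg : R.
Hypothesis g_le : forall z, normc z < 1 -> normc (g z) <= Mg.
Notation W := (hartogs g).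
Notation W4 := (toC2 @^-1` W : set V4).
Notation h := (hinv g).
Notation k := (ksq g).

Definition target (p : V4) : R[i] := toC p.2 * k (toC p.1).
Definition source (p : V4) : R[i] := target p * (cutoff (sqnorm1 p))%:C.

Let mW := measurable_hartogs g_holo g_neq0.
Let mD := measurable_discR2 (R := R).

Lemma calg_target : calg target.
Proof. by apply: calg_mul; [exact: calg_z2|apply: calg_holo; exact: cholo_ksq]. Qed.

Lemma alg_cutoff : alg (fun p : V4 => cutoff (sqnorm1 p)).
Proof.
apply: alg_mul; first exact: alg_cst.
apply: alg_bump; apply: alg_add; first exact: alg_cst.
by apply: alg_opp; exact: alg_sqnorm1.
Qed.

Lemma calg_source : calg source.
Proof. by apply: calg_mul; [exact: calg_target|apply: calg_real; exact: alg_cutoff]. Qed.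

Lemma calg_measurable F : calg F -> measurable_fun (W4 : set R4) (fun p => complex.Re (func2 F (toC2 p))) /\
  measurable_fun (W4 : set R4) (fun p => complex.Im (func2 F (toC2 p))).
Proof.
move=> [ar ai]; split.
  by apply: (eq_measurable_fun (fun p => complex.Re (F p))); [move=> p _; rewrite func2E|exact: alg_measurable].
by apply: (eq_measurable_fun (fun p => complex.Im (F p))); [move=> p _; rewrite func2E|exact: alg_measurable].
Qed.

Lemma disc_indicator_integrable : mu2.-integrable setT (EFin \o (\1_D : R2 -> R)).
Proof.
apply: (@bounded_support_integrable _ _ _ mu2 D (\1_D : R2 -> R) 1 mD discR2_lty).
- exact: measurable_indic.
- by move=> x; rewrite indicE; case: (_ \in _); rewrite ?normr1 ?normr0.
- by move=> x xD; rewrite indicE memNset.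
Qed.

Lemma target_normsq (p : V4) : W4 p ->
  normsq (func2 target) p <= normc (h (toC p.1)) ^+ 2.
Proof.
move=> Wp; have [p1 _] := (hartogsE g p).1 Wp.
have := (hartogs_ratio g_neq0 p1).1 Wp; rewrite fiber_ratioE => r1.
rewrite normsqE func2E /target /ksq [h _ ^+ 2]expr2 mulrA normcM exprMn.
by rewrite ler_piMl ?sqr_ge0 // ltW.
Qed.

(** The bound |h|^2 for |target|^2 is exactly the weight that [Rtwist] absorbs, so the integral is a
    product of two disc areas. *)
Lemma L2_target : L2 W (func2 target).
Proof.
have [mr mi] := calg_measurable calg_target.
have b1 (q : R2) : 1 <= normc (toC q) -> \1_D q = 0 :> R.
  by move=> q1; rewrite indicE memNset // /discR2 /= => /(le_lt_trans q1); rewrite ltxx.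
have [iF _] := Rtwist g_holo g_neq0 (cst_disc_integrable 1) disc_indicator_integrable b1.
apply: (L2_le mW mr mi iF) => p Wp; apply: le_trans (target_normsq Wp) _.
have [p1 _] := (hartogsE g p).1 Wp.
have := (hartogs_ratio g_neq0 p1).1 Wp; rewrite fiber_ratioE expr_lt1 ?normc_ge0 // => r1.
rewrite indicE mem_set /= ?mul1r ?mulr1 //.
by rewrite /discR2 /mkset toC_cmul mulrC.
Qed.

Lemma L2_source : L2 W (func2 source).
Proof.
have [mr mi] := calg_measurable calg_source.
have iF := integrable_EFinZ ((disc_area / bump_mass) ^+ 2) mW (L2_integrable L2_target).
apply: (L2_le mW mr mi iF) => p _.
rewrite !normsqE !func2E normcM exprMn mulrC ler_wpM2r ?sqr_ge0 //.
rewrite normc_real ger0_norm ?cutoff_ge0 // ler_pXn2r ?nnegrE ?cutoff_ge0 ?cutoff_le //.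
by apply: le_trans (cutoff_le 0); exact: cutoff_ge0.
Qed.

Lemma L2a_target : L2a W (func2 target).
Proof.
split; first exact: L2_target.
move=> z [/disc_normc z1 _].
have dk : differentiable (k : C -> C) z.1.
  by have [l dl] := cholo_ksq g_holo g_neq0 z1; exact: cderiv_differentiable dl.
have -> : func2 target = (fun z : C2 => z.2 * k z.1).
  by apply/funext => w; rewrite /func2 /target; congr (_ * k _); rewrite /toC /=; [case: w.2|case: w.1].
apply: differentiableM; first exact: snd_differentiable.
exact: (differentiable_comp (fst_differentiable z) dk).
Qed.

Lemma L2aB u v : L2a W u -> L2a W v -> L2a W (u \- v).
Proof.
move=> [u2 du] [v2 dv]; split; first exact: L2B.
by move=> z Wz; apply: differentiableB; [exact: du|exact: dv].
Qed.

(** The curve z -> (z, g(z) q) stays in the domain. The factors conj(q) and g are the conjugates of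
    what remains of [target] once the Jacobian |g|^2 is included. *)
Lemma cholo_slice u (q : R[i]) : L2a W u -> normc q < 1 ->
  cholo (fun z => conjc q * (g z * u (z, g z * q))).
Proof.
move=> [_ du] q1 z z1.
have Wz : W (z, g z * q).
  split; first exact/disc_normc.
  have : normc (g z * q) < normc (g z) by rewrite normcM mulrC gtr_pMl // normc_gt0 g_neq0.
  by rewrite -(normc_lt_real (g z * q)).
have dg : differentiable g (z : C) by have [l dl] := g_holo z1; exact: cderiv_differentiable dl.
have dp : differentiable (fun z : C => (z, g z * q) : C2) (z : C).
  apply: differentiable_pair; first exact: cderiv_differentiable (cderiv_id z).
  by apply: differentiableM => //; exact: differentiable_cst.
have d1 : differentiable (fun z : C => conjc q * (g z * u (z, g z * q)) : C) (z : C).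
  apply: differentiableM; first exact: differentiable_cst.
  apply: differentiableM => //.
  exact: (differentiable_comp dp (du _ Wz)).
by eexists; exact: differentiable_cderiv d1.
Qed.

Lemma mem_hartogs_scaled (p q : R2) : W4 (p, cmul (if normc (toC p) < 1 then g (toC p) else 1) q) <->
  normc (toC p) < 1 /\ normc (toC q) < 1.
Proof.
rewrite hartogsE -[(p, _).1]/p -[(p, _).2]/(cmul _ q); split=> [[p1]|[p1 q1]].
  rewrite p1 toC_cmul normcM gtr_pMr ?normc_gt0 ?g_neq0 //.
by rewrite p1 toC_cmul normcM gtr_pMr ?normc_gt0 ?g_neq0.
Qed.

Lemma source_target_orthogonal u : L2a W u -> inner W (func2 source \- func2 target) u = 0.
Proof.
move=> uL; have [u2 du] := uL.
have sL : L2 W (func2 source \- func2 target) by apply: L2B => //; [exact: L2_source|exact: L2_target].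
have iF := L2_inner_integrable mW sL u2.
rewrite /inner integralCE.
set F := (fun p : V4 => _) in iF *.
pose s (p : R2) := if normc (toC p) < 1 then g (toC p) else 1.
have [mr mi] := measurable_disc_patch g_holo.
have s0 p : s p != 0 by rewrite /s; case: ifP => [p1|_]; [exact: g_neq0|exact: oner_neq0].
have iF0 := (cintegrable_mkcond mu4 F mW).1 iF.
have [iG EG] := cintegral_fiber_scaling mr mi s0 iF0.
rewrite cintegral_mkcond -EG.
set G := (fun p : R4 => _) in iG EG *.
have [_ <-] := cfubini2 iG.
have FE p : F p = (source p - target p) * conjc (u (toC2 p)).
  by rewrite -(func2E source p) -(func2E target p).
have GE p q : G (p, q) = (normc (s p) ^+ 2)%:C * patch (fun=> 0) W4 F (p, cmul (s p) q) by [].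
(* A slice with |q| >= 1 misses the domain. Otherwise it is the conjugate of [H] on the disc, and
   [disc_mean] with m = 0 leaves a multiple of the integral of [cutoff] - 1, which is 0. *)
have Z q : cintegrable mu2 setT (fun p => G (p, q)) -> cintegral mu2 setT (fun p => G (p, q)) = 0.
  move=> iq; have [q1|q1] := ltP (normc (toC q)) 1; last first.
    rewrite (_ : (fun p => _) = (fun=> 0)).
      by rewrite /cintegral /= !Rintegral_zero //; exact: eq_complexP.
    apply/funext => p; rewrite GE /patch.
    have [pW|_] := boolP ((p, cmul (s p) q) \in W4); last by rewrite mulr0.
    by move: pW; rewrite inE => /mem_hartogs_scaled[_]; rewrite ltNge q1.
  pose v z := conjc (toC q) * (g z * u (z, g z * toC q)).
  pose Q (r : R) := cutoff (r ^+ 2) - 1.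
  pose H (p : R2) := v (toC p) * conjc (toC p) ^+ 0 * (Q (normc (toC p)))%:C.
  have hv : cholo v by exact: cholo_slice.
  have E (p : R2) : G (p, q) = patch (fun=> 0) D (fun p => conjc (H p)) p.
    rewrite GE /patch; have [pD|pD] := boolP (p \in D); last first.
      have [pW|_] := boolP ((p, cmul (s p) q) \in W4); last by rewrite mulr0.
      move: pW; rewrite inE => /mem_hartogs_scaled[p1 _].
      by move/negP: pD; case; rewrite inE.
    have p1 : normc (toC p) < 1 by move: pD; rewrite inE.
    rewrite (mem_set (A := W4)); last by apply/mem_hartogs_scaled.
    rewrite /s p1 FE /H /v /Q /source /target -[(p, _).1]/p -[(p, _).2]/(cmul _ q) toC_cmul -sqnE.
    rewrite -[sqnorm1 _]/(sqn p).
    have toC2p : toC2 (p, cmul (g (toC p)) q) = (toC p, g (toC p) * toC q) :> C2.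
      by rewrite /toC2 /=; congr (_, _); exact: toC_cmul.
    rewrite toC2p.
    have cc (a b : R[i]) (r : R) : conjc (conjc a * b * 1 * r%:C) = a * conjc b * r%:C.
      by case: a b => a1 a2 [b1 b2]; apply: eq_complexP => /=; ring.
    rewrite expr0 cc.
    have gk : (normc (g (toC p)) ^+ 2)%:C * (g (toC p) * k (toC p)) = conjc (g (toC p)).
      have -> : g (toC p) * k (toC p) = (g (toC p))^-1.
        by rewrite /ksq /hinv expr2 mulrA mulfV ?g_neq0 // mul1r.
      apply: (mulIf (g_neq0 p1)); rewrite mulfVK ?g_neq0 //.
      by rewrite normc_sqr; case: (g _) => a b; apply: eq_complexP => /=; ring.
    have cm (a b : R[i]) : conjc (a * b) = conjc a * conjc b.
      by case: a b => a1 a2 [b1 b2]; apply: eq_complexP => /=; ring.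
    rewrite cm -gk.
    move: (u _) => U; move: (conjc U) => U'.
    rewrite (_ : (cutoff (sqn p) - 1)%:C = (cutoff (sqn p))%:C - 1); last by rewrite rmorphB.
    have fld (a b c d e f : R[i]) : a * ((b * d * c * e - b * d * c) * f) = d * (a * (b * c) * f) * (e - 1) by ring.
    exact: fld.
  have iH : cintegrable mu2 D H.
    have : cintegrable mu2 setT (patch (fun=> 0) D (fun p => conjc (H p))).
      by move: iq; apply: eq_cintegrable => // p _; rewrite E.
    move=> /(cintegrable_mkcond mu2 _ mD)/(cintegrable_conj mD).
    by apply: eq_cintegrable => // p _; rewrite conjcK.
  transitivity (cintegral mu2 setT (patch (fun=> 0) D (fun p => conjc (H p)))).
    by apply: eq_cintegral => p _; exact: E.
  rewrite -cintegral_mkcond cintegral_conj //.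
  rewrite (disc_mean hv mD iH).
  have iQ : cintegrable mu2 D (fun p => (normc (toC p) ^+ (2 * 0) * Q (normc (toC p)))%:C).
    split; last by apply: (eq_integrable mD (EFin \o cst 0)) => //; exact: integrable0.
    have := integrable_EFinD mD cutoff_integrable (cst_disc_integrable (-1)).
    by apply: eq_integrable => // p _; rewrite /= mul1r sqnE.
  rewrite cintegralZ // (_ : cintegral mu2 D _ = 0) ?mulr0 ?conjc0 //.
  rewrite /cintegral; apply: eq_complexP => /=; last by rewrite /Rintegral integral0.
  by rewrite -cutoff_mean; apply: eq_Rintegral => p _; rewrite mul1r /Q sqnE.
(* Integrability of the slices holds only for almost every q, so the inner integral vanishes almost
   everywhere, which is enough. *)
have [iGr iGi] := iG.
have aer := ae_integrable2 iGr; have aei := ae_integrable2 iGi.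
have ae0 : \forall q \ae mu2, cintegral mu2 setT (fun p => G (p, q)) = 0.
  by apply: filterS2 aer aei => q hr hi; apply: Z.
have [[jr ji] _] := cfubini2 iG.
apply: eq_complexP.
  by apply: Rintegral_ae0 => //; apply: filterS ae0 => q /(congr1 (@complex.Re R)).
by apply: Rintegral_ae0 => //; apply: filterS ae0 => q /(congr1 (@complex.Im R)).
Qed.

Lemma inner_self_ae v : L2 W v -> inner W v v = 0 -> \forall p \ae mu4, W4 p -> v (toC2 p) = 0.
Proof.
move=> vL v0; have iV := L2_integrable vL.
have N0 : \int[mu4]_(p in W4) normsq v p = 0.
  have := congr1 (@complex.Re R) v0; rewrite /inner integralCE /cintegral /= => h0.
  rewrite -[RHS]h0; apply: eq_Rintegral => p _.
  by rewrite /normsq cReM; case: (v _) => a b /=; ring.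
have E0 : (\int[mu4]_(p in W4) `|(normsq v p)%:E| = 0)%E.
  transitivity (\int[mu4]_(p in W4) (normsq v p)%:E)%E.
    by apply: eq_integral => p _; rewrite /= ger0_norm // normsq_ge0.
  by rewrite -[LHS]fineK ?(integrable_fin_num mW iV) //; congr (_%:E).
have /(ae_eq_integral_abs mu4 mW (measurable_int _ iV)) := E0.
apply: filterS => p /= h Wp; have := h Wp => -[].
rewrite /normsq => /eqP; rewrite paddr_eq0 ?sqr_ge0 // !sqrf_eq0 => /andP[/eqP a /eqP b].
by apply: eq_complexP; rewrite ?a ?b.
Qed.

Lemma innerB a b u : L2 W a -> L2 W b -> L2 W u -> inner W (a \- b) u = inner W a u - inner W b u.
Proof.
move=> aL bL uL; rewrite /inner !integralCE -cintegralB //.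
- by apply: eq_cintegral => p _; rewrite mulrBl.
- exact: L2_inner_integrable.
- exact: L2_inner_integrable.
Qed.

(** [target] witnesses that the set in [xget] is not empty. The difference of two of its members is
    in [L2a] and orthogonal to itself, hence 0 almost everywhere on the domain. *)
Lemma bergman_projection_source : let T := bergman_projection W (func2 source) in
  L2a W T /\ \forall p \ae mu4, W4 p -> T (toC2 p) = target p.
Proof.
set P := [set f | L2a W f /\ forall u, L2a W u -> inner W (func2 source \- f) u = 0].
have Pt : P (func2 target) by split; [exact: L2a_target|exact: source_target_orthogonal].
move=> T; have [TL To] : P T by rewrite /T /bergman_projection; apply: (@xgetPex _ _ P); exists (func2 target).
split=> //; have vL := L2aB TL L2a_target; have v2 := vL.1.
have T2 := TL.1; have t2 := L2_target; have s2 := L2_source.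
have e1 := To _ vL; have e2 := Pt.2 _ vL.
have v0 : inner W (T \- func2 target) (T \- func2 target) = 0.
  move: e1 e2; rewrite !innerB // => /subr0_eq e1 /subr0_eq e2.
  by rewrite -e1 -e2 subrr.
have ae := inner_self_ae v2 v0; move: ae; apply: (@filterS _ _ (ae_filter_ringOfSetsType mu4)) => p h /h /=.
by rewrite func2E => /subr0_eq.
Qed.

End Projection.

(** * Bounds on the Taylor coefficients *)

Section Regularity.
Context {R : realType}.
Notation C := (R[i]^o)%type.
Notation C2 := (C * C)%type.
Notation V4 := ((R * R) * (R * R))%type.
Notation R1 := (measurableTypeR R).
Notation R2 := (R1 * R1)%type.
Notation R4 := (R2 * R2)%type.
Notation mu2 := (@lebesgue2 R).
Notation mu4 := (@lebesgue4 R).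
Notation D := (@discR2 R).

(** A member of [alg] may blow up as |z1| tends to 1; vanishing near that circle leaves only a
    compact set to consider. *)
Lemma alg_bounded (f : V4 -> R) (e M : R) : alg f -> 0 < e -> (forall p, bidisc4 p -> 1 - e < sqnorm1 p -> f p = 0) ->
  exists2 B, 0 <= B & forall p, bidisc4 p -> box4 M p -> `|f p| <= B.
Proof.
move=> af e0 f0; pose K : set V4 := box4 M `&` sqnorm1 @^-1` [set x | x <= 1 - e].
have KO p : K p -> bidisc4 p.
  by move=> [_ h]; apply/bidisc4E; apply: le_lt_trans h _; rewrite ltrBlDr ltrDl.
have cK : compact K.
  apply: compact_closedI; first exact: compact_box4.
  by apply: preimage_closed; [move=> p _; exact: sqnorm1_continuous|exact: closed_le].
have /compact_bounded[B0 [_ hB]] : compact (f @` K).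
  apply: continuous_compact cK; apply: continuous_in_subspaceT => p.
  by rewrite inE => /KO; exact: alg_continuous.
exists (`|B0| + 1); first by rewrite addr_ge0.
move=> p Op Mp; have [h|h] := ltP (1 - e) (sqnorm1 p); first by rewrite f0 // normr0 addr_ge0.
apply: hB; last by exists p.
by apply: le_lt_trans (ler_norm _) _; rewrite ltrDl.
Qed.

Variable g : C -> C.
Hypothesis g_holo : cholo g.
Hypothesis g_neq0 : forall z, normc z < 1 -> g z != 0.
Variable Mg : R.
Hypothesis g_le : forall z, normc z < 1 -> normc (g z) <= Mg.
Notation W := (hartogs g).
Notation W4 := (toC2 @^-1` W : set V4).
Notation h := (hinv g).
Notation k := (ksq g).

Let mW := measurable_hartogs g_holo g_neq0.
Let mD := measurable_discR2 (R := R).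
Let oW : open W4 := open_hartogs g_holo g_neq0.
Let WO : W4 `<=` bidisc4 := @hartogs_sub_bidisc R g.
Let WM := hartogs_sub_box g_le.

(** The cutoff is 0 for |z1|^2 >= 1/2, so the classical derivatives are bounded on the bounded
    domain, hence square integrable, and they are weak derivatives by parts. *)
Lemma source_sobolev n : sobolev W n (func2 (source g)).
Proof.
have as_ := calg_source g_holo g_neq0.
split; first exact: L2_source.
move=> alpha _; have [ar ai] := as_.
have [hr [cr ahr zr]] := alg_chain (derivation_order alpha) oW ar WO.
have [hi [ci ahi zi]] := alg_chain (derivation_order alpha) oW ai WO.
exists (func2 (fun p => hr p +i* hi p)); split; last first.
  apply: weak_derivative_chain => //.
    move: cr; congr (derivation_chain _ _ _ _); apply/funext => p; by rewrite func2E.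
  move: ci; congr (derivation_chain _ _ _ _); apply/funext => p; by rewrite func2E.
pose V : set V4 := sqnorm1 @^-1` [set x | 2^-1 < x].
have oV : open V by apply: open_comp; [move=> q _; exact: sqnorm1_continuous|exact: open_gt].
have sV p : V p -> source g p = 0.
  move=> /= h1; rewrite /source /cutoff bump_neg ?mulr0 //.
  by rewrite subr_le0 ltW.
have e0 : (0 : R) < 2^-1 by rewrite invr_gt0.
have z0 p : W4 p -> V p -> hr p +i* hi p = 0.
  move=> Wp Vp; rewrite (zr V oV _ p Vp Wp) ?(zi V oV _ p Vp Wp) //.
    by move=> q /sV ->.
  by move=> q /sV ->.
have cb : exists2 B, 0 <= B & forall p, W4 p -> normc (hr p +i* hi p) <= B.
  pose K : set V4 := box4 (hbound Mg) `&` sqnorm1 @^-1` [set x | x <= 2^-1].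
  have bd f : alg f -> exists2 B : R, 0 <= B & forall p, K p -> `|f p| <= B.
    move=> af; have KO p : K p -> bidisc4 p.
      by move=> [_ h1]; apply/bidisc4E; apply: le_lt_trans h1 _; rewrite invf_lt1 // ltr1n.
    have cK : compact K.
      apply: compact_closedI; first exact: compact_box4.
      by apply: preimage_closed; [move=> p _; exact: sqnorm1_continuous|exact: closed_le].
    have /compact_bounded[B0 [_ hB]] : compact (f @` K).
      apply: continuous_compact cK; apply: continuous_in_subspaceT => p.
      by rewrite inE => /KO; exact: alg_continuous.
    exists (`|B0| + 1); first by rewrite addr_ge0.
    move=> p Kp; apply: hB; last by exists p.
    by apply: le_lt_trans (ler_norm _) _; rewrite ltrDl.
  have [B1 B10 h1] := bd _ ahr; have [B2 B20 h2] := bd _ ahi.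
  exists (B1 + B2); first exact: addr_ge0.
  move=> p Wp; have [Vp|Vp] := ltP 2^-1 (sqnorm1 p); first by rewrite z0 // normc0 addr_ge0.
  by apply: le_trans (normc_ReIm _) _; rewrite lerD ?h1 ?h2 //; split => //; exact: WM.
have [B _ hB] := cb.
by apply: (@calg_L2 _ _ g_holo g_neq0 _ g_le _ B) => //; split.
Qed.

(* The derivative of order [j] in x1 and of order one in x2. *)
Definition alphaj (j : nat) (i : 'I_4) : nat := nth 0%N [:: j; 0; 1; 0]%N i.

Lemma sum_alphaj j : (\sum_i alphaj j i = j.+1)%N.
Proof. by rewrite !big_ord_recl big_ord0 /alphaj /= !addn0 add0n addn1. Qed.

Let i2 : 'I_4 := Ordinal (isT : (2 < 4)%N).

Lemma derivation_order_alphaj j : derivation_order (alphaj j) = rcons (nseq j ord0) i2.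
Proof.
rewrite /derivation_order !enum_ordSl enum_ord0 /= /alphaj /= cats1.
by congr (rcons _ _); exact: val_inj.
Qed.

Definition z2_holo (F : R[i] -> R[i]) (p : V4) : R[i] := toC p.2 * F (toC p.1).

Lemma z2_holo_diff F p : cholo F -> bidisc4 p ->
  exists Dr Di : 'I_4 -> R, [/\ diff4 (fun p => complex.Re (z2_holo F p)) Dr p,
   diff4 (fun p => complex.Im (z2_holo F p)) Di p &
   [/\ Dr ord0 = complex.Re (z2_holo (cD F) p), Di ord0 = complex.Im (z2_holo (cD F) p),
     Dr i2 = complex.Re (F (toC p.1)) & Di i2 = complex.Im (F (toC p.1))]].
Proof.
move=> hF Op; have [dr di] := diff4_holo (cDP (hF _ Op)).
have dx : diff4 (fun p : V4 => p.2.1) (fun i => nth 0 [:: 0; 0; 1; 0] i) p.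
  have := diff4_linear_form 0 0 1 0 p; congr (diff4 _ _ _).
  by apply/funext => q; rewrite /linear_form4 !mul0r !add0r addr0 mul1r.
have dy : diff4 (fun p : V4 => - p.2.2) (fun i => nth 0 [:: 0; 0; 0; -1] i) p.
  have := diff4_linear_form 0 0 0 (-1) p; congr (diff4 _ _ _).
  by apply/funext => q; rewrite /linear_form4 !mul0r !add0r mulN1r.
have dy' : diff4 (fun p : V4 => p.2.2) (fun i => nth 0 [:: 0; 0; 0; 1] i) p.
  have := diff4_linear_form 0 0 0 1 p; congr (diff4 _ _ _).
  by apply/funext => q; rewrite /linear_form4 !mul0r !add0r mul1r.
have d1 := diff4D (diff4M dx dr) (diff4M dy di).
have d2 := diff4D (diff4M dx di) (diff4M dy' dr).
eexists; eexists; split.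
- have E : (fun q => complex.Re (z2_holo F q)) = (fun q : V4 => q.2.1 * complex.Re (F (toC q.1)) + - q.2.2 * complex.Im (F (toC q.1))).
    by apply/funext => q; rewrite /z2_holo cReM /= mulNr.
  by rewrite E; exact: d1.
- have E : (fun q => complex.Im (z2_holo F q)) = (fun q : V4 => q.2.1 * complex.Im (F (toC q.1)) + q.2.2 * complex.Re (F (toC q.1))).
    by apply/funext => q; rewrite /z2_holo cImM.
  by rewrite E; exact: d2.
- by rewrite /z2_holo cReM cImM /=; split; ring.
Qed.

Lemma calg_z2_holo F : cholo F -> calg (z2_holo F).
Proof. by move=> hF; apply: calg_mul; [exact: calg_z2|exact: calg_holo]. Qed.

(** Each x1-derivative turns z2 F into z2 F', and the final x2-derivative removes z2, leaving a
    function of z1 alone. *)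
Lemma z2_holo_chain F j : cholo F ->
  derivation_chain W4 (rcons (nseq j ord0) i2) (fun p => complex.Re (z2_holo F p))
     (fun p => complex.Re (iter j cD F (toC p.1))) /\
  derivation_chain W4 (rcons (nseq j ord0) i2) (fun p => complex.Im (z2_holo F p))
     (fun p => complex.Im (iter j cD F (toC p.1))).
Proof.
elim: j F => [|j IH] F hF.
  have [ar ai] := calg_holo hF; split.
    exists (fun p => complex.Re (F (toC p.1))); split => // p /WO Op.
    have [Dr [Di [[d1 e1] _ [_ _ e2 _]]]] := z2_holo_diff hF Op.
    by split=> //; [rewrite e1|exact: alg_continuous].
  exists (fun p => complex.Im (F (toC p.1))); split => // p /WO Op.
  have [Dr [Di [_ [d1 e1] [_ _ _ e2]]]] := z2_holo_diff hF Op.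
  by split=> //; [rewrite e1|exact: alg_continuous].
have hD := cholo_cD hF; have [cr ci] := IH _ hD; have [ar ai] := calg_z2_holo hD.
rewrite iterSr; split.
  exists (fun p => complex.Re (z2_holo (cD F) p)); split => // p /WO Op.
  have [Dr [Di [[d1 e1] _ [e2 _ _ _]]]] := z2_holo_diff hF Op.
  by split=> //; [rewrite e1|exact: alg_continuous].
exists (fun p => complex.Im (z2_holo (cD F) p)); split => // p /WO Op.
have [Dr [Di [_ [d1 e1] [_ e2 _ _]]]] := z2_holo_diff hF Op.
by split=> //; [rewrite e1|exact: alg_continuous].
Qed.

Hypothesis bergman_bounded : forall n : nat, sobolev_bounded W n (bergman_projection W).

Notation kj j := (iter j cD k).

Lemma cholo_kj j : cholo (kj j).
Proof. by elim: j => [|j IH] /=; [exact: cholo_ksq|exact: cholo_cD]. Qed.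

(** The projection equals [target] almost everywhere, and [target] has classical derivatives, so any
    weak derivative [H] acts on test functions as the j-th derivative of k does. The bound 5 comes
    from the order j + 1 <= 6. *)
Lemma weak_target j : (j <= 5)%N -> exists H : C2 -> C, L2 W H /\
  forall phi, test_function W4 phi ->
    cintegral mu4 W4 (fun p => H (toC2 p) * (phi p)%:C) =
    cintegral mu4 W4 (fun p => kj j (toC p.1) * (phi p)%:C).
Proof.
move=> j5; have [M hM] := bergman_bounded 6.
have [[T2 Tw] _] := hM _ (source_sobolev 6).
have [|H [H2 Hw]] := Tw (alphaj j); first by rewrite sum_alphaj.
exists H; split=> // phi tphi.
have [_ Tae] := bergman_projection_source g_holo g_neq0.
have hk := cholo_ksq g_holo g_neq0.
have [c1 c2] := z2_holo_chain j hk.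
have ch1 : is_weak_derivative W (alphaj j) (func2 (target g)) (func2 (fun p => kj j (toC p.1))).
  apply: weak_derivative_chain => //; rewrite derivation_order_alphaj.
    move: c1; congr (derivation_chain _ _ _ _); apply/funext => p; by rewrite func2E.
  move: c2; congr (derivation_chain _ _ _ _); apply/funext => p; by rewrite func2E.
have E1 := Hw _ tphi; have E2 := ch1 _ tphi; move: E1 E2; rewrite !integralCE.
have -> : cintegral mu4 W4 (fun p => bergman_projection W (func2 (source g)) (toC2 p) * (partials (alphaj j) phi p)%:C)
   = cintegral mu4 W4 (fun p => func2 (target g) (toC2 p) * (partials (alphaj j) phi p)%:C).
  have tp : test_function W4 (partials (alphaj j) phi) by rewrite partialsE; exact: test_function_foldr.
  have mp : measurable_fun (W4 : set R4) (partials (alphaj j) phi).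
    by apply: measurable_fun_continuous4 => // p _; exact: (test_function_continuous tp).
  have [tr ti] := calg_measurable g_holo g_neq0 (calg_target g_holo g_neq0).
  have [br bi _] := T2.
  have Er (z : R[i]) (r : R) : complex.Re (z * r%:C) = complex.Re z * r by rewrite cReM /= mulr0 subr0.
  have Ei (z : R[i]) (r : R) : complex.Im (z * r%:C) = complex.Im z * r by rewrite cImM /= mulr0 add0r.
  rewrite /cintegral; congr (_ +i* _); rewrite /Rintegral; congr fine; apply: ae_eq_integral => //.
  - apply/measurable_EFinP; apply: (eq_measurable_fun (fun p => complex.Re (bergman_projection W (func2 (source g)) (toC2 p)) * partials (alphaj j) phi p)).
      by move=> p _; rewrite Er.
    exact: measurable_funM.
  - apply/measurable_EFinP; apply: (eq_measurable_fun (fun p => complex.Re (func2 (target g) (toC2 p)) * partials (alphaj j) phi p)).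
      by move=> p _; rewrite Er.
    exact: measurable_funM.
  - by move: Tae; apply: (@filterS _ _ (ae_filter_ringOfSetsType mu4)) => p hp Wp; rewrite hp // func2E.
  - apply/measurable_EFinP; apply: (eq_measurable_fun (fun p => complex.Im (bergman_projection W (func2 (source g)) (toC2 p)) * partials (alphaj j) phi p)).
      by move=> p _; rewrite Ei.
    exact: measurable_funM.
  - apply/measurable_EFinP; apply: (eq_measurable_fun (fun p => complex.Im (func2 (target g) (toC2 p)) * partials (alphaj j) phi p)).
      by move=> p _; rewrite Ei.
    exact: measurable_funM.
  - by move: Tae; apply: (@filterS _ _ (ae_filter_ringOfSetsType mu4)) => p hp Wp; rewrite hp // func2E.
have s0 : (-1) ^+ (\sum_i alphaj j i)%N != 0 :> C by rewrite expf_neq0 // oppr_eq0 oner_neq0.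
move=> E1 E2; have E3 := etrans (esym E1) E2.
rewrite (mulfI s0 E3).
by apply: eq_cintegral => p _; rewrite func2E.
Qed.

End Regularity.
(** Since N <= A, half of the left side swallows the last term. *)
Lemma absorb_half (R : realType) (N A B : R) : N <= A -> A <= 2 * B + 2^-1 * N -> A <= 4 * B.
Proof. lra. Qed.

(** * Testing the weak derivatives against cut-off functions *)

Section Estimates.
Context {R : realType}.
Notation C := (R[i]^o)%type.
Notation C2 := (C * C)%type.
Notation V4 := ((R * R) * (R * R))%type.
Notation R1 := (measurableTypeR R).
Notation R2 := (R1 * R1)%type.
Notation R4 := (R2 * R2)%type.
Notation mu2 := (@lebesgue2 R).
Notation mu4 := (@lebesgue4 R).
Notation D := (@discR2 R).

(** For e > 0, dividing by e makes the value at least [ebump 0 1], uniformly in e, as soon as t <= 1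
    - 2 e, while it is 0 from 1 - e on. *)
Definition window (e t : R) : R := ebump 0 ((1 - e - t) / e).

Lemma window_ge0 e t : 0 <= window e t. Proof. exact: bump_ge0. Qed.
Lemma window_le1 e t : window e t <= 1. Proof. exact: bump0_le1. Qed.

Lemma window_out e t : 0 < e -> 1 - e <= t -> window e t = 0.
Proof. by move=> e0 h; rewrite /window bump_neg // pmulr_lle0 ?invr_gt0 // subr_le0. Qed.

Lemma alg_window e : alg (fun p : V4 => window e (sqnorm1 p)).
Proof.
apply: alg_bump; rewrite (_ : (fun p => _) = (fun p : V4 => (1 - e) / e + - e^-1 * sqnorm1 p)).
  apply: alg_add; first exact: alg_cst.
  by apply: alg_mul; [exact: alg_cst|exact: alg_sqnorm1].
by apply/funext => p; rewrite mulrBl mulNr [e^-1 * _]mulrC.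
Qed.

(** Functions of z1 alone are read on the slice z2 = 0, so that the class [alg] can be reused. *)
Lemma disc_alg_integrable (f : V4 -> R) (e : R) : alg f -> 0 < e ->
  (forall p, bidisc4 p -> 1 - e < sqnorm1 p -> f p = 0) ->
  mu2.-integrable D (EFin \o (fun p => f (p, (0, 0)))).
Proof.
move=> af e0 f0; have [B B0 hB] := alg_bounded 1 af e0 f0.
apply: (@disc_bounded_integrable _ _ B) => p pD.
  have c0 : {for p, continuous ((fun q => (q, (0, 0))) : (R * R)%type -> V4)}.
    exact: (cvg_pair (@cvg_id _ (nbhs p)) (cvg_cst ((0 : R), (0 : R)))).
  have O : bidisc4 ((p, (0, 0)) : V4) by [].
  by refine (continuous_comp c0 (alg_continuous af O)).
apply: hB => //; split; first exact: discR2_sub_box.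
by split; rewrite /box1 /= in_itv /= oppr_le0 ler01.
Qed.

Lemma fiber_bump_integrable : mu2.-integrable setT (EFin \o (fun q => ebump 0 (2^-1 - sqn q))) /\
  \int[mu2]_q ebump 0 (2^-1 - sqn q) = bump_mass (R := R).
Proof.
have i1 : mu2.-integrable D (EFin \o (fun p => ebump 0 (2^-1 - sqn p))).
  by have := radial_bump_integrable (2^-1 : R) 1; apply: eq_integrable => [|p _]; [exact: measurable_discR2|rewrite /= mul1r].
have E (q : R2) : ebump 0 (2^-1 - sqn q) = patch (fun=> 0) D (fun p => ebump 0 (2^-1 - sqn p)) q.
  rewrite /patch; have [//|qD] := boolP (q \in D); rewrite bump_neg // subr_le0.
  have : 1 <= sqn q by rewrite leNgt; apply/negP => /discR2E h; move/negP: qD; apply; rewrite inE.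
  by apply: le_trans; rewrite invf_le1 // ler1n.
split.
  move/(integrable_mkcond _ (measurable_discR2 (R := R))): i1; apply: eq_integrable => // q _.
  by rewrite /= [in RHS]E patchE /patch; case: ifP.
rewrite /bump_mass [RHS]Rintegral_mkcond; apply: eq_Rintegral => q _.
by rewrite [LHS]E patchE /patch; case: ifP.
Qed.

Lemma window_integrable e m : mu2.-integrable D (EFin \o (fun p => normc (toC p) ^+ (2 * m) * window e (sqn p))).
Proof.
apply: (@disc_bounded_integrable _ _ 1) => p pD; last first.
  rewrite ger0_norm ?mulr_ge0 ?exprn_ge0 ?normc_ge0 ?window_ge0 //.
  by rewrite mulr_ile1 ?exprn_ge0 ?normc_ge0 ?window_ge0 ?window_le1 ?exprn_ile1 ?normc_ge0 // ltW.
rewrite (_ : (fun p => _) = (fun p : R2 => (sqn p) ^+ m * window e (sqn p))); last first.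
  by apply/funext => q; rewrite sqnE -exprM.
have cX : {for sqn p, continuous (fun x : R => x ^+ m * window e x)}.
  apply: cvgM; first exact: exprn_continuous.
  have cl : {for sqn p, continuous (fun x : R => (1 - e - x) / e)}.
    by apply: cvgM; [apply: cvgB; [exact: cvg_cst|exact: cvg_id]|exact: cvg_cst].
  exact: (continuous_comp cl (@bump_continuous R 0 _)).
by refine (continuous_comp (@sqn_continuous R p) cX).
Qed.

Variable g : C -> C.
Hypothesis g_holo : cholo g.
Hypothesis g_neq0 : forall z, normc z < 1 -> g z != 0.
Variable Mg : R.
Hypothesis g_le : forall z, normc z < 1 -> normc (g z) <= Mg.
Notation W := (hartogs g).
Notation W4 := (toC2 @^-1` W : set V4).
Notation h := (hinv g).
Notation k := (ksq g).
Notation kj j := (iter j cD k).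

Let mW := measurable_hartogs g_holo g_neq0.
Let mD := measurable_discR2 (R := R).
Let oW : open W4 := open_hartogs g_holo g_neq0.
Let WO : W4 `<=` bidisc4 := @hartogs_sub_bidisc R g.
Let WM := hartogs_sub_box g_le.

Lemma test_parts_L2 (f : V4 -> R) : alg f -> test_function W4 f -> L2 W (func2 (fun p => (f p)%:C)).
Proof.
move=> af tf; have [_ cpt sub] := tf; have [M _ KM] := compact_sub_box4 cpt.
have [|B B0 hB] := continuous_bounded_support (test_function_continuous tf) (M := M).
  move=> p pM; have np : ~ tsupport f p by move=> /KM.
  exact: nbhs_singleton (tsupport_out np).
apply: (@calg_L2 _ _ g_holo g_neq0 _ g_le _ B); first exact: calg_real.
by move=> p _; rewrite normc_real.
Qed.

(** The weak identities concern real test functions; a complex one is split into its real and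
    imaginary parts. *)
Lemma inner_test (H : C2 -> C) (K Psi : V4 -> R[i]) : L2 W H -> calg K -> calg Psi -> L2 W (func2 Psi) ->
  test_function W4 (fun p => complex.Re (Psi p)) -> test_function W4 (fun p => complex.Im (Psi p)) ->
  (forall phi, test_function W4 phi ->
    cintegral mu4 W4 (fun p => H (toC2 p) * (phi p)%:C) = cintegral mu4 W4 (fun p => K p * (phi p)%:C)) ->
  inner W H (func2 Psi) = cintegral mu4 W4 (fun p => K p * conjc (Psi p)).
Proof.
move=> H2 [Kr Ki] [ar ai] P2 tr ti HK.
have cE (z w : R[i]) : z * conjc w = z * (complex.Re w)%:C + (- 'i%C) * (z * (complex.Im w)%:C).
  by case: z w => a b [c d]; apply: eq_complexP => /=; ring.
have iH (f : V4 -> R) : alg f -> test_function W4 f -> cintegrable mu4 W4 (fun p => H (toC2 p) * (f p)%:C).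
  move=> af tf; have := L2_inner_integrable mW H2 (test_parts_L2 af tf).
  apply: eq_cintegrable => // p _; rewrite func2E.
  by congr (_ * _); apply: eq_complexP => //=; rewrite oppr0.
have iK (f : V4 -> R) : alg f -> test_function W4 f -> cintegrable mu4 W4 (fun p => K p * (f p)%:C).
  move=> af tf; split.
    have := test_function_integrable oW (fun p Wp => alg_continuous Kr (WO Wp)) tf.
    by apply: eq_integrable => // p _; rewrite /= [complex.Re (_ * _)]cReM /= mulr0 subr0.
  have := test_function_integrable oW (fun p Wp => alg_continuous Ki (WO Wp)) tf.
  by apply: eq_integrable => // p _; rewrite /= [complex.Im (_ * _)]cImM /= mulr0 add0r.
have i1 := iH _ ar tr; have i2 := iH _ ai ti; have i3 := iK _ ar tr; have i4 := iK _ ai ti.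
rewrite /inner integralCE.
transitivity (cintegral mu4 W4 (fun p => H (toC2 p) * (complex.Re (Psi p))%:C + (- 'i%C) * (H (toC2 p) * (complex.Im (Psi p))%:C))).
  by apply: eq_cintegral => p _; rewrite func2E cE.
transitivity (cintegral mu4 W4 (fun p => K p * (complex.Re (Psi p))%:C + (- 'i%C) * (K p * (complex.Im (Psi p))%:C))); last first.
  by apply: eq_cintegral => p _; rewrite cE.
rewrite cintegralD //; last exact: cintegrableZ.
rewrite cintegralD //; last exact: cintegrableZ.
by rewrite !cintegralZ // HK // HK.
Qed.

Variable e : R.
Hypothesis e0 : 0 < e.

(** The two factors keep z1 away from the circle and z2/g(z1) away from modulus 1. In the
    coordinates of [twist] they separate into a function of z1 and a fixed function of w. *)
Definition weight (p : V4) : R := window e (sqnorm1 p) * ebump 0 (2^-1 - fiber_ratio g p).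

Lemma alg_weight : alg weight.
Proof.
apply: alg_mul; first exact: alg_window.
apply: alg_bump; apply: alg_add; first exact: alg_cst.
by apply: alg_opp; exact: alg_fiber_ratio.
Qed.

Lemma weight_ge0 p : 0 <= weight p.
Proof. by rewrite mulr_ge0 ?window_ge0 ?bump_ge0. Qed.

Lemma weight_le1 p : weight p <= 1.
Proof. by rewrite mulr_ile1 ?window_ge0 ?bump_ge0 ?window_le1 ?bump0_le1. Qed.

Lemma weight_test (f : V4 -> R) : alg f -> test_function W4 (fun p => f p * weight p).
Proof.
move=> af; apply: (@test_function_cut _ _ _ (fiber_ratio g) e 2^-1 (hbound Mg)).
- exact: alg_mul af alg_weight.
- exact: e0.
- exact: alg_fiber_ratio.
- move=> p Op r1; apply/(hartogs_ratio g_neq0 Op); apply: le_lt_trans r1 _.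
  by rewrite invf_lt1 // ltr1n.
- move=> p; rewrite /weight mulf_eq0 mulf_eq0 !negb_or => /and3P[_ h1 h2].
  have s1 : sqnorm1 p < 1 - e.
    by rewrite ltNge; apply/negP => h3; move: h1; rewrite window_out // eqxx.
  have r1 : fiber_ratio g p < 2^-1.
    rewrite ltNge; apply/negP => h3; move: h2; rewrite bump_neg ?eqxx //.
    by rewrite subr_le0.
  split; [exact: ltW|exact: ltW|apply: WM; apply/(hartogs_ratio g_neq0)].
    by apply/bidisc4E; apply: lt_trans s1 _; rewrite ltrBlDr ltrDl.
  by apply: lt_trans r1 _; rewrite invf_lt1 // ltr1n.
Qed.

Lemma calg_weight_test (F : V4 -> R[i]) : calg F -> let Psi p := F p * (weight p)%:C in
  [/\ calg Psi, test_function W4 (fun p => complex.Re (Psi p)) & test_function W4 (fun p => complex.Im (Psi p))].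
Proof.
move=> cF Psi; have [ar ai] := cF; split.
- by apply: calg_mul => //; apply: calg_real; exact: alg_weight.
- rewrite (_ : (fun p => _) = (fun p => complex.Re (F p) * weight p)); first exact: weight_test.
  by apply/funext => p; rewrite /Psi cReM /= mulr0 subr0.
- rewrite (_ : (fun p => _) = (fun p => complex.Im (F p) * weight p)); first exact: weight_test.
  by apply/funext => p; rewrite /Psi cImM /= mulr0 add0r.
Qed.

(** The integral of 1/|g|^2 over the disc, truncated so as to be finite from the start; [hmass_le]
    then bounds it independently of e. *)
Definition hmass : R := \int[mu2]_(p in D) (normc (h (toC p)) ^+ 2 * window e (sqn p)).

Lemma alg_hsq : alg (fun p : V4 => normc (h (toC p.1)) ^+ 2).
Proof.
have [ar ai] := calg_holo (cholo_hinv g_holo g_neq0).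
rewrite (_ : (fun p => _) = (fun p : V4 => complex.Re (h (toC p.1)) * complex.Re (h (toC p.1)) + complex.Im (h (toC p.1)) * complex.Im (h (toC p.1)))).
  by apply: alg_add; exact: alg_mul.
by apply/funext => p; rewrite normc_sqr !expr2.
Qed.

Lemma hmass_integrable : mu2.-integrable D (EFin \o (fun p => normc (h (toC p)) ^+ 2 * window e (sqn p))).
Proof.
apply: (@disc_alg_integrable (fun p => normc (h (toC p.1)) ^+ 2 * window e (sqnorm1 p)) e) => //.
  exact: alg_mul alg_hsq (alg_window e).
by move=> p _ h1; rewrite window_out ?mulr0 // ltW.
Qed.

Lemma fiber_ratio_cmul (p : R4) : fiber_ratio g p = sqn (cmul (h (toC p.1)) p.2).
Proof. by rewrite fiber_ratioE sqnE toC_cmul mulrC. Qed.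

Lemma fiber_bump_out (q : R2) : 1 <= normc (toC q) -> ebump 0 (2^-1 - sqn q) = 0.
Proof.
move=> q1; rewrite bump_neg // subr_le0 sqnE.
have : 1 <= normc (toC q) ^+ 2 by rewrite exprn_ege1.
by apply: le_trans; rewrite invf_le1 // ler1n.
Qed.

(** Of the four powers of |h|, two are the Jacobian consumed by [Rtwist] and two produce [hmass]. *)
Lemma hweight_integral :
  mu4.-integrable W4 (EFin \o (fun p => normc (h (toC p.1)) ^+ 4 * weight p)) /\
  \int[mu4]_(p in W4) (normc (h (toC p.1)) ^+ 4 * weight p) = hmass * bump_mass (R := R).
Proof.
have [ib <-] := fiber_bump_integrable.
have [i1 E1] := Rtwist g_holo g_neq0 hmass_integrable ib fiber_bump_out.
have E (p : R4) : normc (h (toC p.1)) ^+ 4 * weight p =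
  normc (h (toC p.1)) ^+ 2 * (normc (h (toC p.1)) ^+ 2 * window e (sqn p.1) * ebump 0 (2^-1 - sqn (cmul (h (toC p.1)) p.2))).
  have e4 (a b c : R) : a ^+ 4 * (b * c) = a ^+ 2 * (a ^+ 2 * b * c) by ring.
  by rewrite /weight fiber_ratio_cmul -[sqnorm1 p]/(sqn p.1); exact: e4.
split; first by move: i1; apply: eq_integrable => // p _; rewrite /= E.
by rewrite -E1; apply: eq_Rintegral => p _; exact: E.
Qed.

Lemma hmass_ge0 : 0 <= hmass.
Proof. by apply: Rintegral_ge0 => p _; rewrite mulr_ge0 ?sqr_ge0 ?window_ge0. Qed.

Lemma norm2_weight_le (F : V4 -> R[i]) : calg F ->
  (forall p, W4 p -> normc (F p) <= normc (h (toC p.1)) ^+ 2) ->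
  let Psi p := F p * (weight p)%:C in
  L2 W (func2 Psi) /\ norm2 W (func2 Psi) <= hmass * bump_mass (R := R).
Proof.
move=> cF hF Psi; have [cP _ _] := calg_weight_test cF.
have [i1 E1] := hweight_integral.
have [mr mi] := calg_measurable g_holo g_neq0 cP.
have le p : W4 p -> normsq (func2 Psi) p <= normc (h (toC p.1)) ^+ 4 * weight p.
  move=> Wp; rewrite normsqE func2E normcM exprMn normc_real (ger0_norm (weight_ge0 p)).
  have h1 : normc (F p) ^+ 2 <= normc (h (toC p.1)) ^+ 4.
    by rewrite (exprM _ 2 2) ler_pXn2r ?nnegrE ?normc_ge0 ?sqr_ge0 // hF.
  apply: le_trans (ler_wpM2r (sqr_ge0 _) h1) _.
  rewrite ler_wpM2l ?exprn_ge0 ?normc_ge0 // expr2 ler_piMr ?weight_ge0 ?weight_le1 //.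
have L := L2_le mW mr mi i1 le; split => //.
by rewrite -E1; apply: le_Rintegral => //; exact: L2_integrable.
Qed.

(** Tested against k times [weight], [H] pairs to [hmass] times [bump_mass], a quantity that also
    bounds the squared norm of the test function. Young's inequality with t = 2 lets half of it be
    absorbed. *)
Lemma hmass_le (H : C2 -> C) : L2 W H -> (forall phi, test_function W4 phi ->
    cintegral mu4 W4 (fun p => H (toC2 p) * (phi p)%:C) = cintegral mu4 W4 (fun p => k (toC p.1) * (phi p)%:C)) ->
  hmass * bump_mass (R := R) <= 4 * norm2 W H.
Proof.
move=> H2 HK; have ck := calg_holo (cholo_ksq g_holo g_neq0).
have [cP tr ti] := calg_weight_test ck.
have [|L Ln] := norm2_weight_le ck; first by move=> p _; rewrite /ksq normcX.
have E := inner_test H2 ck cP L tr ti HK.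
have [i1 E1] := hweight_integral.
have E2 : inner W H (func2 (fun p => k (toC p.1) * (weight p)%:C)) = (hmass * bump_mass (R := R))%:C.
  rewrite E -E1 /cintegral; apply: eq_complexP => /=.
    apply: eq_Rintegral => p _.
    have -> : normc (h (toC p.1)) ^+ 4 = normc (k (toC p.1)) ^+ 2 by rewrite /ksq normcX -exprM.
    by rewrite normc_sqr; case: (k _) => a b /=; ring.
  rewrite -[RHS](_ : \int[mu4]_(p in W4) 0 = 0); last by rewrite /Rintegral integral0.
  by apply: eq_Rintegral => p _; case: (k _) => a b /=; ring.
have t2 : (0 : R) < 2 by [].
have := normc_inner_le mW t2 H2 L; rewrite E2 normc_real ger0_norm; last first.
  by rewrite mulr_ge0 ?hmass_ge0 // ltW ?bump_mass_gt0.
exact: absorb_half.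
Qed.

(** The test function is z1^m |h|^2 [weight]: the |h|^2 supplies the Jacobian for [twist],
    conj(z1)^m isolates the m-th coefficient by [disc_mean], and the squared norm is controlled by
    [hmass_le]. *)
Lemma coef_window_le (H0 H5 : C2 -> C) m : L2 W H0 -> L2 W H5 ->
  (forall phi, test_function W4 phi ->
    cintegral mu4 W4 (fun p => H0 (toC2 p) * (phi p)%:C) = cintegral mu4 W4 (fun p => k (toC p.1) * (phi p)%:C)) ->
  (forall phi, test_function W4 phi ->
    cintegral mu4 W4 (fun p => H5 (toC2 p) * (phi p)%:C) = cintegral mu4 W4 (fun p => kj 5 (toC p.1) * (phi p)%:C)) ->
  normc (tcoef (kj 5) m) * \int[mu2]_(p in D) (normc (toC p) ^+ (2 * m) * window e (sqn p)) * bump_mass (R := R)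
   <= norm2 W H5 + 4 * norm2 W H0.
Proof.
move=> H02 H52 HK0 HK5; have hA := hmass_le H02 HK0.
have hk5 : cholo (kj 5) := cholo_kj g_holo g_neq0 5.
have ck := calg_holo hk5.
have czm := calg_holo (choloX m (@cholo_id R)).
have cF : calg (fun p : V4 => toC p.1 ^+ m * (normc (h (toC p.1)) ^+ 2)%:C).
  by apply: calg_mul => //; apply: calg_real; exact: alg_hsq.
have [cP tr ti] := calg_weight_test cF.
have [|L Ln] := norm2_weight_le cF.
  move=> p /WO Op; rewrite normcM normc_real ger0_norm ?sqr_ge0 // normcX.
  by rewrite ler_piMl ?sqr_ge0 // exprn_ile1 ?normc_ge0 // ltW.
have E := inner_test H52 ck cP L tr ti HK5.
have [ib Eb] := fiber_bump_integrable.
pose Fm (p : R2) := kj 5 (toC p) * conjc (toC p) ^+ m * (window e (normc (toC p) ^+ 2))%:C.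
have iF : cintegrable mu2 D Fm.
  have c1 : calg (fun p : V4 => kj 5 (toC p.1) * conjc (toC p.1 ^+ m) * (window e (sqnorm1 p))%:C).
    apply: calg_mul; first by apply: calg_mul => //; exact: calg_conj.
    by apply: calg_real; exact: alg_window.
  have z1 p : 1 - e < sqnorm1 p -> window e (sqnorm1 p) = 0.
    by move=> h1; rewrite window_out // ltW.
  have [cr ci] := c1.
  have FE (p : R2) : Fm p = kj 5 (toC p) * conjc (toC p ^+ m) * (window e (sqn p))%:C.
    by rewrite /Fm sqnE [conjc (_ ^+ _)](rmorphXn (@conjc R)).
  have zr p : bidisc4 p -> 1 - e < sqnorm1 p ->
      complex.Re (kj 5 (toC p.1) * conjc (toC p.1 ^+ m) * (window e (sqnorm1 p))%:C) = 0.
    by move=> _ /z1 ->; rewrite mulr0.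
  have zi p : bidisc4 p -> 1 - e < sqnorm1 p ->
      complex.Im (kj 5 (toC p.1) * conjc (toC p.1 ^+ m) * (window e (sqnorm1 p))%:C) = 0.
    by move=> _ /z1 ->; rewrite mulr0.
  split.
    have := disc_alg_integrable cr e0 zr; apply: eq_integrable => // p _.
    by rewrite /= FE.
  have := disc_alg_integrable ci e0 zi; apply: eq_integrable => // p _.
  by rewrite /= FE.
have [iT ET] := twist g_holo g_neq0 iF ib fiber_bump_out.
have cc (a b : R[i]) (x y : R) : conjc (a ^+ m * x%:C * y%:C) = x%:C * (conjc a ^+ m * y%:C).
  have -> : conjc a ^+ m = conjc (a ^+ m) by rewrite (rmorphXn (@conjc R)).
  by case: (a ^+ m) => u v; apply: eq_complexP => /=; ring.
have E2 : inner W H5 (func2 (fun p => toC p.1 ^+ m * (normc (h (toC p.1)) ^+ 2)%:C * (weight p)%:C)) =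
    cintegral mu2 D Fm * (bump_mass (R := R))%:C.
  rewrite E -Eb -ET; apply: eq_cintegral => p _.
  rewrite cc // /Fm /weight fiber_ratio_cmul -[sqnorm1 p]/(sqn p.1) sqnE rmorphM.
  by move: (kj 5 _) (conjc _ ^+ m) => a b; ring.
have iQ := window_integrable e m.
have E3 : cintegral mu2 D Fm = tcoef (kj 5) m * (\int[mu2]_(p in D) (normc (toC p) ^+ (2 * m) * window e (sqn p)))%:C.
  rewrite (disc_mean (Q := fun r => window e (r ^+ 2)) hk5 mD iF).
  have iQc : cintegrable mu2 D (fun p => (normc (toC p) ^+ (2 * m) * window e (normc (toC p) ^+ 2))%:C).
    split; last by apply: (eq_integrable mD (EFin \o cst 0)) => //; exact: integrable0.
    by move: iQ; apply: eq_integrable => // p _; rewrite /= sqnE.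
  rewrite (cintegralZ _ mD iQc); congr (_ * _).
  rewrite /cintegral; congr (_ +i* _); first by apply: eq_Rintegral => p _; rewrite sqnE.
  by rewrite /Rintegral integral0.
have := normc_inner_le mW ltr01 H52 L.
rewrite E2 E3 !normcM !normc_real (ger0_norm (ltW (bump_mass_gt0 (R := R)))) ger0_norm; last first.
  by apply: Rintegral_ge0 => p _; rewrite mulr_ge0 ?exprn_ge0 ?normc_ge0 ?window_ge0.
rewrite invr1 !mul1r => X; apply: le_trans X _; rewrite lerD2l.
exact: le_trans Ln hA.
Qed.

End Estimates.

(** * Decay of the coefficients of k and the dilation estimate *)

Section DilationEstimate.
Context {R : realType}.
Notation C := (R[i]^o)%type.
Notation C2 := (C * C)%type.
Notation R1 := (measurableTypeR R).
Notation R2 := (R1 * R1)%type.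
Notation mu2 := (@lebesgue2 R).
Notation D := (@discR2 R).

(** Only [1 - 3e, 1 - 2e] x [0, e] is kept. There |z|^2 <= 1 - 2e, so [window] is at least
    [ebump 0 1], and by Bernoulli |z|^(2m) >= 1 - 6 m e >= 1/2; this is where the 12 comes from. *)
Lemma window_integral_ge m (e : R) : e = (12 * m.+1%:R)^-1 ->
  2^-1 * ebump 0 1 * e ^+ 2 <= \int[mu2]_(p in D) (normc (toC p) ^+ (2 * m) * window e (sqn p)).
Proof.
move=> eE; have m0 : (1 : R) <= m.+1%:R by rewrite ler1n.
have e0 : 0 < e by rewrite eE invr_gt0 mulr_gt0.
have e12 : e <= 12^-1.
  by rewrite eE lef_pV2 ?posrE ?mulr_gt0 // ler_peMr.
have me : m%:R * e <= 12^-1.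
  rewrite eE invfM mulrCA ler_piMr ?invr_ge0 // ler_pdivrMr // mul1r ler_nat //.
have iQ : mu2.-integrable D (EFin \o (fun p => normc (toC p) ^+ (2 * m) * window e (sqn p))).
  exact: window_integrable.
have v0 : 0 <= 2^-1 * ebump 0 (1 : R) by rewrite mulr_ge0 ?invr_ge0 ?bump_ge0.
have -> : e ^+ 2 = ((1 - 2 * e) - (1 - 3 * e)) * (e - 0) by ring.
apply: Rintegral_disc_ge => //.
- by move=> p _; rewrite mulr_ge0 ?exprn_ge0 ?normc_ge0 ?window_ge0.
- by move: e0; clear; lra.
- exact: ltW.
move=> x y /andP[x1 x2] /andP[y1 y2].
have x0 : 0 <= x by move: e12 x1; clear; lra.
have sE : sqn (x, y) <= 1 - 2 * e.
  have hx : x ^+ 2 <= (1 - 2 * e) ^+ 2 by rewrite ler_pXn2r // nnegrE; move: e12; clear; lra.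
  have hy : y ^+ 2 <= e ^+ 2 by rewrite ler_pXn2r // nnegrE ltW.
  have he : e ^+ 2 <= 12^-1 * e by rewrite expr2 ler_wpM2r // ltW.
  have E : (1 - 2 * e) ^+ 2 = 1 - 4 * e + 4 * e ^+ 2 by ring.
  by rewrite /sqn /=; move: hx hy he e0; rewrite E; clear; lra.
have xp : 1 / 2 <= x ^+ (2 * m).
  have h3 : 0 <= 1 - 3 * e <= 1 by apply/andP; split; move: e12 e0; clear; lra.
  have /andP[_] := expr_sub1_le (2 * m) h3 => h4.
  have h6 : (2 * m)%:R * (1 - (1 - 3 * e)) = 6 * (m%:R * e) by rewrite natrM; ring.
  have h5 : (1 - 3 * e) ^+ (2 * m) <= x ^+ (2 * m).
    by apply: lerXn2r; rewrite ?nnegrE //; case/andP: h3.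
  apply: le_trans h5; move: h4 me; rewrite h6.
  by move: (m%:R * e) (_ ^+ _) => u v; clear; lra.
split; first by apply/discR2E; apply: le_lt_trans sE _; move: e0; clear; lra.
apply: ler_pM; rewrite ?bump_ge0 ?invr_ge0 //.
- rewrite -[2^-1]mul1r; apply: le_trans xp _; rewrite exprM [leRHS]exprM.
  have sx : x ^+ 2 <= normc (toC (x, y)) ^+ 2 by rewrite -sqnE /sqn /= lerDl sqr_ge0.
  by case: (m) => [|m']; [rewrite !expr0|rewrite ler_pXn2r ?nnegrE ?sqr_ge0].
- apply: bump0_nondecreasing; rewrite ler_pdivlMr // mul1r.
  by move: sE; clear; lra.
Qed.

Variable g : C -> C.
Hypothesis g_holo : cholo g.
Hypothesis g_neq0 : forall z, normc z < 1 -> g z != 0.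
Variable Mg : R.
Hypothesis g_le : forall z, normc z < 1 -> normc (g z) <= Mg.
Notation W := (hartogs g).
Notation k := (ksq g).
Hypothesis bergman_bounded : forall n : nat, sobolev_bounded W n (bergman_projection W).

(** The m-th coefficient of the n-th derivative is (m+1)...(m+n) times that of index m + n, and
    every factor is at least m + 1. *)
Lemma tcoef_derivatives (F : R[i] -> R[i]) n m : cholo F ->
  normc (tcoef F (m + n)) * m.+1%:R ^+ n <= normc (tcoef (iter n cD F) m) /\ cholo (iter n cD F).
Proof.
move=> hF; elim: n m => [|n IH] m; first by rewrite addn0 expr0 mulr1.
have [h1 h2] := IH m.+1; split; last exact: cholo_cD.
rewrite iterS tcoef_cD // normcM normc_nat addnS -addSn exprS mulrCA.
apply: ler_wpM2l => //; apply: le_trans h1; apply: ler_wpM2l; first exact: normc_ge0.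
by case: (n) => [|n']; [rewrite !expr0|rewrite ler_pXn2r ?nnegrE // ler_nat].
Qed.

Lemma ksq_dilation : exists2 L : R, 0 <= L & forall s z, 0 <= s <= 1 -> normc z < 1 ->
  normc (k (s%:C * z) - k z) <= L * (1 - s).
Proof.
have [H0 [H02 HK0]] := weak_target g_holo g_neq0 g_le bergman_bounded (isT : (0 <= 5)%N).
have [H5 [H52 HK5]] := weak_target g_holo g_neq0 g_le bergman_bounded (isT : (5 <= 5)%N).
have hk := cholo_ksq g_holo g_neq0.
pose N := norm2 W H5 + 4 * norm2 W H0.
pose b := 2^-1 * ebump 0 (1 : R) * bump_mass (R := R).
have b0 : 0 < b by rewrite !mulr_gt0 ?invr_gt0 ?bump_gt0 ?bump_mass_gt0.
(* 144 is the square of the 12 in e = 1/(12 M), with M = m + 1. The test mass b e^2 costs M^2 and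
   five derivatives gain M^5, which leaves M^3. *)
apply: (lipschitz_dilation (K := 144 * N / b) hk) => m.
pose M : R := m.+1%:R.
have M0 : 0 < M by rewrite ltr0n.
pose e : R := (12 * M)^-1.
have e0 : 0 < e by rewrite invr_gt0 mulr_gt0.
have h1 := coef_window_le g_holo g_neq0 g_le e0 m H02 H52 HK0 HK5.
have h2 := window_integral_ge (erefl : e = (12 * m.+1%:R)^-1).
have [h3 _] := tcoef_derivatives 5 m hk.
set a := normc (tcoef (iter 5 cD k) m) in h1 h3; set c := normc (tcoef k (m + 5)) in h3 *.
have h4 : a * (b * e ^+ 2) <= N.
  apply: le_trans h1; rewrite -mulrA; apply: ler_wpM2l; first exact: normc_ge0.
  rewrite /b mulrAC; apply: ler_wpM2r => //; exact: ltW (bump_mass_gt0 (R := R)).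
have h5 : c * M ^+ 5 * (b * e ^+ 2) <= N.
  by apply: le_trans h4; rewrite ler_pM2r // mulr_gt0 // exprn_gt0.
rewrite ler_pdivlMr // -/M.
have -> : c * M ^+ 3 * b = 144 * (c * M ^+ 5 * (b * e ^+ 2)).
  have fld (x y z : R) : y != 0 -> x * y ^+ 3 * z = 144 * (x * y ^+ 5 * (z * (12 * y)^-1 ^+ 2)).
    by move=> y0; field.
  by apply: fld; rewrite gt_eqF.
by rewrite ler_pM2l.
Qed.

End DilationEstimate.

(** * Stein neighbourhoods *)

Section ComplexPlane2.
Context {R : realType}.
Notation C := (R[i]^o)%type.
Notation C2 := (C * C)%type.
Notation V4 := ((R * R) * (R * R))%type.
Notation mu := (@lebesgue_measure R).

Lemma nbhs2P (z : C2) (P : set C2) : nbhs z P <-> exists2 d : R, 0 < d &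
  forall w : C2, normc (w.1 - z.1) < d -> normc (w.2 - z.2) < d -> P w.
Proof.
split.
  move=> [[A B] /= [/nbhs_normcP[d1 d10 h1] /nbhs_normcP[d2 d20 h2]] AB].
  exists (Num.min d1 d2); first by rewrite lt_min d10.
  move=> [w1 w2] /=; rewrite !lt_min => /andP[a1 _] /andP[_ a2].
  by apply: (AB (w1, w2)); split => /=; [exact: h1|exact: h2].
move=> [d d0 h]; exists ([set w : C | normc (w - z.1) < d], [set w : C | normc (w - z.2) < d]).
  by split; apply/nbhs_normcP; exists d.
by move=> [w1 w2] [/= a b]; exact: h.
Qed.

Lemma normc_continuous (z : C) : {for z, continuous ((fun w : C => normc w) : C -> R)}.
Proof.
move=> P /nbhs_ballP[e /= e0 eP]; apply/nbhs_normcP; exists e => // w wz.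
apply: eP; rewrite /ball /= ltr_norml; apply/andP; split.
  have := normc_dist w z; move: wz; move: (normc (w - z)) (normc w) (normc z) => a b c; clear; lra.
have := normc_dist z w; rewrite normcBC; move: wz; move: (normc (w - z)) (normc w) (normc z) => a b c; clear; lra.
Qed.

Lemma toC2_continuous : continuous (toC2 : V4 -> C2).
Proof.
move=> p P /nbhs2P[e e0 eP]; have e2 : 0 < e / 2 by exact: divr_gt0.
have nb (q : (R * R)%type) : nbhs q [set u : (R * R)%type | normc (toC u - toC q) < e].
  exists (ball q.1 (e / 2), ball q.2 (e / 2)); first by split; exact: nbhsx_ballx.
  move=> [x y] [hx hy].
  have h : normc (toC (x, y) - toC q) <= `|x - q.1| + `|y - q.2| := normc_ReIm _.
  apply: le_lt_trans h _; move: hx hy; rewrite /ball /= ![`|q.1 - _|]distrC ![`|q.2 - _|]distrC.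
  clear; lra.
exists ([set u : (R * R)%type | normc (toC u - toC p.1) < e], [set u : (R * R)%type | normc (toC u - toC p.2) < e]).
  by split; exact: nb.
by move=> q [h1 h2]; apply: eP.
Qed.

Lemma bounded_precompact (S : set C2) (M : R) :
  (forall z, S z -> normc z.1 <= M /\ normc z.2 <= M) -> precompact S.
Proof.
move=> SM; pose B : set C2 := toC2 @` (box4 M : set V4).
have cB : compact B.
  apply: continuous_compact; last exact: compact_box4.
  by apply: continuous_subspaceT => p; exact: toC2_continuous.
exists B; last by split => //; apply: compact_closed => //; exact: norm_hausdorff.
move=> z Sz; have [h1 h2] := SM _ Sz; exists (ofC2 z); last exact: ofC2K.
have b (x : R[i]) : normc x <= M -> box1 M (complex.Re x) /\ box1 M (complex.Im x).
  move=> h; rewrite /box1 /= !in_itv /= -!ler_norml; split.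
    exact: le_trans (Re_normc _) h.
  exact: le_trans (Im_normc _) h.
by have [a1 a2] := b _ h1; have [a3 a4] := b _ h2; split; split.
Qed.

(** A Lebesgue number for the compact set [K], found by shrinking d to 0 from the right in the
    near-covering form of compactness. *)
Lemma compact_uniform_nbhs (K U : set C2) : compact K -> (forall z, K z -> nbhs z U) ->
  exists2 d : R, 0 < d & forall z w, K z -> normc (w.1 - z.1) < d -> normc (w.2 - z.2) < d -> U w.
Proof.
move=> /compact_near_coveringP cK KU.
have H := cK R (0^'+) (fun d z => forall w : C2, normc (w.1 - z.1) < d -> normc (w.2 - z.2) < d -> U w) _.
have /H : forall z, K z -> \forall z' \near z & d \near 0^'+,
    forall w : C2, normc (w.1 - z'.1) < d -> normc (w.2 - z'.2) < d -> U w.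
  move=> z /KU /nbhs2P[d d0 dU]; have d2 : 0 < d / 2 by exact: divr_gt0.
  exists ([set z' : C2 | normc (z'.1 - z.1) < d / 2 /\ normc (z'.2 - z.2) < d / 2], [set x : R | x < d / 2]).
    split => /=; last by apply: nbhs_right_lt.
    by apply/nbhs2P; exists (d / 2).
  move=> [z' x] [/= [h1 h2] xd] w w1 w2; apply: dU.
    have -> : w.1 - z.1 = (w.1 - z'.1) + (z'.1 - z.1) by rewrite addrA subrK.
    apply: le_lt_trans (normcD _ _) _; move: h1 w1 xd.
    by move: (normc _) (normc _) => a b; clear; lra.
  have -> : w.2 - z.2 = (w.2 - z'.2) + (z'.2 - z.2) by rewrite addrA subrK.
  apply: le_lt_trans (normcD _ _) _; move: h2 w2 xd.
  by move: (normc _) (normc _) => a b; clear; lra.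
move=> HH; have HH2 : \forall d \near (0 : R)^'+, 0 < d by exact: nbhs_right_gt.
have [d [d0 hd]] := filter_ex (filterI HH2 HH).
by exists d => // z w Kz; exact: hd.
Qed.

Lemma contRC_continuous (f : R -> C) x : contRC f x -> {for x, continuous f}.
Proof.
move=> cf P /nbhs_normcP[e e0 eP]; have [d d0 h] := cf _ e0.
by apply/nbhs_ballP; exists d => //= y; rewrite /ball /= distrC => yx; apply: eP; exact: h.
Qed.

Lemma within_continuous_open (T : topologicalType) (W : set T) (f : T -> R) :
  (forall z, W z -> {for z, continuous f}) -> {within W, continuous f}.
Proof. by move=> cf; apply: continuous_in_subspaceT => z; rewrite inE; exact: cf. Qed.

Lemma differentiable_line (F : C2 -> C) (z w : C2) (t : C) : differentiable F (z + t *: w) ->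
  differentiable (fun s : C => F (z + s *: w) : C) t.
Proof.
move=> dF; have dl : differentiable (fun s : C => z + s *: w : C2) t.
  apply: differentiableD; first exact: differentiable_cst.
  by apply: differentiableZl; exact: ex_diff.
by refine (differentiable_comp dl dF).
Qed.

Lemma normc_inv (z : R[i]) : z != 0 -> normc z^-1 = (normc z)^-1.
Proof.
move=> z0; have n0 : normc z != 0 by rewrite normc_eq0.
by apply: (mulfI n0); rewrite -normcM !mulfV // [LHS]normc_real normr1.
Qed.

Section Subharmonic.
Variables (W : set C2) (F : C2 -> C).
Hypothesis dF : forall z, W z -> differentiable F z.
Hypothesis F1 : forall z, W z -> normc (F z) < 1.

Definition pole (z : C2) : R := (1 - normc (F z))^-1.

Lemma pole_continuous z : W z -> {for z, continuous pole}.
Proof.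
move=> Wz; have cF := differentiable_continuous (dF Wz).
have cN : {for z, continuous ((fun w => normc (F w)) : C2 -> R)}.
  by refine (continuous_comp cF (@normc_continuous _)).
apply: cvgV; first by rewrite gt_eqF // subr_gt0 F1.
by apply: cvgB; [exact: cvg_cst|exact: cN].
Qed.

(* If |m| = 1 and m F(z) = |F(z)|, then Re (1 / (1 - m F)) is harmonic on the
   line, equals [pole] at z, and is at most [pole] everywhere. *)
Lemma pole_subharmonic z w : (forall t : C, `|t| <= 1 -> W (z + t *: w)) ->
  mu.-integrable `[0, 2 * pi] (EFin \o (fun t => pole (z + expi t *: w))) /\
  pole z <= (2 * pi)^-1 * \int[mu]_(t in `[0, 2 * pi]) pole (z + expi t *: w).
Proof.
move=> Wt; have Wn (t : C) : normc t <= 1 -> W (z + t *: w).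
  by rewrite -lecR => t1; apply: Wt; exact: t1.
have p0 : (0 : R) < 2 * pi by rewrite mulr_gt0 ?pi_gt0.
pose f (t : C) : C := F (z + t *: w).
have df t : normc t <= 1 -> cderiv_at f t ('D_1 f t).
  by move=> t1; apply: differentiable_cderiv; apply: differentiable_line; exact: dF (Wn _ t1).
have f1 t : normc t <= 1 -> normc (f t) < 1 by move=> t1; apply: F1; exact: Wn.
have ce (t : R) : {for t, continuous (expi : R -> C)} by exact: contRC_continuous (contRC_expi t).
have cu (t : R) : {for t, continuous ((fun t => pole (z + expi t *: w)) : R -> R)}.
  have c1 : {for t, continuous ((fun t => z + expi t *: w) : R -> C2)}.
    by apply: cvgD; [exact: cvg_cst|apply: cvgZr_tmp; exact: ce].
  have Wtt : W (z + expi t *: w) by apply: Wn; rewrite normc_expi.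
  by refine (continuous_comp c1 (pole_continuous Wtt)).
have iu : mu.-integrable `[0, 2 * pi] (EFin \o (fun t => pole (z + expi t *: w))).
  apply: continuous_compact_integrable; first exact: segment_compact.
  by apply: continuous_subspaceT => t; exact: cu.
split=> //.
have [mm [m1 mE]] : exists m : R[i], normc m = 1 /\ m * f 0 = (normc (f 0))%:C.
  have [f0|f0] := eqVneq (f 0) 0; first by exists 1; rewrite f0 mulr0 normc0 [normc 1]normc_real normr1.
  have n0 : normc (f 0) != 0 by rewrite normc_eq0.
  exists (conjc (f 0) * ((normc (f 0))^-1)%:C); split.
    rewrite normcM normc_real ger0_norm ?invr_ge0 ?normc_ge0 //.
    rewrite (_ : normc (conjc _) = normc (f 0)) ?mulfV //.
    by case: (f 0) => a b /=; rewrite sqrrN.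
  rewrite mulrAC (_ : conjc (f 0) * f 0 = (normc (f 0) ^+ 2)%:C).
    by rewrite -rmorphM; congr (_%:C); rewrite expr2 mulfK.
  by rewrite normc_sqr; case: (f 0) => a b; apply: eq_complexP => /=; ring.
have nz t : normc t <= 1 -> 1 - normc (f t) <= normc (1 - mm * f t).
  move=> t1; have := normc_dist 1 (mm * f t).
  by rewrite [normc 1]normc_real normr1 normcM m1 mul1r.
have nz0 t : normc t <= 1 -> 1 - mm * f t != 0.
  by move=> t1; rewrite -normc_gt0; apply: lt_le_trans (nz _ t1); rewrite subr_gt0 f1.
pose G (t : R[i]) := (1 - mm * f t)^-1.
have dG t : normc t <= 1 -> exists l, cderiv_at G t l.
  move=> t1; have d1 := cderivZ (- mm) (df _ t1).
  have d2 := cderivD (cderiv_cst 1 t) d1.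
  have d3 : cderiv_at (fun s => 1 - mm * f s) t (0 + - mm * 'D_1 f t).
    apply: cderiv_ext d2; exists 1 => // s _; by rewrite mulNr.
  by eexists; apply: (cderiv_comp d3); exact: cderivV (nz0 _ t1).
have cG t : normc t <= 1 -> ccont G t by move=> /dG[l]; exact: cderiv_ccont.
have MV := mean_value ler01 cG (fun t t1 _ => dG t t1) (z0 := 0).
have Ge (t : R) : normc (expi t) <= 1 by rewrite normc_expi.
have iG : cintegrable mu `[0, 2 * pi] (fun t => G (1%:C * expi t)).
  by apply: cintegrable_circle => // t t1; apply: cG; rewrite t1.
have G0 : G 0 = ((1 - normc (f 0))^-1)%:C.
  rewrite /G mE (_ : 1 - (normc (f 0))%:C = (1 - normc (f 0))%:C); last by rewrite rmorphB.
  by rewrite fmorphV.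
have E0 : \int[mu]_(t in `[0, 2 * pi]) complex.Re (G (1%:C * expi t)) = 2 * pi * pole z.
  have := congr1 (@complex.Re R) MV; rewrite G0 -rmorphM /= => ->.
  by rewrite /pole /f scale0r addr0.
rewrite -(ler_pM2l p0) mulrA mulfV ?gt_eqF // mul1r -E0.
apply: le_Rintegral => //; first exact: iG.1.
move=> t _; rewrite mul1r.
apply: le_trans (ler_norm _) _; apply: le_trans (Re_normc _) _.
rewrite /G normc_inv ?nz0 // /pole lef_pV2 ?nz // posrE.
  by rewrite normc_gt0 nz0.
by rewrite subr_gt0; apply: f1.
Qed.

End Subharmonic.

End ComplexPlane2.

(** * The dilated domains as Stein neighbourhoods *)

Section SteinNeighbourhoods.
Context {R : realType}.
Notation C := (R[i]^o)%type.
Notation C2 := (C * C)%type.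
Notation mu := (@lebesgue_measure R).

Lemma closure_le (S : set C2) (f : C2 -> R) (c : R) z : closure S z -> {for z, continuous f} ->
  (forall w, S w -> f w <= c) -> f z <= c.
Proof.
move=> Sz cf Sc; rewrite leNgt; apply/negP => cz.
have : nbhs z (f @^-1` [set x | c < x]).
  by apply: cf; apply: open_nbhs_nbhs; split=> //; exact: open_gt.
by move=> /Sz[w [/Sc]]; rewrite /= leNgt => /negP.
Qed.

(** Induction: passing from n to n + 1 lowers the value, the gap being (n + 1) (1 - s)^2 times
    s^n. *)
Lemma expr_mul_sub_le1 (s : R) n : 0 <= s <= 1 -> s ^+ n * (1 + n%:R * (1 - s)) <= 1.
Proof.
move=> /andP[s0 s1]; elim: n => [|n IH]; first by rewrite expr0 mul0r addr0 mulr1.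
apply: le_trans IH; rewrite exprSr -mulrA; apply: ler_wpM2l; first exact: exprn_ge0.
rewrite -subr_ge0 -natr1 (_ : _ - _ = (n%:R + 1) * (1 - s) ^+ 2); last by ring.
by rewrite mulr_ge0 ?sqr_ge0 // addr_ge0.
Qed.

Lemma lt1_half (s x : R) : 2^-1 <= s -> 0 <= x -> s * x < 1 -> x <= 2.
Proof. by move=> s2 x0; have := ler_wpM2r x0 s2; lra. Qed.

Lemma sqr_le_bound (x B : R) : 0 <= B -> 0 <= x -> x ^+ 2 <= B -> x <= 2 + B.
Proof. by move=> B0 x0 h; nra. Qed.

Lemma half_le_onem (x : R) : x <= 2^-1 -> 2^-1 <= 1 - x.
Proof. by move=> h; lra. Qed.

Lemma ltD_quarter (a b d : R) : 0 < d -> a < d / 2 -> b <= d / 4 -> a + b < d.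
Proof. by move=> d0 ha hb; lra. Qed.

Variable k : R[i] -> R[i].
Hypothesis k_holo : cholo k.
Variable m0 : R.
Hypothesis m00 : 0 < m0.
Hypothesis k_ge : forall z, normc z < 1 -> m0 <= normc (k z).
Variable L : R.
Hypothesis k_dil : forall s z, 0 <= s <= 1 -> normc z < 1 -> normc (k (s%:C * z) - k z) <= L * (1 - s).
Variable N : nat.
Hypothesis LN : L <= N%:R * m0.

(** As L <= N m0 <= N |k(z)|, the additive error becomes a factor 1 + N (1 - s), which s^N cancels
    by [expr_mul_sub_le1]. *)
Lemma dilation_le s z : 0 <= s <= 1 -> normc z < 1 -> s ^+ N * normc (k (s%:C * z)) <= normc (k z).
Proof.
move=> s01 z1; have /andP[s0 s1] := s01.
have h1 : normc (k (s%:C * z)) <= normc (k z) * (1 + N%:R * (1 - s)).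
  rewrite -[X in normc X](subrK (k z)); apply: le_trans (normcD _ _) _.
  rewrite mulrDr mulr1 addrC lerD2l; apply: le_trans (k_dil s01 z1) _.
  rewrite mulrCA mulrA; apply: ler_wpM2r; first by rewrite subr_ge0.
  by apply: le_trans LN _; apply: ler_wpM2l => //; exact: k_ge.
apply: le_trans (ler_wpM2l (exprn_ge0 N s0) h1) _.
by rewrite mulrCA ler_piMr ?normc_ge0 // expr_mul_sub_le1.
Qed.

Definition model : set C2 := [set z | normc z.1 < 1 /\ normc (z.2 ^+ 2 * k z.1) < 1].

Section Domain.
Variable s : R.
Hypothesis s_ge : 2^-1 <= s.
Hypothesis s_lt1 : s < 1.

Let s0 : 0 < s. Proof. by apply: lt_le_trans s_ge; rewrite invr_gt0. Qed.
Let s01 : 0 <= s <= 1. Proof. by rewrite !ltW. Qed.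

Definition F1 (z : C2) : C := s%:C * z.1.
(* The power of [s] absorbs the Lipschitz error of [k], by [dilation_le]. *)
Definition F2 (z : C2) : C := (s ^+ N.+1)%:C * (z.2 ^+ 2 * k (s%:C * z.1)).
Definition dilated : set C2 := [set z | normc (F1 z) < 1 /\ normc (F2 z) < 1].

Lemma F1_differentiable z : differentiable (F1 : C2 -> C) z.
Proof. by apply: differentiableM; [exact: differentiable_cst|exact: fst_differentiable]. Qed.

Lemma F2_differentiable z : normc (F1 z) < 1 -> differentiable (F2 : C2 -> C) z.
Proof.
move=> z1; have [l dl] := k_holo z1.
have dk : differentiable (k : C -> C) (F1 z) by exact: cderiv_differentiable dl.
have E : F2 = (fun z : C2 => ((s ^+ N.+1)%:C : C) * ((z.2 * z.2) * ((k : C -> C) \o F1) z)).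
  by apply/funext => w; rewrite /F2 expr2.
rewrite E; apply: differentiableM; first exact: differentiable_cst.
apply: differentiableM; first by apply: differentiableM; exact: snd_differentiable.
by apply: differentiable_comp => //; exact: F1_differentiable.
Qed.

Lemma normcF1_continuous z : {for z, continuous ((fun w => normc (F1 w)) : C2 -> R)}.
Proof.
by refine (continuous_comp (differentiable_continuous (F1_differentiable z)) (@normc_continuous _ _)).
Qed.

Lemma normcF2_continuous z : normc (F1 z) < 1 -> {for z, continuous ((fun w => normc (F2 w)) : C2 -> R)}.
Proof.
move=> z1.
by refine (continuous_comp (differentiable_continuous (F2_differentiable z1)) (@normc_continuous _ _)).
Qed.

Lemma normcF1 z : normc (F1 z) = s * normc z.1.
Proof. by rewrite /F1 normcM normc_real ger0_norm // ltW. Qed.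

Lemma normcF2 z : normc (F2 z) = s ^+ N.+1 * (normc z.2 ^+ 2 * normc (k (s%:C * z.1))).
Proof. by rewrite /F2 normcM normc_real ger0_norm ?exprn_ge0 ?ltW // normcM normcX. Qed.

Lemma open_dilated : open dilated.
Proof.
rewrite openE => z [z1 z2]; apply: filterI.
  have c1 := @normcF1_continuous z.
  by refine (c1 [set x | x < 1] _); apply: open_nbhs_nbhs; split=> //; exact: open_lt.
have c2 := normcF2_continuous z1.
by refine (c2 [set x | x < 1] _); apply: open_nbhs_nbhs; split=> //; exact: open_lt.
Qed.

Lemma model_F z : model z -> normc (F1 z) <= s /\ normc (F2 z) <= s.
Proof.
move=> [z1 z2]; split; first by rewrite normcF1 ler_piMr ?ltW.
rewrite normcF2 exprS -mulrA ler_piMr ?ltW // mulrCA.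
apply: le_lt_trans (_ : normc z.2 ^+ 2 * normc (k z.1) < 1); last by rewrite -normcX -normcM.
by apply: ler_wpM2l; [exact: sqr_ge0|exact: dilation_le].
Qed.

Lemma closure_model : closure model `<=` dilated.
Proof.
move=> z cz.
have h1 : normc (F1 z) < 1.
  by apply: le_lt_trans s_lt1; apply: (closure_le cz (normcF1_continuous (z := z))) => w /model_F[].
split=> //; apply: le_lt_trans s_lt1.
by apply: (closure_le cz (normcF2_continuous h1)) => w /model_F[].
Qed.

(** From |F2| < 1, |k| >= m0 and s >= 1/2 one gets |z2|^2 <= 2^(N+1)/m0, and x^2 <= B implies x <= 2
    + B. The summand 2 also makes it a bound for z1. *)
Definition dbound : R := 2 + 2 ^+ N.+1 / m0.

Lemma dilated_bounded z : dilated z -> normc z.1 <= 2 /\ normc z.2 <= dbound.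
Proof.
move=> [z1 z2]; have n1 := normc_ge0 z.1; have n2 := normc_ge0 z.2.
split; first by move: z1; rewrite normcF1; exact: lt1_half.
have B0 : 0 <= 2 ^+ N.+1 / m0 by rewrite divr_ge0 ?exprn_ge0 // ltW.
have h : normc z.2 ^+ 2 <= 2 ^+ N.+1 / m0.
  rewrite ler_pdivlMr // -[leRHS]mulr1.
  have h1 : 2^-1 ^+ N.+1 <= s ^+ N.+1 by apply: lerXn2r; rewrite ?nnegrE ?invr_ge0 ?(ltW s0).
  have h2 : m0 <= normc (k (s%:C * z.1)) by exact: k_ge.
  have h3 : 2^-1 ^+ N.+1 * (normc z.2 ^+ 2 * m0) <= 1.
    apply: le_trans (ltW z2); rewrite normcF2; apply: ler_pM => //.
    - by rewrite mulr_ge0 ?sqr_ge0 // ltW.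
    - by apply: ler_wpM2l => //; exact: sqr_ge0.
  have p2 : (0 : R) < 2 ^+ N.+1 by exact: exprn_gt0.
  by move: h3; rewrite exprVn ler_pdivrMl // .
exact: sqr_le_bound.
Qed.

(** One factor s brings z1 into the disc, and the second is the dilation at s z1 for which
    [dilation_le] pays with s^N; hence s^2 in the first coordinate and s^(N+1) in the second. The
    displacement is of order 1 - s, so the neighbourhoods shrink. *)
Lemma dilated_near_model z : dilated z -> let w : C2 := ((s ^+ 2)%:C * z.1, (s ^+ N.+1)%:C * z.2) in
  [/\ model w, normc (z.1 - w.1) <= 4 * (1 - s) & normc (z.2 - w.2) <= N.+1%:R * dbound * (1 - s)].
Proof.
move=> dz w; have [z1 z2] := dz; have [b1 b2] := dilated_bounded dz; have /andP[s0' s1'] := s01.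
split.
- have E1 : w.1 = s%:C * F1 z by rewrite /w /F1 /= expr2 rmorphM mulrA.
  have w1 : normc w.1 < 1.
    rewrite E1 normcM normc_real ger0_norm // -[ltRHS]mulr1; apply: ltr_pM => //; exact: normc_ge0.
  split => //; rewrite E1 /w /= normcM normcX normcM normc_real ger0_norm ?exprn_ge0 // exprMn.
  have d := dilation_le s01 z1.
  have : s ^+ N.+1 * normc z.2 ^+ 2 * (s ^+ N * normc (k (s%:C * F1 z))) <= s ^+ N.+1 * normc z.2 ^+ 2 * normc (k (F1 z)).
    by apply: ler_wpM2l => //; rewrite mulr_ge0 ?exprn_ge0 ?normc_ge0.
  move=> h; have h2 : s ^+ N.+1 * normc z.2 ^+ 2 * normc (k (F1 z)) < 1 by rewrite -mulrA -normcF2.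
  have h3 := le_lt_trans h h2.
  have -> : (s ^+ N.+1) ^+ 2 * normc z.2 ^+ 2 * normc (k (s%:C * F1 z)) =
     s * (s ^+ N.+1 * normc z.2 ^+ 2 * (s ^+ N * normc (k (s%:C * F1 z)))).
    rewrite !exprS; move: (s ^+ N) (normc z.2) (normc (k _)) => a b c; ring.
  rewrite -[ltRHS]mulr1; apply: ltr_pM => //.
  by rewrite !mulr_ge0 ?exprn_ge0 ?normc_ge0.
- rewrite /w /= -{1}[z.1]mul1r -mulrBl (_ : 1 - (s ^+ 2)%:C = (1 - s ^+ 2)%:C); last by rewrite rmorphB.
  rewrite normcM normc_real ger0_norm; last by rewrite subr_ge0 exprn_ile1.
  apply: le_trans (ler_wpM2l _ b1) _; first by rewrite subr_ge0 exprn_ile1.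
  rewrite -subr_ge0 (_ : _ - _ = 2 * (1 - s) ^+ 2); last by ring.
  by rewrite mulr_ge0 ?sqr_ge0.
- rewrite /w /= -{1}[z.2]mul1r -mulrBl (_ : 1 - (s ^+ N.+1)%:C = (1 - s ^+ N.+1)%:C); last by rewrite rmorphB.
  have /andP[e1 e2] := expr_sub1_le N.+1 s01.
  rewrite normcM normc_real ger0_norm // mulrAC; apply: ler_pM => //; exact: normc_ge0.
Qed.

(** Two segments join each point to the origin: shrinking z2 to 0 first only decreases |F2|, and
    with z2 = 0 the first coordinate can be shrunk freely. *)
Lemma dilated_connected : connected dilated.
Proof.
pose pieces (z : C2) : set C2 := ((fun t : R => (t%:C * z.1, 0) : C2) @` `[0, 1]) `|` ((fun t : R => (z.1, t%:C * z.2) : C2) @` `[0, 1]).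
have e01 (b : bool) : `[0 : R, 1]%classic (b%:R) by rewrite /= in_itv /=; case: b; rewrite ?lexx ler01.
have -> : dilated = \bigcup_(z in dilated) pieces z.
  apply/seteqP; split=> [z dz|w [z [z1 z2]]].
    by exists z => //; right; exists 1; [exact: (e01 true)|rewrite mul1r; case: (z)].
  move=> [] [t]; rewrite /= in_itv /= => /andP[t0 t1] <-.
    split; rewrite ?normcF1 ?normcF2.
      rewrite normcM normc_real ger0_norm // mulrCA -normcF1.
      by apply: le_lt_trans z1; rewrite ler_piMl ?normc_ge0.
    by rewrite [normc _](@normc0 R) expr0n mul0r mulr0 ltr01.
  split; first by rewrite normcF1 /= -normcF1.
  rewrite normcF2 /= normcM normc_real ger0_norm // exprMn.
  apply: le_lt_trans z2; rewrite normcF2 -mulrA mulrCA ler_piMl ?exprn_ile1 //.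
  by rewrite !mulr_ge0 ?exprn_ge0 ?normc_ge0 // ltW.
have ct (t : R) : {for t, continuous ((fun t : R => t%:C) : R -> C)}.
  move=> P /nbhs_normcP[e e0 eP]; apply/nbhs_ballP; exists e => //= y; rewrite /ball /= distrC => yt.
  by apply: eP; rewrite -rmorphB normc_real.
have cm (a : C) (t : R) : {for t, continuous ((fun t : R => t%:C * a) : R -> C)}.
  by refine (cvgMr_tmp (ct t)).
apply: bigcup_connected.
  by exists (0, 0) => z _; left; exists 0; [exact: (e01 false)|rewrite mul0r].
move=> z dz; apply: connectedU.
- exists (z.1, 0); split; first by exists 1; [exact: (e01 true)|rewrite mul1r].
  by exists 0; [exact: (e01 false)|rewrite mul0r].
- apply: connected_continuous_connected; first exact: segment_connected.
  by apply: continuous_subspaceT => t; refine (cvg_pair (cm _ t) (cvg_cst _)).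
- apply: connected_continuous_connected; first exact: segment_connected.
  by apply: continuous_subspaceT => t; refine (cvg_pair (cvg_cst _) (cm _ t)).
Qed.

Definition exhaustion (z : C2) : R := pole F1 z + pole F2 z.

Lemma pole_gt0 (F : C2 -> C) z : normc (F z) < 1 -> 0 < pole F z.
Proof. by move=> h; rewrite invr_gt0 subr_gt0. Qed.

Lemma pole_lt (F : C2 -> C) z c : normc (F z) < 1 -> pole F z < c -> normc (F z) <= 1 - c^-1.
Proof.
move=> h hc; have c0 : 0 < c := lt_trans (pole_gt0 h) hc.
have : c^-1 < 1 - normc (F z).
  by rewrite -[ltRHS]invrK ltf_pV2 ?posrE // invr_gt0 subr_gt0.
by rewrite ltrBrDr -ltrBrDl => /ltW.
Qed.

Lemma dilated_pseudoconvex : pseudoconvex_domain dilated.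
Proof.
split.
- exists (0, 0); split; rewrite ?normcF1 ?normcF2 !(@normc0 R) ?mulr0 ?ltr01 //.
  by rewrite expr0n mul0r mulr0 ltr01.
- exact: open_dilated.
- exact: dilated_connected.
have d1 z : dilated z -> differentiable (F1 : C2 -> C) z by move=> _; exact: F1_differentiable.
have d2 z : dilated z -> differentiable (F2 : C2 -> C) z by move=> [z1 _]; exact: F2_differentiable.
have l1 z : dilated z -> normc (F1 z) < 1 by case.
have l2 z : dilated z -> normc (F2 z) < 1 by case.
exists exhaustion; split.
  split.
    apply: within_continuous_open => z dz.
    by apply: cvgD; [exact: (pole_continuous d1 l1)|exact: (pole_continuous d2 l2)].
  move=> z w zw; have [i1 h1] := pole_subharmonic d1 l1 zw; have [i2 h2] := pole_subharmonic d2 l2 zw.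
  rewrite /exhaustion RintegralD // mulrDr.
  exact: lerD.
move=> c; set S := [set z | _].
(* Both poles are positive, so each is below c, which means |F1|, |F2| <= 1 - 1/c: a non-strict
   bound that passes to the closure and stays below 1. *)
have Sb z : S z -> normc (F1 z) <= 1 - c^-1 /\ normc (F2 z) <= 1 - c^-1 /\ 0 < c.
  move=> [[z1 z2] zc]; have p1 := pole_gt0 z1; have p2 := pole_gt0 z2.
  split; first by apply: pole_lt => //; apply: lt_trans zc; rewrite ltrDl.
  split; first by apply: pole_lt => //; apply: lt_trans zc; rewrite ltrDr.
  by apply: lt_trans zc; rewrite addr_gt0.
split.
  apply: (@bounded_precompact _ _ dbound) => z [dz _]; have [b1 b2] := dilated_bounded dz; split => //.
  by apply: le_trans b1 _; rewrite lerDl divr_ge0 ?exprn_ge0 // ltW.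
move=> z cz; have [w [Sw _]] : S `&` setT !=set0 by apply: cz; exact: filterT.
have [_ [_ c0]] := Sb _ Sw.
have c1 : 1 - c^-1 < 1 by rewrite ltrBlDr ltrDl invr_gt0.
have h1 : normc (F1 z) < 1.
  by apply: le_lt_trans c1; apply: (closure_le cz (normcF1_continuous (z := z))) => u /Sb[].
split=> //; apply: le_lt_trans c1.
by apply: (closure_le cz (normcF2_continuous h1)) => u /Sb[_ []].
Qed.

End Domain.

Lemma model_stein_basis : stein_neighborhood_basis (closure model).
Proof.
have half1 : (2^-1 : R) < 1 by rewrite invf_lt1 // ltr1n.
have mB z : closure model z -> normc z.1 <= 2 /\ normc z.2 <= dbound.
  move=> cz; have r : (2^-1 : R) <= 2^-1 by [].
  exact: (dilated_bounded r (closure_model r half1 cz)).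
have db2 : 2 <= dbound by rewrite lerDl divr_ge0 ?exprn_ge0 // ltW.
have pK : precompact (closure model).
  apply: (@bounded_precompact _ _ dbound) => z /mB[b1 b2]; split => //.
  exact: le_trans b1 db2.
have cK : compact (closure model) by rewrite -precompact_closed //; exact: closed_closure.
move=> U KU; have [d d0 hd] := compact_uniform_nbhs cK KU.
pose B : R := 4 + N.+1%:R * dbound.
have db0 : 0 <= dbound by apply: le_trans db2.
have B0 : 0 < B by rewrite ltr_wpDr ?mulr_ge0.
(* [B] times 1 - s dominates both displacements in [dilated_near_model], so they cost at most d/4;
   d/2 is spent on passing from the closure to the domain. The bound 1/2 keeps s >= 1/2. *)
pose eta : R := Num.min 2^-1 (d / 4 / B).
have eta0 : 0 < eta by rewrite lt_min invr_gt0 ltr0n !divr_gt0.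
have etaB : B * eta <= d / 4.
  by rewrite mulrC -ler_pdivlMr // ge_min lexx orbT.
have eta2 : eta <= 2^-1 by rewrite ge_min lexx.
pose s := 1 - eta.
have s_ge : 2^-1 <= s by exact: half_le_onem.
have s_lt : s < 1 by rewrite /s ltrBlDr ltrDl.
exists (dilated s); split.
- exact: dilated_pseudoconvex.
- split=> //; rewrite -(closure_id _).1; last exact: closed_closure.
  exact: closure_model.
split.
  apply: (@bounded_precompact _ _ dbound) => z /(dilated_bounded s_ge)[b1 b2]; split => //.
  exact: le_trans b1 db2.
move=> z cz.
have [w [dw [w1 w2]]] : dilated s `&` [set w : C2 | normc (w.1 - z.1) < d / 2 /\ normc (w.2 - z.2) < d / 2] !=set0.
  by apply: cz; apply/nbhs2P; exists (d / 2) => //; exact: divr_gt0.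
have [mw a1 a2] := dilated_near_model s_ge s_lt dw.
set u : C2 := (_, _) in mw a1 a2.
have es : 1 - s = eta by rewrite /s opprB addrC subrK.
have e1 : 4 * (1 - s) <= d / 4.
  by apply: le_trans etaB; rewrite es; apply: (ler_wpM2r (ltW eta0)); rewrite lerDl mulr_ge0.
have e2 : N.+1%:R * dbound * (1 - s) <= d / 4.
  by apply: le_trans etaB; rewrite es; apply: (ler_wpM2r (ltW eta0)); rewrite lerDr.
apply: (hd u).
- exact: subset_closure.
- have -> : z.1 - u.1 = (z.1 - w.1) + (w.1 - u.1) by rewrite addrA subrK.
  apply: le_lt_trans (normcD _ _) _; rewrite [normc (z.1 - _)]normcBC.
  exact: ltD_quarter d0 w1 (le_trans a1 e1).
- have -> : z.2 - u.2 = (z.2 - w.2) + (w.2 - u.2) by rewrite addrA subrK.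
  apply: le_lt_trans (normcD _ _) _; rewrite [normc (z.2 - _)]normcBC.
  exact: ltD_quarter d0 w2 (le_trans a2 e2).
Qed.

End SteinNeighbourhoods.
Lemma bounded_disc_normc (R : realType) (g : R[i]^o -> R[i]^o) : [bounded g z | z in disc] ->
  exists2 M : R, 0 < M & forall z, normc z < 1 -> normc (g z) <= M.
Proof.
move=> /pinfty_ex_gt0[[a b]]; rewrite ltcE /= => /andP[/eqP b0 a0] h; exists a => // z z1.
have /h : disc z by apply/disc_normc.
by rewrite b0 => hz; rewrite -(lecR (normc (g z)) a); exact: hz.
Qed.

Lemma hartogs_model (R : realType) (g : R[i]^o -> R[i]^o) :
  (forall z, normc z < 1 -> g z != 0) -> hartogs g = model (ksq g).
Proof.
move=> g0; have E (z : R[i]^o * R[i]^o) : normc z.1 < 1 ->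
    (normc (z.2 ^+ 2 * ksq g z.1) < 1) = (normc z.2 < normc (g z.1)).
  move=> z1; have gz : 0 < normc (g z.1) by rewrite lt0r normc_eq0 g0 ?normc_ge0.
  rewrite /ksq /hinv -exprMn normcX expr_lt1 ?normc_ge0 // normcM normc_inv ?g0 //.
  by rewrite ltr_pdivrMr // mul1r.
apply/seteqP; split=> z [].
  by move=> /disc_normc z1; rewrite normc_lt_real => h; split=> //; rewrite E.
by move=> z1; rewrite E // => h; split; [exact/disc_normc|rewrite normc_lt_real].
Qed.

Theorem theorem8 (R : realType) (g : R[i]^o -> R[i]^o)
    (g_holomorphic : holomorphic disc g)
    (g_nonconstant : ~ exists c, forall z, disc z -> g z = c)
    (g_nonvanishing : forall z, disc z -> g z != 0)
    (g_bounded : [bounded g z | z in disc])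
    (bergman_bounded : forall k : nat,
       sobolev_bounded (hartogs g) k (bergman_projection (hartogs g))) :
  stein_neighborhood_basis (closure (hartogs g)).
Proof.
have g_holo : cholo g.
  by move=> z /disc_normc z1; exists ('D_1 g z); apply: differentiable_cderiv; exact: g_holomorphic.
have g_neq0 z : normc z < 1 -> g z != 0 by move=> /disc_normc; exact: g_nonvanishing.
have [M M0 g_le] := bounded_disc_normc g_bounded.
have [L L0 k_dil] := ksq_dilation g_holo g_neq0 g_le bergman_bounded.
(* |g| <= M gives the lower bound |k| = 1/|g|^2 >= 1/M^2 on the disc. *)
have m0 : 0 < (M ^- 2) by rewrite invr_gt0 exprn_gt0.
have k_ge z : normc z < 1 -> M ^- 2 <= normc (ksq g z).
  move=> z1; have gz : 0 < normc (g z) by rewrite lt0r normc_eq0 g_neq0 ?normc_ge0.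
  rewrite /ksq /hinv normcX normc_inv ?g_neq0 // -exprVn lerXn2r ?nnegrE ?invr_ge0 ?normc_ge0 ?(ltW M0) //.
  by rewrite lef_pV2 ?posrE // g_le.
rewrite (hartogs_model g_neq0).
(* N is an integer at least L divided by the lower bound of |k|, as [dilation_le] requires. *)
apply: (model_stein_basis (cholo_ksq g_holo g_neq0) m0 k_ge k_dil (N := Num.bound (L / M ^- 2))).
by rewrite -ler_pdivrMr // ltW // archi_boundP // divr_ge0 // ltW.
Qed.
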